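(* (I) Let $d\ge 3$. There exist symmetric Borel probability measures $\mu$ on $(\mathfrak{S}(\mathbb{Z}^d),\mathcal{T})$ such that the random walk on $\mathbb{Z}^d$ in the conductances $C_\mu$ is transient, and there are constants $b,B>0$ with $$\frac{C_\mu(x,y)}{C_\mu(x)}\le B\,e^{-b\|x-y\|_2}\qquad\text{for all }x,y\in\mathbb{Z}^d,$$ and such that, furthermore, if $(\tau_n)_{n\ge 0}$ is the random walk on $\mathfrak{S}(\mathbb{Z}^d)$ induced by $\mu$, then its inverted orbits $(O_n)_{n\ge 0}$ satisfy $$e^{-n\log(2)\,\mathbb{P}[T=\infty]+o(n)}\;\le\;\mathbb{E}\Big[\big(\tfrac12\big)^{|O_n|}\Big]\;\le\; e^{-\frac{n+1}{2}\,\mathbb{P}[T=\infty]},$$ where $\mathbb{P}[T=\infty]$ is the probability that the random walk $n\mapsto\tau_n(0)$ (a random walk in the conductances $C_\mu$ started at the origin) never returns to the origin, and $o(n)$ is as $n\to\infty$. (II) For $d=2$, there exist symmetric Borel probability measures $\mu$ on $(\mathfrak{S}(\mathbb{Z}^2),\mathcal{T})$ such that there is $k\in L^1(\mathbb{Z}^2)$ with $\frac{C_\mu(x,y)}{C_\mu(x)}\le k(x-y)$ for all $x,y\in\mathbb{Z}^2$, and such that the inverted orbits $(O_n)_{n\ge0}$ of the random walk on $\mathfrak{S}(\mathbb{Z}^2)$ induced by $\mu$ satisfy neither of the following two (equivalent) properties: (i) for any $\varepsilon>0$, $\mathbb{P}[|O_n|\le\varepsilon n]\ge e^{-\varepsilon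 n}$ for $n$ large enough; (ii) $\lim_{n\to\infty}\frac1n\log\mathbb{E}[(\frac12)^{|O_n|}]=0$.
   Context: $\mathfrak{S}(\mathbb{Z}^d)$ is the group of all permutations (bijections) of $\mathbb{Z}^d$, with the topology $\mathcal{T}$ of pointwise convergence ($\sigma_n\to\sigma$ iff $\sigma_n(x)\to\sigma(x)$ for every $x$); it is a Polish space. A Borel probability measure $\mu$ on it (possibly diffuse) is symmetric if $\mu(A)=\mu(A^{-1})$ for every Borel set $A$, where $A^{-1}=\{\sigma:\sigma^{-1}\in A\}$. The random walk induced by $\mu$ is $\tau_0=\mathrm{Id}$, $\tau_n=s_n\circ\cdots\circ s_1$ with $(s_i)_{i\ge1}$ i.i.d. of law $\mu$. Its inverted orbit of the origin is $$O_n=\{x\in\mathbb{Z}^d:\exists j\in\{0,1,\ldots,n\},\ \tau_j(x)=0\}=\bigcup_{0\le j\le n}\tau_j^{-1}(\{0\}).$$ The conductances associated to $\mu$ are $C_\mu(x,y):=\mu(\{\sigma:\sigma(x)=y\})+\mu(\{\sigma:\sigma(y)=x\})$ and $C_\mu(x):=\sum_yC_\mu(x,y)$. The random walk in the conductances $C_\mu$ is the Markov chain on $\mathbb{Z}^d$ with transition probabilities $C_\mu(x,y)/C_\mu(x)$; for each $x$, $n\mapsto\tau_n(x)$ is such a walk started at $x$. The return time is $T=\inf\{n\ge1:\tau_n(0)=0\}$. *)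

(* Defs.v *)
From HB Require Import structures.
From mathcomp Require Import all_boot all_order all_algebra finmap.
From mathcomp Require Import all_classical all_reals all_analysis.
Import Order.TTheory GRing.Theory Num.Theory.
Import numFieldNormedType.Exports.

Set Implicit Arguments.
Unset Strict Implicit.
Unset Printing Implicit Defensive.

Local Open Scope classical_set_scope.
Local Open Scope ring_scope.

(* Carrying the inverse adds no data: it is determined by the function, see
   [sym_eqP]. *)
Record sym (X : Type) := Sym {
  sym_fun :> X -> X;
  sym_inv_fun : X -> X;
  sym_funK : cancel sym_fun sym_inv_fun;
  sym_inv_funK : cancel sym_inv_fun sym_fun }.

Lemma sym_eqP (X : Type) (s t : sym X) : (s : X -> X) = t -> s = t.
Proof.
case: s t => [f f' fK f'K] [g g' gK g'K] /= efg.
rewrite -efg in gK g'K *.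
have e' : f' = g' by apply/funext => x; rewrite -[x in LHS]g'K fK.
by rewrite -e' in gK g'K *; congr Sym; exact: Prop_irrelevance.
Qed.

Lemma bij_symE (X : Type) (f : X -> X) :
  bijective f -> exists s : sym X, (s : X -> X) = f.
Proof. by case=> g fK gK; exists (Sym fK gK). Qed.

Definition sym_id {X : Type} : sym X :=
  @Sym X id id (fun=> erefl) (fun=> erefl).

Definition sym_inv {X : Type} (s : sym X) : sym X :=
  Sym (sym_inv_funK s) (sym_funK s).

Definition sym_comp {X : Type} (s t : sym X) : sym X :=
  @Sym X (s \o t) (sym_inv_fun t \o sym_inv_fun s)
    (can_comp (sym_funK s) (sym_funK t))
    (can_comp (sym_inv_funK t) (sym_inv_funK s)).

HB.instance Definition _ (X : Type) := gen_eqMixin (sym X).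
HB.instance Definition _ (X : Type) := gen_choiceMixin (sym X).
HB.instance Definition _ (X : Type) := isPointed.Build (sym X) sym_id.

Definition sym_to_fun (X : choiceType) (s : sym X) :
  {ptws X -> discrete_topology X} := s : X -> X.

(* The topology of pointwise convergence, X being discrete. *)
Notation sym_topology X := (initial_topology (@sym_to_fun X)).

Notation borel_sym X := (g_sigma_algebraType (@open (sym_topology X))).

Section conductances.
Context {R : realType} {X : choiceType}.
Variable mu : probability (borel_sym X) R.

Definition symmetric_law : Prop :=
  forall A : set (borel_sym X), measurable A -> mu A = mu (sym_inv @^-1` A).

Definition conductance (x y : X) : \bar R :=
  (mu [set s : sym X | s x = y] + mu [set s : sym X | s y = x])%E.

Definition conductance_at (x : X) : \bar R :=
  (\esum_(y in [set: X]) conductance x y)%E.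

(* Both factors are finite: [conductance_at x] is a priori an extended real,
   but equals 2 for every x. *)
Definition conductance_walk (x y : X) : R :=
  fine (conductance x y) / fine (conductance_at x).

End conductances.

Section processes.
Context {R : realType} {d : measure_display} {Omega : measurableType d}.
Variable P : probability Omega R.

Definition return_time (X : Type) (Y : nat -> Omega -> X) (a : X) (w : Omega) :
    \bar R :=
  ereal_inf [set n%:R%:E | n in [set n : nat | (0 < n)%N /\ Y n w = a]].

Definition never_returns (X : Type) (Y : nat -> Omega -> X) (a : X) : R :=
  fine (P [set w | return_time Y a w = +oo%E]).

(* The state space is countable in all uses. The Markov property is written
   without conditioning:
   P(Y_0 = u_0, ..., Y_(n+1) = u_(n+1))
     = P(Y_0 = u_0, ..., Y_n = u_n) p(u_n, u_(n+1)). *)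
Definition markov_chain (X : Type) (p : X -> X -> R) (a : X)
    (Y : nat -> Omega -> X) : Prop :=
  [/\ forall n x, measurable [set w | Y n w = x],
      P [set w | Y 0%N w = a] = 1%E &
      forall (n : nat) (u : nat -> X),
        P [set w | forall i, (i <= n.+1)%N -> Y i w = u i] =
        (P [set w | forall i, (i <= n)%N -> Y i w = u i] *
         (p (u n) (u n.+1))%:E)%E].

Definition iid_law {d'} {T : measurableType d'} (mu : probability T R)
    (s : nat -> {RV P >-> T}) : Prop :=
  (forall i (A : set T), measurable A -> P (s i @^-1` A) = mu A) /\
  (forall (I : {fset nat}) (A : nat -> set T),
    (forall i, measurable (A i)) ->
    P (\bigcap_(i in [set` I]) s i @^-1` A i) =
    (\big[*%E/1%E]_(i <- I) P (s i @^-1` A i))%E).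

End processes.

(* Every state a has positive probability of no return. As [p] is used only for
   stochastic matrices, a chain started at a exists and all of them have the
   same law. *)
Definition transient (R : realType) (X : Type) (p : X -> X -> R) : Prop :=
  forall (a : X) (d : measure_display) (Omega : measurableType d)
    (P : probability Omega R) (Y : nat -> Omega -> X),
  markov_chain P p a Y -> 0 < never_returns P Y a.

Section inverted_orbits.
Context {X : choiceType} {Omega : Type}.
Variable s : nat -> Omega -> sym X.

(* The steps are indexed from 0: s_(n+1) of the usual indexing is [s n]. *)
Fixpoint walk (n : nat) (w : Omega) : sym X :=
  if n is m.+1 then sym_comp (s m w) (walk m w) else sym_id.

Definition inverted_orbit (o : X) (n : nat) (w : Omega) : set X :=
  [set x | exists2 j, (j <= n)%N & walk j w x = o].

(* [inverted_orbit o n w] has at most n + 1 elements, so [fset_set] is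
   faithful. *)
Definition inverted_orbit_card (o : X) (n : nat) (w : Omega) : nat :=
  #|` fset_set (inverted_orbit o n w)|.

End inverted_orbits.

Section orbit_asymptotics.
Context {R : realType} {d : measure_display} {Omega : measurableType d}.
Variable P : probability Omega R.
Variable N : nat -> Omega -> nat.

Definition half_pow_mean (n : nat) : \bar R :=
  'E_P[(fun w => 2^-1 ^+ N n w : R)%R]%E.

Definition slow_orbits : Prop :=
  forall eps : R, 0 < eps -> \forall n \near \oo,
    ((expR (- (eps * n%:R)))%:E <= P [set w | ((N n w)%:R <= eps * n%:R)%R])%E.

Definition subexponential_mean : Prop :=
  (fun n : nat => ln (fine (half_pow_mean n)) / n%:R) @ \oo --> (0 : R).

End orbit_asymptotics.

Definition norm2 (R : realType) (d : nat) (x : 'rV[int]_d) : R :=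
  Num.sqrt (\sum_(i < d) ((x 0 i)%:~R) ^+ 2).

(* Main.v *)
(* Let s be a product of layers, each of which swaps the pairs of a fixed matching, every
   pair with its own independent coin. Two particles a, b of the same pair satisfy
   E[f(s a) f(s b)] = f(a) f(b) <= E[f(s a)] E[f(s b)] for f >= 0, so a layer, and then any
   composition of independent layers, satisfies
     E[prod_x f(s x)] <= prod_x E[f(s x)].
   By induction on time, the probability that no particle of a finite set visits the origin is
   at most the product of the one-particle probabilities. Keeping each particle with
   probability 1/2 this gives E[2^-|O_n|] <= prod_x (1 - P(x in O_n) / 2)
   <= exp(- E|O_n| / 2), and E|O_n| = sum_(k <= n) P(T > k) >= (n + 1) P(T = oo) by counting
   each point of the orbit at its last occurrence. The lower bound is Jensen's inequality.

   Symmetry of the law is obtained by composing the layers in palindromic order. For d >= 3 we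
   use, in each coordinate, the two matchings of consecutive integers: the walk induced on
   blocks of side 2 has return probabilities (C(2n, n) / 4^n)^d, which are summable. For d = 2
   the layer m flips the binary digit m of the first coordinate with probability
   c_m = 2^-(floor(m/3) + 1); the digits of the walk are then independent, its return
   probabilities are O(n^-2), and its kernel is dominated by a translation invariant one,
   a convolution of measures of total masses 1 + 2 c_m. *)
Require Import Defs.
From HB Require Import structures.
From mathcomp Require Import finmap all_boot all_order all_algebra.
From mathcomp Require Import all_classical all_reals all_analysis.
From mathcomp Require Import measurable_realfun ring lra zify.
Import Order.TTheory GRing.Theory Num.Theory.
Import numFieldNormedType.Exports.
Local Open Scope classical_set_scope.
Local Open Scope ring_scope.

Set Implicit Arguments.
Unset Strict Implicit.
Unset Printing Implicit Defensive.

(** * Expectations of bounded functions *)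

(** The inverse of a product of layers runs through them backwards. The two halves of a palindrome
    cannot share coins: layers are involutions, so the product would collapse to the identity. Hence
    each layer comes in two independent copies, which inversion exchanges. In dimension 2 a
    symmetric kernel of bounded range is recurrent, so long jumps are required while the kernel
    stays below a summable function; this is where infinitely many layers come in. An infinite
    product of permutations need not converge, and a pointwise limit of permutations need not be
    onto; summable swap probabilities make the products and their inverses stabilise at every point
    almost surely. Inequalities are therefore proved for finitely many layers and particles, where
    expectations are finite sums over coin outcomes, and pass to the limit by dominated convergence.
    For [d >= 3] the same construction is used with identity layers appended. Transience is obtained
    from a supersolution of the evolution that bounds the return probabilities, together with a
    last-exit decomposition that turns their summability into a positive escape probability. *)

Definition bdd {R : realType} {d} {W : measurableType d} (F : W -> R) : Prop :=
  measurable_fun setT F /\ exists B, forall w, `|F w| <= B.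

Definition Ex {R : realType} {d} {W : measurableType d} (P : probability W R)
  (F : W -> R) : R := \int[P]_w F w.

Definition ind {R : realType} {W : Type} (A : set W) (w : W) : R := (`[< A w >])%:R.

Section indicator.
Context {R : realType} {W : Type}.
Implicit Types (A : set W).

Lemma indE A : (ind A : W -> R) = \1_A.
Proof. by apply/funext => w; rewrite /ind indicE /in_mem. Qed.

Lemma ind_ge0 A w : 0 <= ind A w :> R. Proof. exact: ler0n. Qed.

Lemma ind_le1 A w : ind A w <= 1 :> R. Proof. by rewrite /ind lern1 leq_b1. Qed.

Lemma indT A w : A w -> ind A w = 1 :> R.
Proof. by move=> Aw; rewrite /ind asboolT. Qed.

Lemma indF A w : ~ A w -> ind A w = 0 :> R.
Proof. by move=> Aw; rewrite /ind asboolF. Qed.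

Lemma indI A A' w : ind (A `&` A') w = ind A w * ind A' w :> R.
Proof.
case: (pselect (A w)) => Aw; last first.
  by rewrite (indF Aw) mul0r indF// => -[].
case: (pselect (A' w)) => Bw; last first.
  by rewrite (indF Bw) mulr0 indF// => -[].
by rewrite !indT ?mulr1.
Qed.

End indicator.

Section bounded_functions.
Context {R : realType} {d : measure_display} {W : measurableType d}.
Implicit Types (F G : W -> R) (A : set W).

Lemma bdd_cst (c : R) : bdd (fun _ : W => c).
Proof. by split; [exact: measurable_cst|exists `|c|]. Qed.

Lemma bddD F G : bdd F -> bdd G -> bdd (fun w => F w + G w).
Proof.
move=> [mF [B FB]] [mG [C GC]]; split; first exact: measurable_funD.
by exists (B + C) => w; rewrite (le_trans (ler_normD _ _))// lerD.
Qed.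

Lemma bddM F G : bdd F -> bdd G -> bdd (fun w => F w * G w).
Proof.
move=> [mF [B FB]] [mG [C GC]]; split; first exact: measurable_funM.
by exists (B * C) => w; rewrite normrM ler_pM.
Qed.

Lemma bddZ (c : R) F : bdd F -> bdd (fun w => c * F w).
Proof. by move=> bF; apply: bddM => //; exact: bdd_cst. Qed.

Lemma bdd_sum (I : Type) (r : seq I) (H : I -> W -> R) :
  (forall i, bdd (H i)) -> bdd (fun w => \sum_(i <- r) H i w).
Proof.
move=> bH; elim: r => [|i r IH].
  by under eq_fun do rewrite big_nil; exact: bdd_cst.
by under eq_fun do rewrite big_cons; exact: bddD.
Qed.

Lemma bdd_prod (I : Type) (r : seq I) (H : I -> W -> R) :
  (forall i, bdd (H i)) -> bdd (fun w => \prod_(i <- r) H i w).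
Proof.
move=> bH; elim: r => [|i r IH].
  by under eq_fun do rewrite big_nil; exact: bdd_cst.
by under eq_fun do rewrite big_cons; exact: bddM.
Qed.

Lemma bdd_ind A : measurable A -> bdd (ind A : W -> R).
Proof.
move=> mA; split; first by rewrite indE; exact: measurable_indic.
by exists 1 => w; rewrite ger0_norm ?ind_ge0 ?ind_le1.
Qed.

Variable P : probability W R.

Lemma bdd_integrable F : bdd F -> P.-integrable setT (EFin \o F).
Proof.
move=> [mF [B FB]]; apply: measurable_bounded_integrable => //.
  by rewrite (@le_lt_trans _ _ 1%E) ?probability_le1// ltry.
rewrite /globally/bounded_near/=; near=> M => w _.
by rewrite (le_trans (FB w))//; near: M; exact: nbhs_pinfty_ge.
Unshelve. all: by end_near. Qed.

Lemma ExE F : bdd F -> (\int[P]_w (F w)%:E)%E = (Ex P F)%:E.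
Proof.
move=> bF; rewrite /Ex /Rintegral fineK//.
exact: integrable_fin_num (bdd_integrable bF).
Qed.

Lemma Ex_cst (c : R) : Ex P (fun=> c) = c.
Proof. rewrite /Ex Rintegral_cst// [X in fine X](_ : _ = 1%E) ?mulr1//; exact: probability_setT. Qed.

Lemma ExD F G : bdd F -> bdd G -> Ex P (fun w => F w + G w) = Ex P F + Ex P G.
Proof. by move=> bF bG; apply: RintegralD => //; exact: bdd_integrable. Qed.

Lemma ExZ (c : R) F : bdd F -> Ex P (fun w => c * F w) = c * Ex P F.
Proof. by move=> bF; apply: RintegralZl => //; exact: bdd_integrable. Qed.

Lemma Ex_sum (I : Type) (r : seq I) (H : I -> W -> R) :
  (forall i, bdd (H i)) ->
  Ex P (fun w => \sum_(i <- r) H i w) = \sum_(i <- r) Ex P (H i).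
Proof.
move=> bH; elim: r => [|i r IH].
  by rewrite big_nil -[RHS](Ex_cst 0); congr Ex; apply/funext => w; rewrite big_nil.
rewrite big_cons -IH -ExD//; last exact: bdd_sum.
by congr Ex; apply/funext => w; rewrite big_cons.
Qed.

Lemma Ex_le F G : bdd F -> bdd G -> (forall w, F w <= G w) -> Ex P F <= Ex P G.
Proof. by move=> bF bG FG; apply: le_Rintegral => //; exact: bdd_integrable. Qed.

Lemma Ex_ge0 F : (forall w, 0 <= F w) -> 0 <= Ex P F.
Proof. by move=> F0; exact: Rintegral_ge0. Qed.

Lemma Ex_le1 F : bdd F -> (forall w, F w <= 1) -> Ex P F <= 1.
Proof. by move=> bF F1; rewrite -[leRHS](Ex_cst 1); apply: Ex_le => //; exact: bdd_cst. Qed.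

Lemma Ex_ind A : measurable A -> P A = (Ex P (ind A))%:E.
Proof.
move=> mA; rewrite -ExE; last exact: bdd_ind.
by rewrite indE integral_indic// setIT.
Qed.

Lemma Ex_ind_le A A' : measurable A -> measurable A' -> A `<=` A' ->
  Ex P (ind A) <= Ex P (ind A').
Proof.
move=> mA mA' AA'; rewrite -lee_fin -!Ex_ind//.
by apply: le_measure => //; rewrite inE.
Qed.

Lemma Ex_ind_full A A' : measurable A -> measurable A' -> Ex P (ind A) = 1 ->
  Ex P (ind A') = Ex P (fun w => ind A w * ind A' w).
Proof.
move=> mA mA' A1; have mC := measurableC mA.
have bM : bdd (fun w => ind (~` A) w * ind A' w : R) by apply: bddM; exact: bdd_ind.
have -> : Ex P (ind A') = Ex P (fun w => ind A w * ind A' w) +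
   Ex P (fun w => ind (~` A) w * ind A' w).
  rewrite -ExD//; last by apply: bddM; exact: bdd_ind.
  congr Ex; apply/funext => w; rewrite -mulrDl.
  have [h|h] := pselect (A w); first by rewrite (indT h) [ind (~` _) w]indF ?addr0 ?mul1r//; apply.
  by rewrite (indF h) [ind (~` _) w]indT ?add0r ?mul1r.
suff -> : Ex P (fun w => ind (~` A) w * ind A' w) = 0 by rewrite addr0.
apply/eqP; rewrite eq_le; apply/andP; split; last first.
  by apply: Ex_ge0 => w; rewrite mulr_ge0 ?ind_ge0.
apply: (@le_trans _ _ (Ex P (ind (~` A)))).
  apply: Ex_le => //; first exact: bdd_ind.
  by move=> w; rewrite ler_piMr ?ind_ge0// ind_le1.
rewrite -lee_fin -Ex_ind//.
by rewrite probability_setC// Ex_ind// A1 subee.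
Qed.

Lemma Ex_cvg (Fn : nat -> W -> R) F (B : R) :
  (forall n, measurable_fun setT (Fn n)) -> bdd F ->
  (forall n w, `|Fn n w| <= B) ->
  {ae P, forall w, (Fn ^~ w) @ \oo --> F w} ->
  (fun n => Ex P (Fn n)) @ \oo --> Ex P F.
Proof.
move=> mFn bF FB cF.
have bFn n : bdd (Fn n) by split=> //; exists B.
have [] := @dominated_convergence _ _ _ P setT measurableT
  (fun n w => (Fn n w)%:E) (fun w => (F w)%:E) (fun=> B%:E) => //.
- by move=> n; exact/measurable_EFinP.
- by apply/measurable_EFinP; case: bF.
- case: cF => N [mN N0 sN]; exists N; split => // w /= cw; apply: sN => /= cw'.
  by apply: cw => _; apply: cvg_comp cw' _.
- exact: (bdd_integrable (bdd_cst B)).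
- by apply: aeW => w n _; rewrite lee_fin.
move=> _ _; rewrite ExE//.
under eq_fun do rewrite ExE//.
by move/fine_cvgP => [_].
Qed.

End bounded_functions.

(** * Countably valued random variables *)

Section discrete.
Context {R : realType}.

(** When [T] is countable, measurable level sets make every preimage measurable, so no sigma-algebra
    on [T] has to be chosen. *)
Definition dmeas {d} {W : measurableType d} {T : Type} (phi : W -> T) : Prop :=
  forall t, measurable [set w | phi w = t].

Lemma measurable_prop {d} {W : measurableType d} (Q : Prop) :
  measurable ([set _ | Q] : set W).
Proof.
have [q|nq] := pselect Q.
  by rewrite (_ : mkset _ = setT)//; apply/seteqP; split.
by rewrite (_ : mkset _ = set0)//; apply/seteqP; split.
Qed.

Lemma dmeas_cst {d} {W : measurableType d} {T : Type} (t : T) : dmeas (fun _ : W => t).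
Proof. by move=> t'; exact: measurable_prop. Qed.

Lemma measurable_bigcup_countable {d} {W : measurableType d} {T : countType}
  (D : set T) (F : T -> set W) :
  (forall t, D t -> measurable (F t)) -> measurable (\bigcup_(t in D) F t).
Proof.
move=> mF; rewrite bigcup_mkcond; apply: countable_bigcupT_measurable => // t.
by case: ifP => // /set_mem; exact: mF.
Qed.

Lemma dmeas_set {d} {W : measurableType d} {T : countType} (phi : W -> T)
  (A : set T) : dmeas phi -> measurable (phi @^-1` A).
Proof.
move=> mphi; rewrite (_ : phi @^-1` A = \bigcup_(t in A) [set w | phi w = t]).
  by apply: measurable_bigcup_countable => t _; exact: mphi.
apply/seteqP; split => [w Aw|w [t At /= e]]; first by exists (phi w).
by rewrite e.
Qed.

Lemma dmeas_comp {d} {W : measurableType d} {T : countType} {U : Type} (phi : W -> T)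
  (h : T -> U) : dmeas phi -> dmeas (h \o phi).
Proof. by move=> mphi u; exact: (dmeas_set [set t | h t = u] mphi). Qed.

Lemma dmeas_pair {d} {W : measurableType d} {T U : Type} (phi : W -> T) (psi : W -> U) :
  dmeas phi -> dmeas psi -> dmeas (fun w => (phi w, psi w)).
Proof.
move=> mp ms [t u]; rewrite (_ : mkset _ = [set w | phi w = t] `&` [set w | psi w = u]).
  exact: measurableI.
by apply/seteqP; split => w /= [<- <-].
Qed.

Lemma dmeas_bdd {d} {W : measurableType d} {T : countType} (phi : W -> T) (h : T -> R) :
  dmeas phi -> (exists B, forall t, `|h t| <= B) -> bdd (fun w => h (phi w)).
Proof.
move=> mp [B hB]; split; last by exists B => w.
by move=> _ A mA; rewrite setTI; exact: (dmeas_set (h @^-1` A) mp).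
Qed.

(* Lets conditional expectations given a countable-valued variable be compared fiber by
   fiber, without writing a series. *)
Lemma Ex_fiber_le {d d'} {W : measurableType d} {W' : measurableType d'}
  (P : probability W R) (P' : probability W' R) {T : countType}
  (phi : W -> T) (phi' : W' -> T) (F : W -> R) (G : W' -> R) :
  dmeas phi -> dmeas phi' -> bdd F -> bdd G ->
  (forall t, Ex P (fun w => F w * ind [set w | phi w = t] w) <=
             Ex P' (fun w => G w * ind [set w | phi' w = t] w)) ->
  Ex P F <= Ex P' G.
Proof.
move=> mp mp' bF bG le.
(* [tr] restricts [H] to the event [pickle (ps w) < n] and writes it as a finite sum of its parts on
   the fibers; indices that decode to nothing contribute 0. Dominated convergence removes the
   cut-off. *)
pose tr := fun (V : Type) (ps : V -> T) (H : V -> R) (n : nat) (w : V) =>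
  \sum_(i <- iota 0 n) if unpickle i is Some t then
     H w * ind [set v | ps v = t] w * (pickle t == i)%:R else 0 : R.
have trE : forall (V : Type) (ps : V -> T) (H : V -> R) n w,
    tr V ps H n w = H w * (pickle (ps w) < n)%:R.
  move=> V ps H n w.
  rewrite /tr; case: ltnP => np.
    rewrite (bigD1_seq (pickle (ps w))) ?iota_uniq ?mem_iota//= pickleK /= eqxx indT//.
    rewrite big1 ?addr0 ?mulr1// => i ne; case: (unpickle i) => // t.
    have [pi|] := eqVneq; last by rewrite mulr0.
    by rewrite indF ?mulr0 ?mul0r//= => e; rewrite -pi e eqxx in ne.
  rewrite mulr0 big_seq big1// => i; rewrite mem_iota/= add0n => ni.
  case: (unpickle i) => // t; have [pi|] := eqVneq; last by rewrite mulr0.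
  by rewrite indF ?mulr0 ?mul0r//= => e; move: np; rewrite e pi leqNgt ni.
have key : forall e (V : measurableType e) (Q : probability V R) (ps : V -> T) (H : V -> R),
    dmeas ps -> bdd H ->
    [/\ (fun n => Ex Q (tr V ps H n)) @ \oo --> Ex Q H &
     forall n, Ex Q (tr V ps H n) = \sum_(i <- iota 0 n) if unpickle i is Some t then
     (pickle t == i)%:R * Ex Q (fun w => H w * ind [set v | ps v = t] w) else 0].
  move=> e V Q ps H mps bH; have bt n : bdd (tr V ps H n).
    apply: bdd_sum => i; case: (unpickle i) => [t|]; last exact: bdd_cst.
    apply: bddM; [|exact: bdd_cst]; apply: bddM => //; apply: bdd_ind; exact: mps.
  split.
    case: (bH) => mH [B HB]; apply: (@Ex_cvg _ _ _ _ _ _ B) => // [n|n w|].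
    - by case: (bt n).
    - by rewrite trE normrM (le_trans _ (HB w))// ler_piMr// normr_nat lern1 leq_b1.
    apply: aeW => w.
    apply: cvg_near_cst; near=> n; rewrite trE.
    have -> : (pickle (ps w) < n)%N by near: n; exact: nbhs_infty_gt.
    by rewrite mulr1.
  move=> n; rewrite Ex_sum.
    apply: eq_bigr => i _; case: (unpickle i) => [t|]; last exact: Ex_cst.
    rewrite -ExZ; first by congr Ex; apply/funext => w; rewrite mulrC.
    apply: bddM => //; apply: bdd_ind; exact: mps.
  move=> i; case: (unpickle i) => [t|]; last exact: bdd_cst.
  apply: bddM; [|exact: bdd_cst]; apply: bddM => //; apply: bdd_ind; exact: mps.
have [c1 e1] := key _ _ P _ _ mp bF; have [c2 e2] := key _ _ P' _ _ mp' bG.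
apply: ler_cvg_to c1 c2 _; near=> n; rewrite e1 e2; apply: ler_sum => i _.
by case: (unpickle i) => // t; rewrite ler_wpM2l.
Unshelve. all: by end_near. Qed.

Lemma Ex_fiber_eq {d d'} {W : measurableType d} {W' : measurableType d'}
  (P : probability W R) (P' : probability W' R) {T : countType}
  (phi : W -> T) (phi' : W' -> T) (F : W -> R) (G : W' -> R) :
  dmeas phi -> dmeas phi' -> bdd F -> bdd G ->
  (forall t, Ex P (fun w => F w * ind [set w | phi w = t] w) =
             Ex P' (fun w => G w * ind [set w | phi' w = t] w)) ->
  Ex P F = Ex P' G.
Proof.
move=> mp mp' bF bG e; apply/eqP; rewrite eq_le.
by apply/andP; split; [apply: Ex_fiber_le mp mp' _ _ _|apply: Ex_fiber_le mp' mp _ _ _]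
  => // t; rewrite e.
Qed.

End discrete.

(** * Independent biased coins on the unit interval *)

(* Coin n splits the current interval in the proportion [e n : 1 - e n], tests on which
   side the point lies and rescales that side to [0, 1). *)
Section coins.
Context {R : realType}.
Variable e : nat -> R.
Hypothesis e01 : forall i, 0 < e i < 1.

Definition bern (i : nat) (b : bool) : R := if b then e i else 1 - e i.

(** Points outside [[0, 1)] are sent to 0, so that the description of the coins holds for every real
    [w]. *)
Definition coin_start (w : R) : R := if 0 <= w < 1 then w else 0.

Fixpoint coin_rest (n : nat) (w : R) : R :=
  if n is m.+1 then
    let u := coin_rest m w in if u < e m then u / e m else (u - e m) / (1 - e m)
  else coin_start w.

Definition coin (n : nat) (w : R) : bool := coin_rest n w < e n.

(** The points of [[0, 1)] whose first [n] coins are given by [b] form an interval with this left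
    end and length [box_len b n]; the outcome [true] is the left part of each cut. *)
Fixpoint box_lo (b : nat -> bool) (n : nat) : R :=
  if n is m.+1 then
    box_lo b m + if b m then 0 else e m * \prod_(i < m) bern i (b i)
  else 0.

Definition box_len (b : nat -> bool) (n : nat) : R := \prod_(i < n) bern i (b i).

Lemma bern_gt0 i b : 0 < bern i b.
Proof. by have := e01 i; rewrite /bern; case: b => /andP[? ?] //; lra. Qed.

Lemma box_len_gt0 b n : 0 < box_len b n.
Proof. by apply: prodr_gt0 => i _; exact: bern_gt0. Qed.

Lemma box_lenS b n : box_len b n.+1 = box_len b n * bern n (b n).
Proof. by rewrite /box_len big_ord_recr. Qed.

Lemma box_loE b n : box_lo b n.+1 = box_lo b n + if b n then 0 else e n * box_len b n.
Proof. by []. Qed.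

Lemma box_lenSE b n : box_len b n.+1 =
  if b n then e n * box_len b n else box_len b n - e n * box_len b n.
Proof. by rewrite box_lenS /bern; case: (b n); ring. Qed.

Lemma box_step_gt0 b n : 0 < e n * box_len b n < box_len b n.
Proof.
have l0 := box_len_gt0 b n; have /andP[e0 e1] := e01 n.
by rewrite mulr_gt0//= gtr_pMl.
Qed.

Lemma box_itv b n : 0 <= box_lo b n /\ box_lo b n + box_len b n <= 1.
Proof.
elim: n => [|n [IH1 IH2]]; first by rewrite /box_len big_ord0 /=; lra.
have /andP[] := box_step_gt0 b n; rewrite box_loE box_lenSE.
by case: (b n); split; lra.
Qed.

(** The affine formula for [coin_rest] is carried through the induction because it turns the next
    coin into the comparison of [u] with the point that cuts the current interval in the ratio
    [e n : 1 - e n]. *)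
Lemma coinP b n w : let u := coin_start w in
  ((forall i, (i < n)%N -> coin i w = b i) <->
     (box_lo b n <= u /\ u < box_lo b n + box_len b n)) /\
  ((forall i, (i < n)%N -> coin i w = b i) ->
     coin_rest n w = (u - box_lo b n) / box_len b n).
Proof.
move=> u; have u01 : 0 <= u < 1.
  by rewrite /u /coin_start; case: ifP => // _; rewrite lexx ltr01.
elim: n => [|n [[IH1 IH2] IH3]].
  rewrite /box_len big_ord0 /= add0r subr0 divr1; split => //; split => //.
  by case/andP: u01.
have l0 := box_len_gt0 b n; have /andP[e0 e1] := e01 n.
have cE : (forall i, (i < n)%N -> coin i w = b i) ->
    coin n w = (u < box_lo b n + e n * box_len b n).
  by move=> /IH3; rewrite /coin => ->; rewrite ltr_pdivrMr// ltrBlDl.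
have sp : (forall i, (i < n.+1)%N -> coin i w = b i) <->
    (forall i, (i < n)%N -> coin i w = b i) /\ coin n w = b n.
  split => [h|[h1 h2] i]; first by split => [i ni|]; apply: h => //; exact: ltnW.
  by rewrite ltnS leq_eqVlt => /predU1P[->//|]; exact: h1.
have /andP[] := box_step_gt0 b n.
rewrite box_loE box_lenSE; set t := e n * _ => t0 tl; split.
  split=> [/sp [h hn]|h].
    have [h1 h2] := IH1 h; rewrite cE// -/t in hn.
    by rewrite -hn; case: ltP => h3; split; lra.
  apply/sp; have h' : forall i, (i < n)%N -> coin i w = b i.
    by apply: IH2; move: h; case: (b n) => -[h1 h2]; split; lra.
  split => //; rewrite cE//; move: h; case: (b n) => -[h1 h2].
    by apply/idP; rewrite -/t; lra.
  by apply/negbTE; rewrite -leNgt -/t; lra.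
move=> /sp [h hn] /=; subst t.
have hc := cE h; rewrite hn in hc.
have -> : (coin_rest n w < e n) = b n by rewrite -hn.
rewrite (IH3 h); case: (b n); first by field; rewrite !gt_eqF.
by field; rewrite !gt_eqF ?subr_gt0.
Qed.

Definition coin_prob : probability (measurableTypeR R) R := uniform_prob (@ltr01 R).

Lemma coin_prob_itv (a b : R) : 0 <= a -> a <= b -> b <= 1 ->
  coin_prob [set` `[a, b[] = (b - a)%:E.
Proof.
move=> a0 ab b1; rewrite /coin_prob /= /uniform_prob.
rewrite (eq_integral (fun=> 1%E)).
  by rewrite integral_cst//= mul1e lebesgue_measure_itv/= lte_fin;
    case: ltgtP ab => // -> _; rewrite subrr.
move=> x; rewrite inE/= in_itv/= /uniform_pdf => /andP[ax xb].
by rewrite (le_trans a0 ax) (le_trans (ltW xb) b1) subr0 invr1.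
Qed.

Lemma coin_box b n :
  measurable [set w : R | forall i, (i < n)%N -> coin i w = b i] /\
  coin_prob [set w | forall i, (i < n)%N -> coin i w = b i] = (box_len b n)%:E.
Proof.
set A := mkset _; pose D := [set` `[0 : R, 1[].
have mD : measurable (D : set (measurableTypeR R)) by exact: measurable_itv.
have mDC : measurable (~` D : set (measurableTypeR R)) by exact: measurableC.
have [l0 l1] := box_itv b n; have l2 := box_len_gt0 b n.
have AD : A `&` D = [set` `[box_lo b n, box_lo b n + box_len b n[].
  apply/seteqP; split=> w /=.
    move=> [/(coinP b n w).1.1 /=]; rewrite /D /= !in_itv /= /coin_start => h w01.
    by rewrite w01 in h; case: h => -> ->.
  rewrite /D /= !in_itv /= => /andP[h1 h2].
  have w01 : 0 <= w < 1 by apply/andP; split; lra.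
  by split=> //; apply/(coinP b n w).1; rewrite /coin_start w01.
have mAD : measurable (A `&` D) by rewrite AD.
have AcD : measurable (A `\` D).
  (* All points outside [[0, 1)] have the same coins as [-1], so [A] contains the whole complement
     or misses it; the complement is a null set anyway. *)
  have [A0|A0] := pselect (A (-1)).
    rewrite (_ : _ `\` _ = ~` D); first exact: mDC.
    apply/seteqP; split => [w []//|w /= Dw]; split => //.
    move=> i /A0 <-; rewrite /coin; suff -> : coin_rest i w = coin_rest i (-1) by [].
    elim: i => [|i IH] /=; last by rewrite IH.
    rewrite /coin_start; move: Dw; rewrite /D /= in_itv/= => /negP/negbTE ->.
    by rewrite ler0N1.
  rewrite (_ : _ `\` _ = set0)// -subset0 => w [/= Aw Dw]; apply: A0 => i /Aw <-.
  rewrite /coin; suff -> : coin_rest i w = coin_rest i (-1) by [].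
  elim: i => [|i IH] /=; last by rewrite IH.
  rewrite /coin_start; move: Dw; rewrite /D /= in_itv/= => /negP/negbTE ->.
  by rewrite ler0N1.
have mA : measurable A by rewrite -(setUIDK A D); exact: measurableU.
split => //.
have e1 : coin_prob A = coin_prob (A `&` D).
  rewrite -[in LHS](setUIDK A D) measureU//; last first.
    by rewrite -subset0 => w [[_ ?] [_ ?]].
  rewrite [X in (_ + X)%E](_ : _ = 0%E) ?adde0//; apply/eqP; rewrite eq_le measure_ge0 andbT.
  have -> : 0%E = coin_prob (~` D).
    rewrite probability_setC// /D.
    by rewrite [X in (_ - X)%E]coin_prob_itv// subr0 subee.
  by apply: le_measure; rewrite ?inE.
rewrite e1 AD coin_prob_itv//; first by congr EFin; lra.
by rewrite lerDl ltW.
Qed.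

End coins.

(** Dependence on finitely many coins: it yields measurability and boundedness at once, reduces
    expectations to finite sums, and states independence as disjointness of index lists. *)
Definition uses {T : Type} (I : seq nat) (Phi : (nat -> bool) -> T) : Prop :=
  forall c c', {in I, c =1 c'} -> Phi c = Phi c'.

Section coin_expectation.
Context {R : realType}.
Variable e : nat -> R.
Hypothesis e01 : forall i, 0 < e i < 1.
Implicit Types (Phi Psi : (nat -> bool) -> R) (I : seq nat).

Definition coins (w : R) (i : nat) : bool := coin e i w.

Definition Ec Phi : R := Ex (coin_prob (R := R)) (Phi \o coins).

Definition extend N (v : {ffun 'I_N -> bool}) (n : nat) : bool :=
  if insub n is Some i then v i else false.

Definition weight N (v : {ffun 'I_N -> bool}) : R := \prod_(i < N) bern e i (v i).

Lemma extendE N (v : {ffun 'I_N -> bool}) (i : 'I_N) : extend v i = v i.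
Proof. by rewrite /extend valK. Qed.

Lemma coins_sum N Phi : uses (iota 0 N) Phi -> Phi \o coins =
  (fun w => \sum_(v : {ffun 'I_N -> bool})
    Phi (extend v) * ind [set w | forall i, (i < N)%N -> coin e i w = extend v i] w).
Proof.
move=> uPhi; apply/funext => w /=.
rewrite (bigD1 [ffun i : 'I_N => coin e i w])//= big1 ?addr0.
  rewrite indT ?mulr1; last first.
    by move=> i iN; rewrite -[i]/(val (Ordinal iN)) extendE ffunE.
  apply: uPhi => i; rewrite mem_iota add0n => /andP[_ iN].
  by rewrite -[i]/(val (Ordinal iN)) extendE ffunE.
move=> v vE; rewrite indF ?mulr0//= => h; case/eqP: vE; apply/ffunP => i.
by rewrite ffunE h ?ltn_ord// extendE.
Qed.

Lemma bdd_coins I Phi : uses I Phi -> bdd (Phi \o coins : measurableTypeR R -> R).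
Proof.
move=> uPhi; have uN : uses (iota 0 (\max_(i <- I) i).+1) Phi.
  move=> c c' h; apply: uPhi => i iI; apply: h.
  by rewrite mem_iota add0n ltnS leq0n leq_bigmax_seq.
rewrite (coins_sum uN); apply: bdd_sum => v; apply: bddM; first exact: bdd_cst.
by apply: bdd_ind; have [] := coin_box e01 (extend v) (\max_(i <- I) i).+1.
Qed.

Lemma EcE N Phi : uses (iota 0 N) Phi ->
  Ec Phi = \sum_(v : {ffun 'I_N -> bool}) weight v * Phi (extend v).
Proof.
move=> uPhi; rewrite /Ec (coins_sum uPhi).
have mb v : measurable
    [set w : measurableTypeR R | forall i, (i < N)%N -> coin e i w = extend v i].
  by have [] := coin_box e01 (extend v) N.
rewrite Ex_sum; last by move=> v; apply: bddM; [exact: bdd_cst|exact: bdd_ind].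
apply: eq_bigr => v _; rewrite ExZ; last exact: bdd_ind.
rewrite mulrC; congr (_ * _); apply: EFin_inj; rewrite -Ex_ind//.
rewrite (coin_box e01 (extend v) N).2; congr EFin; apply: eq_bigr => i _.
by rewrite extendE.
Qed.

Lemma weight_sum N : \sum_(v : {ffun 'I_N -> bool}) weight v = 1.
Proof.
rewrite -(bigA_distr_bigA (fun i b => bern e (nat_of_ord i) b)) big1// => i _.
by rewrite big_bool /bern /= addrCA subrr addr0.
Qed.

Lemma Ec_indep I J Phi Psi : uses I Phi -> uses J Psi ->
  {in I, forall i, i \notin J} ->
  Ec (fun c => Phi c * Psi c) = Ec Phi * Ec Psi.
Proof.
move=> uPhi uPsi dIJ; pose N := (\max_(i <- I ++ J) i).+1.
have uN (T : Type) K (F : (nat -> bool) -> T) : {subset K <= I ++ J} -> uses K F ->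
    uses (iota 0 N) F.
  move=> sK uF c c' h; apply: uF => i /sK iK; apply: h.
  by rewrite mem_iota add0n ltnS leq0n leq_bigmax_seq.
have sI : {subset I <= I ++ J} by move=> i; rewrite mem_cat => ->.
have sJ : {subset J <= I ++ J} by move=> i; rewrite mem_cat => ->; rewrite orbT.
rewrite (EcE (uN _ _ _ sI uPhi)) (EcE (uN _ _ _ sJ uPsi)).
rewrite (@EcE N); last first.
  by move=> c c' h; rewrite (uN _ _ _ sI uPhi _ _ h) (uN _ _ _ sJ uPsi _ _ h).
rewrite big_distrlr/= pair_big/=.
(* Exchanging the coordinates in [J] of two copies preserves the product weight. *)
pose mix (p : {ffun 'I_N -> bool} * {ffun 'I_N -> bool}) :=
  ([ffun i : 'I_N => if (nat_of_ord i \in J) then p.2 i else p.1 i],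
   [ffun i : 'I_N => if (nat_of_ord i \in J) then p.1 i else p.2 i]).
have mixK : involutive mix.
  by move=> [v v']; congr pair; apply/ffunP => i; rewrite !ffunE /= ?ffunE; case: (nat_of_ord i \in J).
(* The total weight 1 supplies the second copy of the outcomes on the left side. *)
rewrite -[LHS]mulr1 -(weight_sum N) big_distrlr/= pair_big/=.
rewrite [RHS](reindex_inj (inv_inj mixK)).
apply: eq_bigr => -[v v'] _; set m := mix _; rewrite [LHS]/=.
have Wm : weight m.1 * weight m.2 = weight v * weight v'.
  rewrite /weight -!big_split/=; apply: eq_bigr => i _; rewrite /m /= !ffunE/=.
  by case: ifP => // _; rewrite mulrC.
have -> : Phi (extend v) = Phi (extend m.1).
  apply: uPhi => i iI; rewrite /extend; case: insubP => // j _ ji.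
  by rewrite /m /= ffunE /= ji (negbTE (dIJ _ iI)).
have -> : Psi (extend v) = Psi (extend m.2).
  apply: uPsi => i iJ; rewrite /extend; case: insubP => // j _ ji.
  by rewrite /m /= ffunE /= ji iJ.
by rewrite mulrAC -Wm mulrACA.
Qed.

Lemma Ec1 i (g : bool -> R) :
  Ec (fun c => g (c i)) = (1 - e i) * g false + e i * g true.
Proof.
have ui : uses [:: i] (fun c => g (c i)) by move=> c c' ->//; exact: mem_head.
rewrite (@EcE i.+1); last first.
  by move=> c c' h; apply: ui => j; rewrite inE => /eqP ->; apply: h; rewrite mem_iota add0n leq0n ltnSn.
pose F (j : 'I_i.+1) (b : bool) := bern e j b * (if j == ord_max then g b else 1).
transitivity (\sum_(v : {ffun 'I_i.+1 -> bool}) \prod_j F j (v j)).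
  apply: eq_bigr => v _; rewrite /F big_split/= -/(weight v); congr (_ * _).
  by rewrite big_ord_recr/= eqxx big1 ?mul1r -?(extendE v ord_max)// => j _;
    case: eqP => // /(congr1 val)/= /eqP; rewrite ltn_eqF.
rewrite -(bigA_distr_bigA F) (bigD1 ord_max)//= [X in _ * X]big1 ?mulr1.
  by rewrite big_bool /F eqxx /bern/= addrC.
by move=> j /negbTE jm; rewrite big_bool /F jm /bern /= !mulr1 addrCA subrr addr0.
Qed.

End coin_expectation.

Section coin_lemmas.
Context {R : realType}.
Variable e : nat -> R.
Hypothesis e01 : forall i, 0 < e i < 1.
Local Notation Ec := (Ec e).

Lemma Ec_cst (a : R) : Ec (fun=> a) = a.
Proof. exact: Ex_cst. Qed.

Lemma Ec_le I J (Phi Psi : (nat -> bool) -> R) : uses I Phi -> uses J Psi ->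
  (forall c, Phi c <= Psi c) -> Ec Phi <= Ec Psi.
Proof.
move=> uPhi uPsi le; apply: Ex_le => [||w]; [| |exact: le].
  exact: bdd_coins uPhi.
exact: bdd_coins uPsi.
Qed.

Lemma Ec_ge0 (Phi : (nat -> bool) -> R) : (forall c, 0 <= Phi c) -> 0 <= Ec Phi.
Proof. by move=> ge0; apply: Ex_ge0 => w; exact: ge0. Qed.

Lemma Ec_sum (A : Type) (r : seq A) (I : A -> seq nat) (F : A -> (nat -> bool) -> R) :
  (forall a, uses (I a) (F a)) ->
  Ec (fun c => \sum_(a <- r) F a c) = \sum_(a <- r) Ec (F a).
Proof. by move=> uF; apply: Ex_sum => a; exact: bdd_coins (uF a). Qed.

Lemma EcZ I (a : R) (Phi : (nat -> bool) -> R) : uses I Phi ->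
  Ec (fun c => a * Phi c) = a * Ec Phi.
Proof. by move=> uPhi; apply: ExZ; exact: bdd_coins uPhi. Qed.

(** Conditioning on a finite-valued function of the coins: split according to the value of [b], then
    use independence of the coins in [I] from those in [J a] for each value [a]. *)
Lemma Ec_cond (A : finType) (b : (nat -> bool) -> A) (F : A -> (nat -> bool) -> R)
  (I : seq nat) (J : A -> seq nat) : uses I b -> (forall a, uses (J a) (F a)) ->
  (forall a, {in I, forall i, i \notin J a}) ->
  Ec (fun c => F (b c) c) = Ec (fun c => Ec (F (b c))).
Proof.
move=> ub uF IJ.
have ui a : uses I (fun c => (b c == a)%:R : R) by move=> c c' /ub ->.
have E1 : (fun c => F (b c) c) = (fun c => \sum_a (b c == a)%:R * F a c).
  apply/funext => c; rewrite (bigD1 (b c))//= eqxx mul1r big1 ?addr0// => a.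
  by rewrite eq_sym => /negbTE ->; rewrite mul0r.
have E2 : (fun c => Ec (F (b c))) = (fun c => \sum_a Ec (F a) * (b c == a)%:R).
  apply/funext => c; rewrite (bigD1 (b c))//= eqxx mulr1 big1 ?addr0// => a.
  by rewrite eq_sym => /negbTE ->; rewrite mulr0.
rewrite E1 E2 (@Ec_sum _ _ (fun a => I ++ J a)); last first.
  move=> a c c' h; rewrite (ui a c c'); last by move=> i iI; apply: h; rewrite mem_cat iI.
  by rewrite (uF a c c')// => i iJ; apply: h; rewrite mem_cat iJ orbT.
rewrite (@Ec_sum _ _ (fun=> I)); last by move=> a c c' h; rewrite (ui a c c').
apply: eq_bigr => a _; rewrite (Ec_indep e01 (ui a) (uF a) (IJ a)).
by rewrite mulrC (EcZ _ (ui a)).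
Qed.

Fixpoint bern_mean (ps : seq R) (G : seq bool -> R) : R :=
  if ps is p :: qs then
    (1 - p) * bern_mean qs (G \o cons false) + p * bern_mean qs (G \o cons true)
  else G [::].

(** The right side sees the indices only through their biases, so two families of coins with equal
    biases give equal expectations. *)
Lemma Ec_uniq (I : seq nat) (G : seq bool -> R) : uniq I ->
  Ec (fun c => G (map c I)) = bern_mean (map e I) G.
Proof.
elim: I G => [|i I IH] G /=; first by rewrite Ec_cst.
move=> /andP[iI uI].
rewrite (@Ec_cond _ (fun c => c i) (fun b c => G (b :: map c I)) [:: i] (fun=> I)).
- by rewrite (Ec1 e01 i (fun b => Ec (fun c => G (b :: map c I)))) -!IH.
- by move=> c c' ->//; exact: mem_head.
- by move=> b c c' h; congr (G (_ :: _)); apply/eq_in_map.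
- by move=> _ j; rewrite inE => /eqP ->.
Qed.

End coin_lemmas.

(** * Layers of independent swaps *)

(* Layer [(b, k)] swaps each pair [{x, sg k x}] with probability [dl k], independently over
   the pairs; the two values of [b] give two independent copies of the layer. Its coins are
   indexed by the pair's representative [layer_rep]. *)
Section layers.
Context {R : realType} {X : countType}.
Variables (sg : nat -> X -> X) (dl : nat -> R).
Hypothesis sgK : forall k, involutive (sg k).
Hypothesis dl01 : forall k, 0 < dl k < 1.

Definition layer_rep (k : nat) (x : X) : X :=
  if (pickle x <= pickle (sg k x))%N then x else sg k x.

Definition layer_coin (t : bool * nat) (x : X) : nat :=
  pickle (t, layer_rep t.2 x).

Definition layer_bias (i : nat) : R :=
  if unpickle i is Some (t, x) then dl (t : bool * nat, x : X).1.2 else 2^-1.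

Definition layer (t : bool * nat) (c : nat -> bool) (x : X) : X :=
  if c (layer_coin t x) then sg t.2 x else x.

Definition layers (ls : seq (bool * nat)) (c : nat -> bool) (x : X) : X :=
  foldl (fun y t => layer t c y) x ls.

Definition avg (k : nat) (f : X -> R) (x : X) : R :=
  (1 - dl k) * f x + dl k * f (sg k x).

Local Notation Ec := (Ec layer_bias).

(** The transition operator of one layer on functions of finitely many particles, all moved by the
    same coins. *)
Definition layer_mean (t : bool * nat) (h : seq X -> R) (xs : seq X) : R :=
  Ec (fun c => h (map (layer t c) xs)).

Lemma layer_bias01 i : 0 < layer_bias i < 1.
Proof.
by rewrite /layer_bias; case: unpickle => [[t x]|]; [exact: dl01|lra].
Qed.

Lemma layer_rep_sg k x : layer_rep k (sg k x) = layer_rep k x.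
Proof.
rewrite /layer_rep sgK; case: ltngtP => // h.
exact/(pcan_inj pickleK).
Qed.

Lemma layer_coin_sg t x : layer_coin t (sg t.2 x) = layer_coin t x.
Proof. by rewrite /layer_coin layer_rep_sg. Qed.

Lemma layer_coin_eq t x y : layer_coin t x = layer_coin t y -> x = y \/ x = sg t.2 y.
Proof.
move=> /(pcan_inj pickleK) []; rewrite /layer_rep.
case: ifP => _; case: ifP => _ E; [by left|by right| |].
  by right; rewrite -E sgK.
by left; rewrite -(sgK t.2 x) E sgK.
Qed.

Lemma layer_coin_neq t t' x y : t != t' -> layer_coin t x <> layer_coin t' y.
Proof. by move=> /eqP tt' /(pcan_inj pickleK) [] /tt'. Qed.

Lemma layer_bias_coin t x : layer_bias (layer_coin t x) = dl t.2.
Proof. by rewrite /layer_bias /layer_coin pickleK. Qed.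

Lemma layerK t c : involutive (layer t c).
Proof.
move=> x; rewrite /layer; case cx : (c (layer_coin t x)); last by rewrite cx.
by rewrite layer_coin_sg cx sgK.
Qed.

Lemma layers_rcons ls t c x : layers (rcons ls t) c x = layer t c (layers ls c x).
Proof. by rewrite /layers -cats1 foldl_cat. Qed.

Lemma layers_cat ls ls' c x : layers (ls ++ ls') c x = layers ls' c (layers ls c x).
Proof. exact: foldl_cat. Qed.

Lemma layersK ls c : cancel (layers ls c) (layers (rev ls) c).
Proof.
elim: ls => [|t ls IH] x //=; rewrite rev_cons layers_rcons /=.
by rewrite IH layerK.
Qed.

Definition mask_move (k : nat) (m : seq bool) (xs : seq X) : seq X :=
  [seq if p.2 then sg k p.1 else p.1 | p <- zip xs m].

Lemma map_layer t c xs :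
  map (layer t c) xs = mask_move t.2 (map c (map (layer_coin t) xs)) xs.
Proof. by rewrite /mask_move; elim: xs => //= x xs ->. Qed.

(** The new positions depend only on the tuple of coins read by [xs], encoded by [mask_move];
    conditioning on this finite tuple leaves a functional of other coins. *)
Lemma layer_cond t (Phi : seq X -> (nat -> bool) -> R) (K : seq X -> seq nat) xs :
  (forall ys, uses (K ys) (Phi ys)) ->
  (forall ys x, layer_coin t x \notin K ys) ->
  Ec (fun c => Phi (map (layer t c) xs) c) =
  layer_mean t (fun ys => Ec (Phi ys)) xs.
Proof.
move=> uPhi tK; rewrite /layer_mean.
pose b (c : nat -> bool) := [tuple of map c (map_tuple (layer_coin t) (in_tuple xs))].
transitivity (Ec (fun c => Phi (mask_move t.2 (b c) xs) c)).
  by congr Ec; apply/funext => c; rewrite map_layer.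
rewrite (@Ec_cond _ _ layer_bias01 _ b (fun m c => Phi (mask_move t.2 m xs) c)
  (map (layer_coin t) xs) (fun m => K (mask_move t.2 m xs))).
- by congr Ec; apply/funext => c; rewrite map_layer.
- by move=> c c' h; apply: val_inj => /=; apply/eq_in_map.
- by move=> m; exact: uPhi.
- by move=> m i /mapP[x _ ->].
Qed.

Lemma uses_layer t (Phi : seq X -> (nat -> bool) -> R) (K : seq X -> seq nat) xs :
  (forall ys, uses (K ys) (Phi ys)) ->
  uses (map (layer_coin t) xs ++ flatten [seq K (mask_move t.2 m xs) |
     m <- map val (enum {: (size xs).-tuple bool})])
    (fun c => Phi (map (layer t c) xs) c).
Proof.
move=> uPhi c c' h.
have -> : map (layer t c') xs = map (layer t c) xs.
  apply/eq_in_map => x xxs; rewrite /layer h// mem_cat map_f//.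
apply: uPhi => i iK; apply: h; rewrite mem_cat; apply/orP; right.
apply/flattenP; exists (K (map (layer t c) xs)) => //.
rewrite map_layer; apply/mapP; exists (map c (map (layer_coin t) xs)) => //.
apply/mapP; exists [tuple of map c (map_tuple (layer_coin t) (in_tuple xs))] => //.
by rewrite mem_enum.
Qed.

(** Distinct layers read disjoint sets of coins, so averaging over them composes their operators.
    The induction removes the last layer and absorbs it, by [uses_layer], into the functional
    evaluated after the preceding ones. *)
Lemma layers_cond ls (Phi : seq X -> (nat -> bool) -> R) (K : seq X -> seq nat) xs :
  uniq ls -> (forall ys, uses (K ys) (Phi ys)) ->
  (forall t ys x, t \in ls -> layer_coin t x \notin K ys) ->
  Ec (fun c => Phi (map (layers ls c) xs) c) =
  foldr layer_mean (fun ys => Ec (Phi ys)) ls xs.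
Proof.
elim/last_ind: ls Phi K xs => [|ls t IH] Phi K xs.
  by move=> _ _ _ /=; congr Ec; apply/funext => c; rewrite map_id.
rewrite rcons_uniq => /andP[tls uls] uPhi lK; rewrite foldr_rcons.
have e1 : (fun c => Phi (map (layers (rcons ls t) c) xs) c) =
          (fun c => Phi (map (layer t c) (map (layers ls c) xs)) c).
  by apply/funext => c; rewrite -map_comp; congr (Phi _ c); apply/eq_map => x;
    rewrite layers_rcons.
rewrite e1 (IH (fun ys c => Phi (map (layer t c) ys) c) _ _ uls
   (fun ys => @uses_layer t _ _ ys uPhi)).
  congr (foldr _ _ _ _); apply/funext => ys; apply: layer_cond uPhi _ => zs x.
  by apply: lK; rewrite mem_rcons mem_head.
move=> t' ys x t'ls; rewrite mem_cat negb_or; apply/andP; split.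
  apply/mapP => -[y _]; apply: layer_coin_neq.
  by apply: contraNneq tls => <-.
apply/flattenP => -[J /mapP[m _ ->]]; apply/negP; apply: lK.
by rewrite mem_rcons inE t'ls orbT.
Qed.

Definition layers_mean (ls : seq (bool * nat)) (h : seq X -> R) : seq X -> R :=
  foldr layer_mean h ls.

Lemma Ec_layers ls (h : seq X -> R) xs : uniq ls ->
  Ec (fun c => h (map (layers ls c) xs)) = layers_mean ls h xs.
Proof.
move=> uls; rewrite (@layers_cond ls (fun ys c => h ys) (fun=> [::]))//.
by congr (foldr _ _ _ _); apply/funext => ys; rewrite Ec_cst.
Qed.

(** The two copies of layer [k] have the same law: only the number of pairs met by [xs] and their
    common bias matter. *)
Lemma layer_mean_swap b b' k h xs :
  layer_mean (b, k) h xs = layer_mean (b', k) h xs.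
Proof.
(* One entry, hence one coin, for each pair met by [xs]: particles of the same pair read the same
   coin. *)
pose rs := undup (map (layer_rep k) xs).
pose G (m : seq bool) := h [seq if nth false m (index (layer_rep k x) rs)
  then sg k x else x | x <- xs].
have key a : layer_mean (a, k) h xs = bern_mean (nseq (size rs) (dl k)) G.
  have ur : uniq [seq pickle ((a, k), r) | r <- rs].
    by rewrite map_inj_uniq ?undup_uniq// => x y /(pcan_inj pickleK) [].
  have -> : nseq (size rs) (dl k) = map layer_bias [seq pickle ((a, k), r) | r <- rs].
    by elim: {G ur}rs => //= r rs' ->; rewrite /layer_bias pickleK.
  rewrite -(Ec_uniq layer_bias01)//; congr Ec; apply/funext => c; rewrite /G.
  congr h; apply/eq_in_map => x xxs; rewrite /layer/=.
  have xr : layer_rep k x \in rs by rewrite mem_undup map_f.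
  rewrite -map_comp (nth_map (layer_rep k x)) ?index_mem//=.
  by rewrite nth_index.
by rewrite !key.
Qed.

Lemma layer_mean_le t (h h' : seq X -> R) xs :
  (forall c, h (map (layer t c) xs) <= h' (map (layer t c) xs)) ->
  layer_mean t h xs <= layer_mean t h' xs.
Proof.
move=> le; apply: Ec_le => //; try exact: layer_bias01.
- move=> c c' hc; congr h; apply/eq_in_map => x xxs.
  by rewrite /layer hc//; exact: (map_f (layer_coin t) xxs).
- move=> c c' hc; congr h'; apply/eq_in_map => x xxs.
  by rewrite /layer hc//; exact: (map_f (layer_coin t) xxs).
Qed.

End layers.

Section layers_mean.
Context {R : realType} {X : countType}.
Variables (sg : nat -> X -> X) (dl : nat -> R).
Hypothesis sgK : forall k, involutive (sg k).
Hypothesis dl01 : forall k, 0 < dl k < 1.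
Local Notation Ec := (Ec (layer_bias (X := X) dl)).
Local Notation avg := (avg sg dl).
Local Notation layer := (layer sg).
Local Notation layers := (layers sg).
Local Notation layer_mean := (layer_mean sg dl).
Local Notation layers_mean := (layers_mean sg dl).
Let bias01 := layer_bias01 (X := X) dl01.

Definition avgs (ks : seq nat) (f : X -> R) : X -> R := foldr avg f ks.

Lemma avg_le k f g : (forall x, f x <= g x) -> forall x, avg k f x <= avg k g x.
Proof.
by move=> fg x; have /andP[d0 d1] := dl01 k; rewrite lerD// ler_wpM2l// ?subr_ge0 ltW.
Qed.

Lemma avg_cst k (a : R) x : avg k (fun=> a) x = a.
Proof. by rewrite /avg -mulrDl subrK mul1r. Qed.

Lemma avgs_le ks f g : (forall x, f x <= g x) -> forall x, avgs ks f x <= avgs ks g x.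
Proof. by move=> fg; elim: ks => //= k ks IH; exact: avg_le. Qed.

Lemma avgs_cst ks (a : R) x : avgs ks (fun=> a) x = a.
Proof.
elim: ks x => //= k ks IH x; rewrite -[RHS](avg_cst k a x).
by congr (avg k _ x); apply/funext.
Qed.

Lemma avgs_ge0 ks f : (forall x, 0 <= f x) -> forall x, 0 <= avgs ks f x.
Proof. by move=> f0 x; rewrite -(avgs_cst ks 0 x); exact: avgs_le. Qed.

Lemma uses_prod t (f : X -> R) xs :
  uses (map (layer_coin sg t) xs) (fun c => \prod_(x <- xs) f (layer t c x)).
Proof.
move=> c c' h; rewrite big_seq [RHS]big_seq; apply: eq_bigr => x xxs.
by rewrite /layer h// map_f.
Qed.

Lemma Ec_layer t (f : X -> R) x : Ec (fun c => f (layer t c x)) = avg t.2 f x.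
Proof.
rewrite /layer (Ec1 bias01 _ (fun b => f (if b then sg t.2 x else x))).
by rewrite layer_bias_coin.
Qed.

(** Different pairs have independent coins, so the expectation factors over the pairs. A pair
    holding one particle gives its average exactly; only a pair holding two particles makes the
    inequality strict. *)
Lemma layer_mean_prod t (f : X -> R) xs : (forall x, 0 <= f x) -> uniq xs ->
  layer_mean t (fun ys => \prod_(y <- ys) f y) xs <= \prod_(x <- xs) avg t.2 f x.
Proof.
move=> f0; rewrite /layer_mean.
under [X in Ec X]funext => c do rewrite big_map.
have avg0 y : 0 <= avg t.2 f y by rewrite -(avg_cst t.2 0 y); exact: avg_le.
(* Strong induction on the number of particles, since one or two of them are removed according to
   whether the partner of [x] is present. *)
elim: {xs}(size xs).+1 {-2}xs (ltnSn (size xs)) => // n IH [|x xs] /=.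
  by move=> _ _; rewrite big_nil; under [X in Ec X]funext do rewrite big_nil; rewrite Ec_cst.
rewrite ltnS => sxs /andP[xxs uxs].
have split_off (F1 : (nat -> bool) -> R) ys :
    uses [:: layer_coin sg t x] F1 -> (size ys < n)%N -> uniq ys ->
    x \notin ys -> sg t.2 x \notin ys -> 0 <= Ec F1 ->
    Ec (fun c => F1 c * \prod_(y <- ys) f (layer t c y)) <=
    Ec F1 * \prod_(y <- ys) avg t.2 f y.
  move=> uF sys uys xys sxys F10.
  rewrite (Ec_indep bias01 uF (@uses_prod t f ys)).
    by rewrite ler_wpM2l// IH.
  move=> i; rewrite inE => /eqP ->; apply/mapP => -[y yys].
  move=> /(layer_coin_eq sgK) [xy|xy]; first by rewrite xy yys in xys.
  by rewrite xy sgK yys in sxys.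
case sx : (sg t.2 x \in xs); last first.
  rewrite big_cons; under [X in Ec X]funext do rewrite big_cons.
  rewrite -(Ec_layer t f x); apply: split_off => //.
  - by move=> c c' h; rewrite /layer h// mem_head.
  - by rewrite sx.
  - exact: Ec_ge0.
have pxs := perm_to_rem sx; set ys := rem _ _ in pxs.
have E1 (g : X -> R) : \prod_(y <- x :: xs) g y = (g x * g (sg t.2 x)) * \prod_(y <- ys) g y.
  by rewrite big_cons (perm_big _ pxs)/= big_cons mulrA.
rewrite E1; under [X in Ec X]funext do rewrite E1.
have uys : uniq (sg t.2 x :: ys) by rewrite -(perm_uniq pxs).
have eF : Ec (fun c => f (layer t c x) * f (layer t c (sg t.2 x))) = f x * f (sg t.2 x).
  rewrite /layer layer_coin_sg//.
  rewrite (Ec1 bias01 _ (fun b => f (if b then sg t.2 x else x) *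
    f (if b then sg t.2 (sg t.2 x) else sg t.2 x)))/= sgK.
  by rewrite (mulrC (f (sg _ _))) -mulrDl subrK mul1r.
apply: le_trans (split_off _ ys _ _ _ _ _ _) _.
- by move=> c c' h; rewrite /layer layer_coin_sg// h// mem_head.
- by rewrite (leq_trans _ sxs)//= (perm_size pxs)/=.
- by case/andP: uys.
- by apply: contra xxs; exact: mem_rem.
- by case/andP: uys.
- by rewrite eF mulr_ge0.
rewrite eF ler_wpM2r//; first exact: prodr_ge0.
rewrite /avg sgK; have /andP[d0 d1] := dl01 t.2.
(* The difference of the two sides is [dl (1 - dl) (f x - f (sg x)) ^ 2]. *)
rewrite -subr_ge0 [leRHS](_ : _ = dl t.2 * (1 - dl t.2) * (f x - f (sg t.2 x)) ^+ 2).
  by rewrite mulr_ge0 ?sqr_ge0// mulr_ge0 ?subr_ge0// ltW.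
by ring.
Qed.

Lemma layers_mean_cst ls (a : R) xs : layers_mean ls (fun=> a) xs = a.
Proof.
elim: ls xs => //= t ls IH xs; rewrite /layer_mean.
by under [X in Ec X]funext do rewrite -/(layers_mean _ _ _) IH; rewrite Ec_cst.
Qed.

Lemma layers_mean_prod ls (f : X -> R) xs : (forall x, 0 <= f x) -> uniq xs ->
  layers_mean ls (fun ys => \prod_(y <- ys) f y) xs <=
  \prod_(x <- xs) avgs (unzip2 ls) f x.
Proof.
move=> f0; elim: ls xs => //= t ls IH xs uxs.
apply: le_trans (layer_mean_prod t (avgs_ge0 (unzip2 ls) f0) uxs).
apply: layer_mean_le => // c; apply: IH.
by rewrite map_inj_uniq//; exact/inv_inj/layerK.
Qed.

Lemma layers_mean1 ls (f : X -> R) x :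
  layers_mean ls (fun ys => \prod_(y <- ys) f y) [:: x] = avgs (unzip2 ls) f x.
Proof.
elim: ls x => [|t ls IH] x /=; first by rewrite big_seq1.
by rewrite -(Ec_layer t); congr Ec; apply/funext => c; exact: IH.
Qed.

(** Which coin is read depends on the position reached through [ls], but that position is determined
    by coins of other layers, so the coin keeps its bias. *)
Lemma layers_coin ls t x : uniq ls -> t \notin ls ->
  Ec (fun c => (c (layer_coin sg t (layers ls c x)))%:R) = dl t.2.
Proof.
move=> uls tls.
rewrite (@layers_cond _ _ _ _ dl01 ls
  (fun ys c => (c (layer_coin sg t (head x ys)))%:R)
  (fun ys => [:: layer_coin sg t (head x ys)]) [:: x])//=.
- rewrite -[RHS](layers_mean_cst ls _ [:: x]); congr (foldr _ _ _ _).
  apply/funext => ys; rewrite (Ec1 bias01 _ (fun b : bool => b%:R))/=.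
  by rewrite layer_bias_coin mulr0 add0r mulr1.
- by move=> ys c c' ->//; exact: mem_head.
- move=> t' ys y t'ls; rewrite inE; apply/eqP; apply: layer_coin_neq.
  by apply: contraNneq tls => <-.
Qed.

(* The second half applies the inverses of fresh copies of the layers of the first half:
   this makes the law of the product invariant under inversion. *)
Definition palindrome (b : bool) (M : nat) : seq (bool * nat) :=
  map (pair b) (iota 0 M) ++ map (pair (~~ b)) (rev (iota 0 M)).

Lemma palindrome_uniq b M : uniq (palindrome b M).
Proof.
have pI (a : bool) : injective (pair a : nat -> _) by move=> i j [].
rewrite cat_uniq !map_inj_uniq ?rev_uniq ?iota_uniq//= andbT.
by apply/hasPn => _ /mapP[i _ ->]; apply/mapP => -[j _ []]; case: b.
Qed.

Lemma palindrome_rev b M : rev (palindrome b M) = palindrome (~~ b) M.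
Proof. by rewrite rev_cat -!map_rev revK /palindrome negbK. Qed.

Lemma palindrome_unzip2 b M : unzip2 (palindrome b M) = iota 0 M ++ rev (iota 0 M).
Proof. by rewrite /unzip2 map_cat -!map_comp !map_id. Qed.

(** Changing [b] only exchanges the two copies of each layer. Since [palindrome_rev] identifies the
    inverse product with the other value of [b], a finite product and its inverse have the same
    law. *)
Lemma palindrome_mean b M h : layers_mean (palindrome b M) h = layers_mean (palindrome (~~ b) M) h.
Proof.
have sw ls : layers_mean [seq (~~ t.1, t.2) | t <- ls] h = layers_mean ls h.
  elim: ls => //= -[a k] ls IH; rewrite -/(layers_mean _ _) IH.
  by apply/funext => xs; exact: layer_mean_swap.
rewrite -[RHS]sw /palindrome map_cat -!map_comp.
by congr (foldr _ _ (_ ++ _)); apply/eq_map => k /=; rewrite ?negbK.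
Qed.

(** Passing from [M] to [M.+1] inserts the two copies of layer [M] in the middle. If the first does
    not move the point, the second reads its coin at the same position. *)
Lemma palindrome_step b M c x :
  layers (palindrome b M.+1) c x != layers (palindrome b M) c x ->
  c (layer_coin sg (b, M) (layers (map (pair b) (iota 0 M)) c x)) ||
  c (layer_coin sg (~~ b, M) (layers (map (pair b) (iota 0 M)) c x)).
Proof.
apply: contraNT; rewrite negb_or => /andP[/negbTE c1 /negbTE c2].
rewrite /palindrome -addn1 iotaD/= rev_cat !map_cat -!catA/= !layers_cat/=.
by rewrite /layer c1/= c2.
Qed.

End layers_mean.

(** * The Borel sets of the symmetric group *)

Section borel_sym.
Context {X : countType}.
Implicit Types (xs ys : seq X) (s : sym X).

Definition cylinder xs ys : set (sym X) := [set s : sym X | map s xs = ys].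

Lemma cylinderI xs ys xs' ys' : exists us vs,
  cylinder xs ys `&` cylinder xs' ys' = cylinder us vs.
Proof.
have [sxy|sxy] := eqVneq (size xs) (size ys).
  exists (xs ++ xs'), (ys ++ ys'); apply/seteqP; split => s /=.
    by rewrite /cylinder/= map_cat => -[-> ->].
  rewrite /cylinder/= map_cat => /eqP; rewrite eqseq_cat ?size_map//.
  by case/andP => /eqP -> /eqP ->.
(* With different lengths the first cylinder is empty, and so is the intersection. *)
exists xs, ys; apply/seteqP; split => [s []//|s /= h].
by case/eqP: sxy; rewrite -h size_map.
Qed.

Lemma open_eval (x y : X) : @open (sym_topology X) [set s : sym X | s x = y].
Proof.
exists [set f : {ptws X -> discrete_topology X} | f x = y] => //.
have c : continuous (fun f : {ptws X -> discrete_topology X} => f x).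
  exact: (@proj_continuous X (fun=> discrete_topology X) x).
have h := iffLR (continuousP _) c.
exact: (h [set y] (discrete_open _)).
Qed.

(** The sets containing all functions that agree with [s] on some finite list form a filter. It
    converges to [s] pointwise, hence contains every open neighbourhood of [s]. *)
Lemma open_cylinder (O : set (sym_topology X)) (s : sym X) : open O -> O s ->
  exists xs, cylinder xs (map s xs) `<=` O.
Proof.
move=> [U oU <-] Us.
pose F : set_system {ptws X -> discrete_topology X} :=
  [set A | exists xs, forall g : X -> X, {in xs, g =1 s} -> A g].
have FF : Filter F.
  split; first by exists [::].
  - move=> A B [xs hA] [ys hB]; exists (xs ++ ys) => g h; split.
      by apply: hA => x xxs; apply: h; rewrite mem_cat xxs.
    by apply: hB => x xxs; apply: h; rewrite mem_cat xxs orbT.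
  - by move=> A B AB [xs hA]; exists xs => g h; apply: AB; exact: hA.
have : F --> (sym_to_fun s).
  apply/cvg_sup => x A [B [[V oV <-] Vs] BA]; exists [:: x] => g h.
  by apply: BA; rewrite /= h ?mem_head.
move=> /(_ U) [|xs h]; first exact: open_nbhs_nbhs.
exists xs => t /= hst; apply: h => x xxs.
by move/eq_in_map: hst; apply.
Qed.

Lemma measurable_eval (x y : X) : measurable ([set s | s x = y] : set (borel_sym X)).
Proof. by apply: sub_sigma_algebra; exact: open_eval. Qed.

Lemma measurable_cylinder xs ys : measurable (cylinder xs ys : set (borel_sym X)).
Proof.
elim: xs ys => [|x xs IH] [|y ys].
- by rewrite (_ : cylinder _ _ = setT)//; apply/seteqP; split.
- by rewrite (_ : cylinder _ _ = set0)//; apply/seteqP; split.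
- by rewrite (_ : cylinder _ _ = set0)//; apply/seteqP; split.
rewrite (_ : cylinder _ _ = [set s : sym X | s x = y] `&` cylinder xs ys).
  by apply: measurableI; [exact: measurable_eval|exact: IH].
by apply/seteqP; split => s /=; rewrite /cylinder/=; [case=> -> ->|case=> -> ->].
Qed.

Definition cylinders : set (set (sym X)) :=
  [set A | exists xs ys, A = cylinder xs ys].

(** As [X] is countable there are countably many cylinders, so every open set is a countable union
    of them. *)
Lemma borel_cylinders :
  (@measurable _ (borel_sym X) : set (set (sym X))) = <<s cylinders >>.
Proof.
apply/seteqP; split; last first.
  apply: smallest_sub; first exact: smallest_sigma_algebra.
  by move=> _ [xs [ys ->]]; exact: measurable_cylinder.
apply: smallest_sub; first exact: smallest_sigma_algebra.
move=> O oO.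
pose D := [set p : seq X * seq X | cylinder p.1 p.2 `<=` O].
have -> : O = \bigcup_(p in D) cylinder p.1 p.2.
  apply/seteqP; split => [s Os|s [p pD ps]]; last exact: pD.
  by have [xs hxs] := open_cylinder oO Os; exists (xs, map s xs).
apply: (@measurable_bigcup_countable _ (g_sigma_algebraType cylinders)) => p _.
by apply: sub_sigma_algebra; exists p.1, p.2.
Qed.

Lemma measurable_sym {d} {W : measurableType d} (S : W -> borel_sym X) :
  (forall x, dmeas (fun w => (S w : sym X) x)) -> measurable_fun setT S.
Proof.
move=> mS; apply: (@measurability _ _ W (borel_sym X) setT S cylinders borel_cylinders).
move=> _ [_ [xs [ys ->]] <-]; rewrite setTI.
elim: xs ys => [|x xs IH] [|y ys].
- by rewrite (_ : _ @^-1` _ = setT)//; apply/seteqP; split.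
- by rewrite (_ : _ @^-1` _ = set0)//; apply/seteqP; split.
- by rewrite (_ : _ @^-1` _ = set0)//; apply/seteqP; split.
rewrite (_ : _ @^-1` _ = [set w | (S w : sym X) x = y] `&` S @^-1` cylinder xs ys).
  by apply: measurableI; [exact: mS|exact: IH].
by apply/seteqP; split => s /=; rewrite /cylinder/=; [case=> -> ->|case=> -> ->].
Qed.

Lemma dmeas_eval (x : X) : dmeas (fun s : borel_sym X => (s : sym X) x).
Proof. by move=> y; exact: measurable_eval. Qed.

Lemma dmeas_map xs : dmeas (fun s : borel_sym X => map (s : sym X) xs).
Proof. by move=> ys; exact: measurable_cylinder. Qed.

Lemma measurable_sym_inv : measurable_fun setT (@sym_inv X : borel_sym X -> borel_sym X).
Proof.
apply: measurable_sym => x y.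
rewrite (_ : mkset _ = [set s : sym X | s y = x]); first exact: measurable_eval.
apply/seteqP; split => s /=; first by move=> <-; rewrite (sym_inv_funK s).
by move=> <-; rewrite (sym_funK s).
Qed.

Lemma sym_measure_unique {R : realType} (m1 m2 : {measure set (borel_sym X) -> \bar R}) :
  (m1 setT < +oo)%E ->
  (forall xs ys, m1 (cylinder xs ys) = m2 (cylinder xs ys)) ->
  forall A, measurable A -> m1 A = m2 A.
Proof.
move=> fin e12 A mA.
apply: (@measure_unique _ R (borel_sym X) cylinders (fun=> setT) borel_cylinders _ _ _ m1 m2) => //.
- by move=> _ _ [xs [ys ->]] [us [vs ->]]; have [a [b ->]] := cylinderI xs ys us vs; exists a, b.
- by move=> _; exists [::], [::]; apply/seteqP.
- by rewrite bigcup_const//; exists 0%N.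
- by move=> _ [xs [ys ->]]; exact: e12.
Qed.

End borel_sym.

(** * The limit of the stirring permutations *)

Section eventually_constant.
Context {d : measure_display} {W : measurableType d}.

Definition ends_at {T : Type} (u : nat -> T) (y : T) : Prop :=
  exists N, forall M, (N <= M)%N -> u M = y.

Lemma ends_at_unique {T : Type} (u : nat -> T) y z : ends_at u y -> ends_at u z -> y = z.
Proof.
by move=> [N hN] [N' hN']; rewrite -(hN _ (leq_maxl N N')) (hN' _ (leq_maxr N N')).
Qed.

Lemma dmeas_bind {T U : countType} (phi : W -> T) (psi : T -> W -> U) :
  dmeas phi -> (forall t, dmeas (psi t)) -> dmeas (fun w => psi (phi w) w).
Proof.
move=> mp ms u.
rewrite (_ : mkset _ = \bigcup_(t in setT) ([set w | phi w = t] `&` [set w | psi t w = u])).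
  by apply: measurable_bigcup_countable => t _; apply: measurableI; [exact: mp|exact: ms].
apply/seteqP; split => w /= [].
  by exists (phi w).
by move=> t _ [/= <- <-].
Qed.

Lemma measurable_ends_at {T : countType} (u : nat -> W -> T) (y : T) :
  (forall n, dmeas (u n)) -> measurable [set w | ends_at (u ^~ w) y].
Proof.
move=> mu; rewrite (_ : mkset _ = \bigcup_N \bigcap_(M in [set M | (N <= M)%N]) [set w | u M w = y]).
  by apply: bigcupT_measurable => N; apply: bigcap_measurable => [|M _]; [exists N => /=|exact: mu].
by apply/seteqP; split => w [N]; [move=> h; exists N|move=> _ h; exists N] => // M /h.
Qed.

End eventually_constant.

Section stirring_law.
Context {R : realType} {X : countType}.
Variables (sg : nat -> X -> X) (dl : nat -> R).
Hypothesis sgK : forall k, involutive (sg k).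
Hypothesis dl01 : forall k, 0 < dl k < 1.
Hypothesis dl_sum : (\sum_(k <oo) (dl k)%:E < +oo)%E.
Local Notation bias := (layer_bias (X := X) dl).
Local Notation W := (measurableTypeR R).
Let bias01 := layer_bias01 (X := X) dl01.
Let P : probability W R := coin_prob.

Lemma dmeas_coin i : dmeas (fun w : W => coins bias w i).
Proof.
move=> b; have [] := @bdd_coins _ _ bias01 [:: i] (fun c => (c i == b)%:R).
  by move=> c c' ->//; exact: mem_head.
move=> /(_ measurableT [set 1]) m _; have := m (measurable_set1 _).
rewrite setTI; congr measurable; apply/seteqP; split => w /=.
  by case: eqP => // _ /eqP; rewrite eq_sym oner_eq0.
by move=> ->; rewrite eqxx.
Qed.

Lemma dmeas_layers ls x : dmeas (fun w : W => layers sg ls (coins bias w) x).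
Proof.
elim/last_ind: ls => [|ls t IH] /=.
  exact: dmeas_cst.
under eq_fun do rewrite layers_rcons.
apply: (dmeas_bind (psi := fun y w => layer sg t (coins bias w) y)) => // y.
exact: (dmeas_comp (fun b : bool => if b then sg t.2 y else y) (dmeas_coin _)).
Qed.

Definition stirring (b : bool) (x : X) (M : nat) (w : W) : X :=
  layers sg (palindrome b M) (coins bias w) x.

Lemma dmeas_stirring b x M : dmeas (stirring b x M).
Proof. exact: dmeas_layers. Qed.

Lemma dmeas_map_stirring b xs M : dmeas (fun w => map (fun x => stirring b x M w) xs).
Proof.
elim: xs => [|x xs IH] /=.
  exact: dmeas_cst.
exact: (dmeas_comp (fun p => p.1 :: p.2) (dmeas_pair (dmeas_stirring b x M) IH)).
Qed.

Lemma stirring_step b x M :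
  measurable [set w | stirring b x M.+1 w != stirring b x M w] /\
  (P [set w | stirring b x M.+1 w != stirring b x M w] <= (dl M + dl M)%:E)%E.
Proof.
set A := mkset _.
have mA : measurable A.
  exact: (dmeas_set [set p | p.1 != p.2] (dmeas_pair (dmeas_stirring b x M.+1) (dmeas_stirring b x M))).
split => //; rewrite Ex_ind// lee_fin.
pose F a (w : W) : R := (coins bias w (layer_coin sg (a, M)
  (layers sg (map (pair b) (iota 0 M)) (coins bias w) x)))%:R.
have pI (a : bool) : injective (pair a : nat -> _) by move=> i j [].
have uls : uniq (map (pair b) (iota 0 M)) by rewrite map_inj_uniq ?iota_uniq.
have EF a : Ex P (F a) = dl M.
  rewrite -[RHS]/(dl (a, M).2) -(layers_coin sg dl01 x uls)//.
  by apply/mapP => -[i]; rewrite mem_iota add0n => /andP[_ iM] [_ Mi]; rewrite Mi ltnn in iM.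
have bF a : bdd (F a).
  apply: (dmeas_bdd (h := fun c : bool => c%:R)); last first.
    by exists 1 => -[]; rewrite ?normr1 ?normr0.
  apply: (dmeas_bind (psi := fun y w => coins bias w (layer_coin sg (a, M) y))).
    exact: dmeas_layers.
  by move=> y; exact: dmeas_coin.
(* Union bound: each term [dl M] is the probability that the coin of one of the two inserted layers,
   read at the common position, shows [true]. *)
rewrite -{1}(EF b) -(EF (~~ b)) -ExD//; apply: Ex_le => //.
- exact: bdd_ind.
- exact: bddD.
move=> w; have [Aw|Aw] := pselect (A w); last first.
  by rewrite indF// addr_ge0// ler0n.
rewrite indT// /F; have /orP[->|->] := palindrome_step Aw.
  by rewrite lerDl ler0n.
by rewrite lerDr ler0n.
Qed.

(** Both values of [b] are required: the products for [true] are the inverses of those for [false],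
    and their limit is what makes the limit map bijective. *)
Definition stabilizes (w : W) : Prop :=
  forall b x, exists y, ends_at (stirring b x ^~ w) y.

(* Borel-Cantelli: the step from M to M + 1 moves a given point with probability at most
   [2 (dl M)]. *)
Lemma stabilizes_ae : {ae P, forall w, stabilizes w}.
Proof.
pose A (p : bool * X) M := [set w | stirring p.1 p.2 M.+1 w != stirring p.1 p.2 M w].
pose N n := if unpickle n is Some p then lim_sup_set (A p) else set0.
have nN : P.-negligible (\bigcup_n N n).
  apply: negligible_bigcup => n; rewrite /N; case: unpickle => [p|]; last exact: negligible_set0.
  have mA M : measurable (A p M) by have [] := stirring_step p.1 p.2 M.
  exists (lim_sup_set (A p)); split => //.
    by apply: bigcapT_measurable => k; apply: bigcup_measurable.
  apply: lim_sup_set_cvg0 => //.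
  apply: (@le_lt_trans _ _ (\sum_(k <oo) ((dl k)%:E + (dl k)%:E))%E).
    apply: lee_nneseries => // k _.
    by rewrite -EFinD; have [] := stirring_step p.1 p.2 k.
  have d0 k : (0 <= (dl k)%:E)%E by rewrite lee_fin ltW//; have /andP[] := dl01 k.
  by rewrite nneseriesD// lte_add_pinfty.
apply: negligibleS nN => w /= /existsNP[b /existsNP[x nb]].
exists (pickle (b, x)) => //; rewrite /N pickleK => n _.
apply: contrapT => h; apply: nb; exists (stirring b x n w), n => M nM.
rewrite -(subnKC nM); elim: (M - n)%N => [|j IH]; first by rewrite addn0.
rewrite addnS -[RHS]IH; apply/eqP; apply: contrapT => /negP ne.
by apply: h; exists (n + j)%N => //=; exact: leq_addr.
Qed.

Definition limit_spec (w : W) (s : sym X) : Prop :=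
  forall x, ends_at (stirring false x ^~ w) (s x) /\
            ends_at (stirring true x ^~ w) (sym_inv s x).

Lemma stirringK b x M w : stirring (~~ b) (stirring b x M w) M w = x.
Proof. by rewrite /stirring -palindrome_rev layersK. Qed.

Lemma limit_exists w : stabilizes w -> exists s, limit_spec w s.
Proof.
move=> st; pose g b x := projT1 (cid (st b x)).
have gP b x : ends_at (stirring b x ^~ w) (g b x) := projT2 (cid (st b x)).
have gK b : cancel (g b) (g (~~ b)).
  move=> x; have [N hN] := gP b x; have [N' hN'] := gP (~~ b) (g b x).
  rewrite -(hN' _ (leq_maxr N N')) -(hN _ (leq_maxl N N')); exact: stirringK.
have gK' : cancel (g true) (g false) := gK true.
by exists (Sym (gK false) gK') => x; split; exact: gP.
Qed.

(** On the null event where the products do not stabilise the value is the identity; elsewhere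
    [limit_spec] determines the permutation, which makes the choice measurable. *)
Definition stirring_limit (w : W) : borel_sym X := xget sym_id (limit_spec w).

Lemma stirring_limitP w : stabilizes w -> limit_spec w (stirring_limit w).
Proof. by move=> /limit_exists; exact: xgetPex. Qed.

Lemma measurable_stabilizes : measurable [set w | stabilizes w].
Proof.
rewrite (_ : mkset _ = \bigcap_(p : bool * X) \bigcup_(y in setT)
  [set w | ends_at (stirring p.1 p.2 ^~ w) y]).
  rewrite -[X in measurable X]setCK setC_bigcap; apply: measurableC.
  apply: measurable_bigcup_countable => p _; apply: measurableC.
  apply: measurable_bigcup_countable => y _; apply: measurable_ends_at => n.
  exact: dmeas_stirring.
apply/seteqP; split => w /=.
  by move=> st p _; have [y ?] := st p.1 p.2; exists y.
by move=> st b x; have [y _ ?] := st (b, x) Logic.I; exists y.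
Qed.

Lemma measurable_stirring_limit : measurable_fun setT stirring_limit.
Proof.
apply: measurable_sym => x y.
rewrite (_ : mkset _ =
  ([set w | stabilizes w] `&` [set w | ends_at (stirring false x ^~ w) y]) `|`
  (~` [set w | stabilizes w] `&` [set _ | x = y])).
  apply: measurableU; apply: measurableI.
  - exact: measurable_stabilizes.
  - by apply: measurable_ends_at => n; exact: dmeas_stirring.
  - by apply: measurableC; exact: measurable_stabilizes.
  - exact: measurable_prop.
have bad w : ~ stabilizes w -> stirring_limit w = sym_id.
  move=> nst; rewrite /stirring_limit xgetPN// => s hs; apply: nst => -[] z.
    by exists (sym_inv s z); have [] := hs z.
  by exists (s z); have [] := hs z.
apply/seteqP; split => w /=.
  have [st|nst] := pselect (stabilizes w).
    by move=> <-; left; split => //; have [] := stirring_limitP st x.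
  by rewrite bad//= => <-; right.
move=> [[st e]|[nst <-]]; last by rewrite bad.
by have [e' _] := stirring_limitP st x; exact: ends_at_unique e' e.
Qed.

HB.instance Definition _ := isMeasurableFun.Build _ _ W (borel_sym X)
  stirring_limit measurable_stirring_limit.

Definition stirring_law : probability (borel_sym X) R :=
  distribution P stirring_limit.

Lemma Ex_stirring_law (F : borel_sym X -> R) : bdd F ->
  Ex stirring_law F = Ex P (F \o stirring_limit).
Proof.
move=> bF; have bF' : bdd (F \o stirring_limit).
  case: bF => mF [B FB]; split; last by exists B => w; exact: FB.
  exact: measurableT_comp mF measurable_stirring_limit.
apply: EFin_inj; rewrite -!ExE// integral_distribution//.
  by apply/measurable_EFinP; case: bF.
exact: bdd_integrable bF'.
Qed.

(** The positions of finitely many particles are almost surely eventually constant, so dominated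
    convergence applies to bounded [h], for the product and for its inverse alike. *)
Lemma stirring_limit_cvg (h : seq X -> R) xs : (exists B, forall ys, `|h ys| <= B) ->
  layers_mean sg dl (palindrome false M) h xs @[M --> \oo] -->
    Ex P (fun w => h (map (stirring_limit w) xs)) /\
  layers_mean sg dl (palindrome true M) h xs @[M --> \oo] -->
    Ex P (fun w => h (map (sym_inv (stirring_limit w)) xs)).
Proof.
move=> [B hB].
have ma (f : X -> nat -> X) g : (forall x, ends_at (f x) (g x)) ->
    ends_at (fun M => map (f ^~ M) xs) (map g xs).
  move=> fg; elim: xs => [|x ys [N hN]]; first by exists 0%N.
  have [N' hN'] := fg x; exists (maxn N N') => M; rewrite geq_max => /andP[/hN e /hN' e'] /=.
  by rewrite e e'.
have gen b (Y : W -> X -> X) : (forall xs, dmeas (fun w => map (Y w) xs)) ->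
    (forall w, stabilizes w -> forall x, ends_at (stirring b x ^~ w) (Y w x)) ->
    layers_mean sg dl (palindrome b M) h xs @[M --> \oo] -->
    Ex P (fun w => h (map (Y w) xs)).
  move=> mY YP.
  have -> : (fun M => layers_mean sg dl (palindrome b M) h xs) =
      (fun M => Ex P (fun w => h (map (fun x => stirring b x M w) xs))).
    by apply/funext => M; rewrite -(Ec_layers sg dl01 h xs (palindrome_uniq b M)).
  apply: (@Ex_cvg _ _ _ _ _ _ B) => //.
  - by move=> n; have [] := dmeas_bdd (dmeas_map_stirring b xs n) (ex_intro _ B hB).
  - exact: (dmeas_bdd (mY xs) (ex_intro _ B hB)).
  case: stabilizes_ae => N [mN N0 sN]; exists N; split => // w /= nc; apply: sN => /= st.
  apply: nc; have [K hK] := ma _ _ (YP w st); apply: cvg_near_cst.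
  by near=> M; rewrite hK//; near: M; exact: nbhs_infty_ge.
have mS := measurable_stirring_limit.
have mmap xs' : dmeas (fun w => map (stirring_limit w) xs').
  by move=> ys; rewrite -[X in measurable X]setTI; exact: (mS measurableT _ (measurable_cylinder xs' ys)).
have mmap' xs' : dmeas (fun w => map (sym_inv (stirring_limit w)) xs').
  move=> ys; rewrite -[X in measurable X]setTI.
  exact: (measurableT_comp measurable_sym_inv mS measurableT (measurable_cylinder xs' ys)).
by split; apply: gen => // w /stirring_limitP + x => /(_ x)[].
Unshelve. all: by end_near. Qed.

Lemma stirring_law_cvg (h : seq X -> R) xs : (exists B, forall ys, `|h ys| <= B) ->
  layers_mean sg dl (palindrome false M) h xs @[M --> \oo] -->
    Ex stirring_law (fun s => h (map (s : sym X) xs)).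
Proof.
move=> hB; rewrite Ex_stirring_law; first by have [] := stirring_limit_cvg xs hB.
by apply: dmeas_bdd hB; exact: dmeas_map.
Qed.

(** On a cylinder the law and its image under inversion are limits of the finite means for the two
    palindromes, which are equal by [palindrome_mean]; cylinders are stable under intersection and
    generate the Borel sets. *)
Lemma stirring_law_symmetric : symmetric_law stirring_law.
Proof.
pose inv_limit := @sym_inv X \o stirring_limit.
have minv : measurable_fun setT (inv_limit : W -> borel_sym X).
  exact: measurableT_comp measurable_sym_inv measurable_stirring_limit.
pose invRV : {RV P >-> borel_sym X} :=
  HB.pack (inv_limit : W -> borel_sym X) (isMeasurableFun.Build _ _ W (borel_sym X) inv_limit minv).
move=> A mA.
apply: (sym_measure_unique (m1 := stirring_law) (m2 := distribution P invRV)) => //.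
  by rewrite (@le_lt_trans _ _ 1%E) ?probability_le1// ltry.
move=> xs ys; rewrite /stirring_law /distribution /pushforward/=.
pose h (zs : seq X) : R := (zs == ys)%:R.
have hB : exists B, forall zs, `|h zs| <= B.
  by exists 1 => zs; rewrite normr_nat lern1 leq_b1.
have [c1 c2] := stirring_limit_cvg xs hB.
have : Ex P (fun w => h (map (stirring_limit w) xs)) =
       Ex P (fun w => h (map (sym_inv (stirring_limit w)) xs)).
  apply: cvg_unique c1 _ => //.
  rewrite (_ : (fun M => layers_mean sg dl (palindrome false M) h xs) =
    (fun M => layers_mean sg dl (palindrome true M) h xs))//.
  by apply/funext => M; rewrite palindrome_mean.
have indh (Y : W -> borel_sym X) : measurable_fun setT Y ->
    P (Y @^-1` cylinder xs ys) = (Ex P (fun w => h (map (Y w : sym X) xs)))%:E.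
  move=> mY; rewrite Ex_ind; last first.
    by rewrite -[X in measurable X]setTI; apply: mY => //; exact: measurable_cylinder.
  congr EFin; congr Ex; apply/funext => w; rewrite /h /ind.
  by congr ((nat_of_bool _)%:R); apply/asboolP/eqP.
by move=> e; rewrite (indh _ measurable_stirring_limit) (indh _ minv) e.
Qed.

End stirring_law.

Section stirring_law_consequences.
Context {R : realType} {X : countType}.

(** Functions with values in [[0, 1]] keep the products bounded, so the inequality survives the
    passage to infinitely many layers; the one-particle avoidance probabilities are of this kind. *)
Definition negatively_dependent (mu : probability (borel_sym X) R) : Prop :=
  forall (f : X -> R) (xs : seq X), (forall x, 0 <= f x <= 1) -> uniq xs ->
    Ex mu (fun s => \prod_(x <- xs) f ((s : sym X) x)) <=
    \prod_(x <- xs) Ex mu (fun s => f ((s : sym X) x)).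

Variables (sg : nat -> X -> X) (dl : nat -> R).
Hypothesis sgK : forall k, involutive (sg k).
Hypothesis dl01 : forall k, 0 < dl k < 1.
Hypothesis dl_sum : (\sum_(k <oo) (dl k)%:E < +oo)%E.
Let mu := stirring_law sgK dl01.

Lemma prod_le1 (f : X -> R) : (forall x, 0 <= f x <= 1) ->
  exists B, forall ys, `|\prod_(y <- ys) f y| <= B.
Proof.
move=> f01; exists 1 => ys.
suff : 0 <= \prod_(y <- ys) f y <= 1 by move=> /andP[p0 p1]; rewrite ger0_norm.
elim: ys => [|y ys /andP[IH0 IH1]]; first by rewrite big_nil ler01 lexx.
by have /andP[f0 f1] := f01 y; rewrite big_cons mulr_ge0//= mulr_ile1.
Qed.

Lemma stirring_law_avgs (f : X -> R) x : (forall x, 0 <= f x <= 1) ->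
  avgs sg dl (iota 0 M ++ rev (iota 0 M)) f x @[M --> \oo] -->
  Ex mu (fun s => f ((s : sym X) x)).
Proof.
move=> f01; have := @stirring_law_cvg _ _ _ _ sgK dl01 dl_sum _ [:: x] (prod_le1 f01).
rewrite (_ : (fun s : borel_sym X => _) = (fun s => f ((s : sym X) x))); last first.
  by apply/funext => s; rewrite /= big_seq1.
rewrite (_ : (fun M => _) = (fun M => avgs sg dl (iota 0 M ++ rev (iota 0 M)) f x))//.
by apply/funext => M; rewrite layers_mean1// palindrome_unzip2.
Qed.

Lemma stirring_law_negdep : negatively_dependent mu.
Proof.
move=> f xs f01 uxs.
have := @stirring_law_cvg _ _ _ _ sgK dl01 dl_sum _ xs (prod_le1 f01).
rewrite (_ : (fun s : borel_sym X => _) =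
  (fun s => \prod_(x <- xs) f ((s : sym X) x))); last first.
  by apply/funext => s; rewrite big_map.
move=> c; apply: (ler_cvg_to c).
  have {c uxs} : forall ys : seq X,
      \prod_(x <- ys) avgs sg dl (iota 0 M ++ rev (iota 0 M)) f x @[M --> \oo] -->
      \prod_(x <- ys) Ex mu (fun s => f ((s : sym X) x)).
    elim=> [|y ys IH].
      by under eq_fun do rewrite big_nil; rewrite big_nil; exact: cvg_cst.
    under eq_fun do rewrite big_cons; rewrite big_cons.
    by apply: cvgM => //; exact: stirring_law_avgs.
  exact.
near=> M; rewrite -(palindrome_unzip2 false); apply: layers_mean_prod => //.
by move=> x; have /andP[] := f01 x.
Unshelve. all: by end_near. Qed.

End stirring_law_consequences.

(** * Walks avoiding the origin *)

Section avoidance.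
Context {R : realType} {X : countType}.
Variables (o : X) (mu : probability (borel_sym X) R).

(* The probability that no particle of [xs] is at [o] at any time in [0, n]. *)
Fixpoint avoid (n : nat) (xs : seq X) : R :=
  (o \notin xs)%:R *
  if n is m.+1 then Ex mu (fun s => avoid m (map (s : sym X) xs)) else 1.

(* The probability that the walk from [o] does not return before time [k + 1]. *)
Definition no_return (k : nat) : R :=
  if k is m.+1 then Ex mu (fun s => avoid m [:: (s : sym X) o]) else 1.

Lemma avoid01 n xs : 0 <= avoid n xs <= 1.
Proof.
elim: n xs => [|n IH] xs /=; first by rewrite mulr1 ler0n lern1 leq_b1.
have b : bdd (fun s : borel_sym X => avoid n (map (s : sym X) xs)).
  apply: (dmeas_bdd (h := avoid n) (dmeas_map xs)); exists 1 => ys.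
  by have /andP[a0 a1] := IH ys; rewrite ger0_norm.
have e0 : 0 <= Ex mu (fun s => avoid n (map (s : sym X) xs)).
  by apply: Ex_ge0 => s; have /andP[] := IH (map (s : sym X) xs).
rewrite mulr_ge0// mulr_ile1// ?lern1 ?leq_b1//.
by apply: Ex_le1 => // s; have /andP[] := IH (map (s : sym X) xs).
Qed.

Lemma bdd_avoid n xs : bdd (fun s : borel_sym X => avoid n (map (s : sym X) xs)).
Proof.
apply: (dmeas_bdd (h := avoid n) (dmeas_map xs)); exists 1 => ys.
by have /andP[a0 a1] := avoid01 n ys; rewrite ger0_norm.
Qed.

(** A permutation keeps the particles distinct, so the induction hypothesis applies after the first
    step; negative dependence is then used with [f] the one-particle avoidance probability over the
    remaining time. *)
Lemma avoid_prod n xs : negatively_dependent mu -> uniq xs ->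
  avoid n xs <= \prod_(x <- xs) avoid n [:: x].
Proof.
move=> nd; have a01 m x := avoid01 m [:: x].
have p0 m ys : 0 <= \prod_(x <- ys) avoid m [:: x].
  by apply: prodr_ge0 => x _; have /andP[] := a01 m x.
elim: n xs => [|n IH] xs uxs; have [oxs|oxs] := boolP (o \in xs).
- by rewrite {1}/avoid oxs mul0r.
- rewrite {1}/avoid oxs mul1r big_seq big1// => x xxs.
  by rewrite /= inE mulr1; case: eqP => // ox; rewrite ox xxs in oxs.
- by rewrite {1}/avoid oxs mul0r.
rewrite /= oxs mul1r.
rewrite (_ : \prod_(x <- xs) _ = \prod_(x <- xs) Ex mu (fun s => avoid n [:: (s : sym X) x])).
  apply: le_trans (nd (fun x => avoid n [:: x]) xs (a01 n) uxs).
  apply: Ex_le.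
  - exact: bdd_avoid.
  - by apply: bdd_prod => x; exact: (bdd_avoid n [:: x]).
  move=> s; apply: le_trans (IH _ _) _; last by rewrite big_map.
  by rewrite map_inj_uniq//; exact: can_inj (@sym_funK _ s).
rewrite big_seq [RHS]big_seq; apply: eq_bigr => x xxs.
by rewrite inE; case: eqP => [ox|_]; [rewrite ox xxs in oxs|rewrite mul1r].
Qed.

End avoidance.

Section return_times.
Context {R : realType} {d : measure_display} {W : measurableType d}.
Variable P : probability W R.

Lemma return_timeP (T : Type) (Y : nat -> W -> T) (a : T) w :
  return_time (R := R) Y a w = +oo%E <-> forall n, (0 < n)%N -> Y n w <> a.
Proof.
rewrite /return_time; split => [e n n0 Yn|h].
  suff : (ereal_inf [set n%:R%:E | n in [set n : nat | (0 < n)%N /\ Y n w = a]]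
          <= (n%:R : R)%:E)%E by rewrite e.
  by apply: ereal_inf_lbound; exists n.
rewrite (_ : [set _ | _ in _] = set0) ?ereal_inf0//.
by rewrite -subset0 => r [n [n0 Yn] _]; exact: (h n n0 Yn).
Qed.

Definition no_return_by {T : Type} (Y : nat -> W -> T) (a : T) (k : nat) : set W :=
  [set w | forall i, (0 < i <= k)%N -> Y i w <> a].

Lemma no_return_by_cvg (T : countType) (Y : nat -> W -> T) (a : T) :
  (forall n, dmeas (Y n)) ->
  [/\ forall k, measurable (no_return_by Y a k),
      (fun k => Ex P (ind (no_return_by Y a k))) @ \oo --> never_returns P Y a &
      forall k, never_returns P Y a <= Ex P (ind (no_return_by Y a k))].
Proof.
move=> mY; have mk k : measurable (no_return_by Y a k).
  rewrite (_ : no_return_by Y a k =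
    \bigcap_i (if (0 < i <= k)%N then Y i @^-1` [set x | x <> a] else setT)).
    by apply: bigcapT_measurable => i; case: ifP => // _; exact: dmeas_set.
  apply/seteqP; split => w /= h i; first by case: ifP => // ik _; exact: h.
  by move=> ik; have := h i Logic.I; rewrite ik.
have capE : [set w | return_time (R := R) Y a w = +oo%E] = \bigcap_k no_return_by Y a k.
  apply/seteqP; split => w /=.
    by move=> /return_timeP h k _ i /andP[i0 _]; exact: h.
  by move=> h; apply/return_timeP => n n0; apply: (h n Logic.I); rewrite n0 leqnn.
have mcap : measurable (\bigcap_k no_return_by Y a k) by exact: bigcapT_measurable.
have qE : (never_returns P Y a)%:E = P (\bigcap_k no_return_by Y a k).
  by rewrite /never_returns capE fineK// fin_num_measure.
split => //.
  have c : P \o no_return_by Y a @ \oo --> P (\bigcap_k no_return_by Y a k).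
    apply: nonincreasing_cvg_mu => //.
      by rewrite (@le_lt_trans _ _ 1%E) ?probability_le1// ltry.
    move=> m n mn; apply/subsetPset => w h i /andP[i0 im].
    by apply: h; rewrite i0 (leq_trans im).
  rewrite -qE in c; have /fine_cvgP[_] := c.
  by rewrite (_ : fine \o _ = (fun k => Ex P (ind (no_return_by Y a k))))//;
    apply/funext => k /=; rewrite Ex_ind.
move=> k; rewrite -lee_fin qE -Ex_ind//; apply: le_measure; rewrite ?inE//.
by move=> w h; exact: h.
Qed.

End return_times.

(** * The walk driven by independent steps *)

Section iid_walk.
Context {R : realType} {X : countType}.
Variables (o : X) (mu : probability (borel_sym X) R).
Context {d : measure_display} {W : measurableType d}.
Variables (P : probability W R) (s : nat -> {RV P >-> borel_sym X}).
Hypothesis iid : iid_law mu s.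

(** A product event of the past, carried through the inductions in place of conditioning on the
    first [j] steps. *)
Definition first_steps (j : nat) (A : nat -> set (borel_sym X)) : set W :=
  [set w | forall i, (i < j)%N -> A i (s i w)].

Lemma first_stepsE j A : (forall i, measurable (A i)) ->
  measurable (first_steps j A) /\
  P (first_steps j A) = (\prod_(0 <= i < j) fine (mu (A i)))%:E.
Proof.
move=> mA; pose I := [fset i in iota 0 j]%fset.
have IE i : (i \in I) = (i < j)%N by rewrite !inE/= mem_iota.
have AE : first_steps j A = \bigcap_(i in [set` I]) s i @^-1` A i.
  by apply/seteqP; split => w /= h i; [rewrite /= IE => /h|move=> ij; apply: h; rewrite /= IE].
have mB i : measurable (s i @^-1` A i).
  by rewrite -[X in measurable X]setTI; exact: measurable_funP.
split.
  rewrite (_ : first_steps j A = \bigcap_i (if (i < j)%N then s i @^-1` A i else setT)).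
    by apply: bigcapT_measurable => i; case: ifP.
  apply/seteqP; split => w /= h i; first by case: ltnP => // ij _; exact: h.
  by move=> ij; have := h i Logic.I; rewrite ij.
rewrite AE iid.2//.
have pI : perm_eq I (iota 0 j).
  by apply: uniq_perm; rewrite ?fset_uniq ?iota_uniq// => i; rewrite IE mem_iota.
rewrite (perm_big _ pI)/= /index_iota subn0.
elim: (iota 0 j) => [|i r IH]; first by rewrite !big_nil.
by rewrite !big_cons IH iid.1// EFinM fineK// fin_num_measure.
Qed.

Lemma first_stepsS j A : (forall i, measurable (A i)) ->
  Ex P (ind (first_steps j.+1 A)) = Ex P (ind (first_steps j A)) * fine (mu (A j)).
Proof.
move=> mA; apply: EFin_inj; have [m1 e1] := first_stepsE j.+1 mA.
have [m0 e0] := first_stepsE j mA.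
by rewrite EFinM -!Ex_ind// e1 e0 big_nat_recr//= EFinM.
Qed.

Lemma dmeas_step j xs : dmeas (fun w => map (s j w : sym X) xs).
Proof.
move=> ys; rewrite -[X in measurable X]setTI.
have ms : measurable_fun setT (s j) by exact: measurable_funP.
exact: (ms measurableT _ (measurable_cylinder xs ys)).
Qed.

Lemma dmeas_step1 j x : dmeas (fun w => (s j w : sym X) x).
Proof. exact: (dmeas_comp (head x) (dmeas_step j [:: x])). Qed.

(* Starting at time [j]: no particle of [xs] is at [o] during the next [n] steps. *)
Fixpoint avoids (j n : nat) (xs : seq X) (w : W) : bool :=
  (o \notin xs) &&
  if n is m.+1 then avoids j.+1 m (map (s j w : sym X) xs) w else true.

Lemma dmeas_avoids j n xs : dmeas (avoids j n xs).
Proof.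
elim: n j xs => [|n IH] j xs /=; first exact: dmeas_cst.
apply: (dmeas_comp (fun b => (o \notin xs) && b)).
apply: (dmeas_bind (psi := fun ys w => avoids j.+1 n ys w) (dmeas_step j xs)) => ys.
exact: IH.
Qed.

Lemma bdd_bool (b : W -> bool) : dmeas b -> bdd (fun w => (b w)%:R : R).
Proof.
move=> mb; apply: (dmeas_bdd (h := fun c : bool => c%:R) mb).
by exists 1 => c; rewrite normr_nat lern1 leq_b1.
Qed.

(** Markov property at time [j]: fiber over the image of [xs] under the step [s j]. The constraint
    defining a fiber is itself an event of that step, so it joins the past and the assumption at
    time [j.+1] applies. *)
Lemma Ex_avoids_step j n xs A : (forall i, measurable (A i)) ->
  (forall B ys, (forall i, measurable (B i)) ->
    Ex P (fun w => ind (first_steps j.+1 B) w * (avoids j.+1 n ys w)%:R) =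
    Ex P (ind (first_steps j.+1 B)) * avoid o mu n ys) ->
  Ex P (fun w => ind (first_steps j A) w *
                 (avoids j.+1 n (map (s j w : sym X) xs) w)%:R) =
  Ex P (ind (first_steps j A)) * Ex mu (fun t => avoid o mu n (map (t : sym X) xs)).
Proof.
move=> mA IH; rewrite -ExZ; last exact: bdd_avoid.
have [m0 _] := first_stepsE j mA.
apply: (Ex_fiber_eq (dmeas_step j xs) (dmeas_map xs)).
- apply: bddM; [exact: bdd_ind|apply: bdd_bool].
  apply: (dmeas_bind (psi := fun ys w => avoids j.+1 n ys w) (dmeas_step j xs)) => ys.
  exact: dmeas_avoids.
- by apply: bddZ; exact: bdd_avoid.
move=> ys; pose B i := if (i == j)%N then cylinder xs ys : set (borel_sym X) else A i.
have mB i : measurable (B i) by rewrite /B; case: ifP => // _; exact: measurable_cylinder.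
have [m1 _] := first_stepsE j.+1 mB.
transitivity (Ex P (fun w => ind (first_steps j.+1 B) w * (avoids j.+1 n ys w)%:R)).
  congr Ex; apply/funext => w.
  have -> : first_steps j.+1 B =
      first_steps j A `&` [set w | map (s j w : sym X) xs = ys].
    apply/seteqP; split => v /=.
      move=> h; split => [i ij|]; last by have := h j (ltnSn j); rewrite /B eqxx.
      by have := h i (ltnW ij); rewrite /B ltn_eqF.
    move=> [h1 h2] i; rewrite ltnS /B; case: eqP => [->//|/eqP ne ij].
    by apply: h1; rewrite ltn_neqAle ne.
  rewrite indI; have [e|e] := pselect (map (s j w : sym X) xs = ys).
    by rewrite e mulrAC.
  have z : ind [set w | map (s j w : sym X) xs = ys] w = 0 :> R by rewrite indF.
  by rewrite z !(mulr0, mul0r).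
rewrite IH// first_stepsS//.
have -> : Ex P (ind (first_steps j B)) = Ex P (ind (first_steps j A)).
  congr Ex; congr ind; apply/seteqP; split => v h i ij;
    by have := h i ij; rewrite /B ltn_eqF.
rewrite {1}/B eqxx.
transitivity (Ex mu (fun t => Ex P (ind (first_steps j A)) * avoid o mu n ys *
    ind (cylinder xs ys) t)).
  rewrite ExZ; last by apply: bdd_ind; exact: measurable_cylinder.
  rewrite mulrAC; congr (_ * _); apply: EFin_inj.
  rewrite fineK ?fin_num_measure//; last exact: measurable_cylinder.
  by rewrite Ex_ind//; exact: measurable_cylinder.
congr Ex; apply/funext => t.
have [e|e] := pselect (cylinder xs ys t); first by rewrite [map _ _]e.
by rewrite !(indF e) !mulr0.
Qed.

Lemma Ex_avoids j n xs A : (forall i, measurable (A i)) ->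
  Ex P (fun w => ind (first_steps j A) w * (avoids j n xs w)%:R) =
  Ex P (ind (first_steps j A)) * avoid o mu n xs.
Proof.
elim: n j xs A => [|n IH] j xs A mA; have [m0 _] := first_stepsE j mA => /=.
  rewrite andbT mulr1 mulrC -ExZ; last exact: bdd_ind.
  by congr Ex; apply/funext => w; rewrite mulrC.
case: (o \in xs) => /=.
  by rewrite mul0r mulr0 -[RHS](Ex_cst P 0); congr Ex; apply/funext => w; rewrite mulr0.
rewrite mul1r; apply: Ex_avoids_step => // B ys mB; exact: IH.
Qed.

Lemma first_steps0 j : Ex P (ind (first_steps j (fun=> setT))) = 1.
Proof.
rewrite -[RHS](Ex_cst P 1); congr Ex; apply/funext => w.
by rewrite indT.
Qed.

Lemma Ex_avoids0 j n xs : Ex P (fun w => (avoids j n xs w)%:R) = avoid o mu n xs.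
Proof.
have := @Ex_avoids j n xs (fun=> setT) (fun=> measurableT).
rewrite first_steps0 mul1r => <-.
by congr Ex; apply/funext => w; rewrite indT ?mul1r.
Qed.

Fixpoint walk_from (j i : nat) (w : W) (x : X) : X :=
  if i is i'.+1 then (s (j + i') w : sym X) (walk_from j i' w x) else x.

Lemma walk_from0 i w x : walk_from 0 i w x = walk (fun n => s n) i w x.
Proof. by elim: i => //= i ->. Qed.

Lemma walk_fromS j i w x : walk_from j i.+1 w x = walk_from j.+1 i w ((s j w : sym X) x).
Proof.
elim: i => [|i IH] /=; first by rewrite addn0.
by rewrite -addSnnS -IH.
Qed.

Lemma walk_fromD j i w x :
  walk_from j i w (walk (fun n => s n) j w x) = walk (fun n => s n) (j + i) w x.
Proof. by elim: i => [|i IH] /=; rewrite ?addn0// addnS /= IH. Qed.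

Lemma dmeas_walk_from j i x : dmeas (fun w => walk_from j i w x).
Proof.
elim: i => [|i IH] /=; first exact: dmeas_cst.
apply: (dmeas_bind (psi := fun y w => (s (j + i) w : sym X) y) IH) => y.
exact: dmeas_step1.
Qed.

Lemma avoidsP j n xs w :
  reflect (forall i x, (i <= n)%N -> x \in xs -> walk_from j i w x <> o) (avoids j n xs w).
Proof.
apply/(iffP idP); elim: n j xs => [|n IH] j xs /=.
- by rewrite andbT => oxs [|//] x _ xxs /= xo; case/negP: oxs; rewrite -xo.
- move=> /andP[oxs h] [|i] x; first by move=> _ xxs /= xo; case/negP: oxs; rewrite -xo.
  by rewrite ltnS walk_fromS => ni xxs; apply: (IH _ _ h) => //; exact: map_f.
- by move=> h; rewrite andbT; apply/negP => oxs; exact: (h 0%N o).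
- move=> h; apply/andP; split; first by apply/negP => oxs; exact: (h 0%N o).
  by apply: IH => i _ ni /mapP[x xxs ->]; rewrite -walk_fromS; exact: h.
Qed.

(** The walk restarted at time [j] has a law that does not depend on [j], so the expected number of
    last occurrences is expressed by the walk from the origin alone. *)
Lemma Ex_no_return_from j k :
  measurable (no_return_by (fun i w => walk_from j i w o) o k) /\
  Ex P (ind (no_return_by (fun i w => walk_from j i w o) o k)) = no_return o mu k.
Proof.
case: k => [|m].
  rewrite (_ : no_return_by _ _ _ = setT).
    split => //=; rewrite -[RHS](Ex_cst P 1); congr Ex.
    by apply/funext => w; rewrite indT.
  by apply/seteqP; split => // w _ [|i].
have mav : dmeas (fun w => avoids j.+1 m [:: (s j w : sym X) o] w).
  apply: (dmeas_bind (psi := fun ys w => avoids j.+1 m ys w) (dmeas_step j [:: o])) => ys.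
  exact: dmeas_avoids.
have E : no_return_by (fun i w => walk_from j i w o) o m.+1 =
    [set w | avoids j.+1 m [:: (s j w : sym X) o] w = true].
  apply/seteqP; split => w /= h.
    by apply/avoidsP => i x im; rewrite inE => /eqP ->; rewrite -walk_fromS; exact: h.
  case=> // i /andP[_ im]; rewrite walk_fromS; move/avoidsP: h; apply => //.
  exact: mem_head.
rewrite E; split; first exact: mav.
have := @Ex_avoids_step j m [:: o] (fun=> setT) (fun=> measurableT) (fun B ys mB => @Ex_avoids j.+1 m ys B mB).
rewrite first_steps0 mul1r /= => <-; congr Ex; apply/funext => w.
rewrite [ind (first_steps _ _) _]indT ?mul1r// /ind; congr ((nat_of_bool _)%:R).
by apply/asboolP/idP.
Qed.

End iid_walk.

(** * Bounds on the inverted orbit *)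

Section orbit_card.
Context {R : realType} {X : countType}.
Variables (o : X) (mu : probability (borel_sym X) R).
Context {d : measure_display} {W : measurableType d}.
Variables (P : probability W R) (s : nat -> {RV P >-> borel_sym X}).
Hypothesis iid : iid_law mu s.
Local Notation walk := (walk (fun n => s n)).
Local Notation card := (inverted_orbit_card (fun n => s n) o).

Definition preorigin (w : W) (j : nat) : X := sym_inv (walk j w) o.

Definition orbit_seq (n : nat) (w : W) : seq X := map (preorigin w) (iota 0 n.+1).

Lemma preoriginP w j x : preorigin w j = x <-> walk j w x = o.
Proof.
rewrite /preorigin /=; split => <-; first by rewrite (sym_inv_funK (walk j w)).
by rewrite (sym_funK (walk j w)).
Qed.

Lemma cardE n w : card n w = size (undup (orbit_seq n w)).
Proof.
rewrite /inverted_orbit_card.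
have -> : inverted_orbit (fun n => s n) o n w = [set` orbit_seq n w].
  apply/seteqP; split => x /=.
    move=> [j jn h]; apply/mapP; exists j; first by rewrite mem_iota add0n ltnS.
    exact/esym/preoriginP.
  move=> /mapP[j]; rewrite mem_iota add0n ltnS => /andP[_ jn] e; exists j => //.
  by apply/preoriginP.
apply/perm_size/uniq_perm; rewrite ?fset_uniq ?undup_uniq// => x.
rewrite mem_undup; have /= -> := in_fset_set (finite_seq (orbit_seq n w)).
by apply/idP/idP; rewrite inE.
Qed.

(* Counting each point of the orbit at its last occurrence. *)
Lemma card_sum n w : card n w =
  (\sum_(j < n.+1) `[< no_return_by (fun i w => walk_from s j i w o) o (n - j) w >])%N.
Proof.
rewrite cardE /orbit_seq -(big_mkord xpredT (fun j =>
  nat_of_bool `[< no_return_by (fun i w => walk_from s j i w o) o (n - j) w >])).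
have gen m a : (a + m)%N = n.+1 ->
  size (undup (map (preorigin w) (iota a m))) = (\sum_(j <- iota a m)
   nat_of_bool `[< no_return_by (fun i w => walk_from s j i w o) o (n - j) w >])%N.
  elim: m a => [|m IH] a am /=; first by rewrite big_nil.
  rewrite big_cons -IH ?addSnnS//.
  (* [undup] keeps last occurrences: the index [a] counts exactly when no later index up to [n] has
     the same preimage of the origin, that is, when the walk restarted from [o] at time [a] does not
     return by time [n]. *)
  set b := asbool _; suff -> : preorigin w a \in map (preorigin w) (iota a.+1 m) = ~~ b.
    by case: b.
  apply/idP/idP.
    move=> /mapP[i]; rewrite mem_iota => /andP[ai im] e.
    apply/asboolP => h; apply: (h (i - a)%N).
      by rewrite subn_gt0 ai leq_sub2r//; lia.
    have e0 : walk a w (preorigin w a) = o by apply/preoriginP.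
    have := walk_fromD s a (i - a) w (preorigin w a).
    by rewrite e0 subnKC ?(ltnW ai)// => ->; apply/preoriginP.
  move=> /asboolPn h; apply: contrapT => /negP ne; apply: h => i /andP[i0 ina] wi.
  move/mapP: ne; apply; exists (a + i)%N; first by rewrite mem_iota; lia.
  have e0 : walk a w (preorigin w a) = o by apply/preoriginP.
  by apply/esym/preoriginP; rewrite -walk_fromD e0.
by rewrite gen// /index_iota subn0.
Qed.

Lemma card_le n w : (card n w <= n.+1)%N.
Proof. by rewrite cardE (leq_trans (size_undup _))// size_map size_iota. Qed.

Lemma dmeas_preorigin j : dmeas (fun w => preorigin w j).
Proof.
move=> x; rewrite (_ : mkset _ = [set w | walk_from s 0 j w x = o]).
  exact: dmeas_walk_from.
by apply/seteqP; split => w /=; rewrite walk_from0 => /preoriginP.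
Qed.

Lemma dmeas_orbit_seq n : dmeas (orbit_seq n).
Proof.
rewrite /orbit_seq; elim: (iota 0 n.+1) => [|j js IH] /=; first exact: dmeas_cst.
exact: (dmeas_comp (fun p => p.1 :: p.2) (dmeas_pair (dmeas_preorigin j) IH)).
Qed.

Lemma dmeas_card n : dmeas (card n).
Proof.
have -> : card n = (fun xs => size (undup xs)) \o orbit_seq n.
  by apply/funext => w; rewrite cardE.
exact: dmeas_comp (dmeas_orbit_seq n).
Qed.

Lemma bdd_card n : bdd (fun w => (card n w)%:R : R).
Proof.
split; last by exists n.+1%:R => w; rewrite normr_nat ler_nat card_le.
move=> _ A mA; rewrite setTI.
exact: (dmeas_set [set k | A k%:R] (dmeas_card n)).
Qed.

Lemma Ex_card n : Ex P (fun w => (card n w)%:R) = \sum_(j < n.+1) no_return o mu j.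
Proof.
transitivity (\sum_(j < n.+1) Ex P
    (ind (no_return_by (fun i w => walk_from s j i w o) o (n - j)))).
  rewrite -Ex_sum; last first.
    by move=> j; apply: bdd_ind; have [] := Ex_no_return_from o iid j (n - j).
  by congr Ex; apply/funext => w; rewrite card_sum natr_sum.
rewrite (reindex_inj rev_ord_inj)/=; apply: eq_bigr => j _.
by have [_ ->] := Ex_no_return_from o iid (n - j) (n - (n - j)); rewrite subKn// -ltnS.
Qed.

Definition half_pow n w : R := 2^-1 ^+ card n w.

Lemma half01 : 0 <= 2^-1 :> R /\ 2^-1 <= 1 :> R.
Proof. by split; lra. Qed.

Lemma bdd_half_pow n : bdd (half_pow n).
Proof.
split; last first.
  exists 1 => w; have [h0 h1] := half01.
  by rewrite ger0_norm ?exprn_ge0// exprn_ile1.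
move=> _ A mA; rewrite setTI.
exact: (dmeas_set [set k | A (2^-1 ^+ k)] (dmeas_card n)).
Qed.

Lemma half_pow_meanE n : half_pow_mean P card n = (Ex P (half_pow n))%:E.
Proof. by rewrite /half_pow_mean unlock ExE//; exact: bdd_half_pow. Qed.

Let q := never_returns P (fun n w => walk n w o) o.

Lemma no_return_cvg :
  no_return o mu @ \oo --> q /\ forall k, q <= no_return o mu k.
Proof.
have [|_ c le] := @no_return_by_cvg _ _ _ P _ (fun n w => walk_from s 0 n w o) o.
  by move=> n; exact: dmeas_walk_from.
have e k : Ex P (ind (no_return_by (fun n w => walk_from s 0 n w o) o k)) = no_return o mu k.
  by have [] := Ex_no_return_from o iid 0 k.
have qE : never_returns P (fun n w => walk_from s 0 n w o) o = q.
  by congr never_returns; apply/funext => n; apply/funext => w; rewrite walk_from0.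
rewrite qE in c le; split => [|k]; last by rewrite -e.
by rewrite (_ : no_return o mu = (fun k => Ex P
  (ind (no_return_by (fun n w => walk_from s 0 n w o) o k))))//; apply/funext => k; rewrite e.
Qed.

Lemma no_return01 k : 0 <= no_return o mu k <= 1.
Proof.
case: k => [|k] /=; first by rewrite ler01 lexx.
have b := bdd_avoid o mu k [:: o].
rewrite Ex_ge0 ?Ex_le1// => t; by have /andP[] := avoid01 o mu k [:: (t : sym X) o].
Qed.

(* Jensen's inequality for [2 ^- |O_n|], through the tangent line of [exp] at the mean. *)
Lemma half_pow_lower n :
  expR (- (ln 2 * \sum_(j < n.+1) no_return o mu j)) <= Ex P (half_pow n).
Proof.
set m := \sum_(j < _) _.
pose F w : R := expR (- (ln 2 * m)) * (1 + ln 2 * m) +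
  (- (expR (- (ln 2 * m)) * ln 2)) * (card n w)%:R.
have bc := bdd_card n.
have EF : Ex P F = expR (- (ln 2 * m)).
  rewrite ExD; [|exact: bdd_cst|exact: bddZ].
  by rewrite Ex_cst ExZ// Ex_card -/m; ring.
rewrite -EF; apply: Ex_le; [by apply: bddD; [exact: bdd_cst|exact: bddZ]|exact: bdd_half_pow|].
move=> w; rewrite /F /half_pow.
have -> : 2^-1 ^+ card n w = expR (- (ln 2 * m)) * expR (ln 2 * m - ln 2 * (card n w)%:R).
  rewrite -expRD addKr -mulNr mulrC expRM_natl expRN lnK// posrE; lra.
apply: le_trans (ler_wpM2l (expR_ge0 _) (expR_ge1Dx _)).
by rewrite le_eqVlt; apply/orP; left; apply/eqP; ring.
Qed.

(** A finite exhaustion of [X], which replaces the infinite product and sum over all starting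
    points. *)
Definition pickle_below (m : nat) : seq X := pmap (@pickle_inv X) (iota 0 m).

Lemma pickle_below_uniq m : uniq (pickle_below m).
Proof. exact: (pmap_uniq (@pickle_invK X)) (iota_uniq _ _). Qed.

Lemma mem_pickle_below m x : (x \in pickle_below m) = (pickle x < m)%N.
Proof.
rewrite mem_pmap; apply/mapP/idP => [[i]|xm].
  rewrite mem_iota add0n => /andP[_ im] e; have := @pickle_invK X i.
  by rewrite -e /= => ->.
by exists (pickle x); [rewrite mem_iota|rewrite pickleK_inv].
Qed.

Lemma avoids_mem n w x : avoids o s 0 n [:: x] w = (x \notin orbit_seq n w).
Proof.
apply/avoidsP/idP.
  move=> h; apply/mapP => -[j]; rewrite mem_iota add0n ltnS => /andP[_ jn] e.
  by apply: (h j x jn (mem_head _ _)); rewrite walk_from0; apply/preoriginP.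
move=> xO i y ni; rewrite inE => /eqP ->; rewrite walk_from0 => /preoriginP e.
by move/mapP: xO; apply; exists i => //; rewrite mem_iota add0n ltnS.
Qed.

Lemma avoids_cons j n x xs w :
  avoids o s j n (x :: xs) w = avoids o s j n [:: x] w && avoids o s j n xs w.
Proof.
apply/avoidsP/andP.
  move=> h; split; apply/avoidsP => i y ni yxs; apply: h => //.
    by move: yxs; rewrite !inE => ->.
  by rewrite inE yxs orbT.
move=> [/avoidsP h1 /avoidsP h2] i y ni; rewrite inE => /orP[/eqP ->|].
  by apply: h1 => //; exact: mem_head.
exact: h2.
Qed.

Lemma bdd_avoids j n xs : bdd (fun w => (avoids o s j n xs w)%:R : R).
Proof. by apply: bdd_bool; exact: dmeas_avoids. Qed.

(* Expanding the product over [xs] amounts to keeping each particle with probability 1/2. *)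
Lemma Ex_avoids_half_le n ys xs : negatively_dependent mu -> uniq (ys ++ xs) ->
  Ex P (fun w => (avoids o s 0 n ys w)%:R *
    \prod_(x <- xs) ((1 + (avoids o s 0 n [:: x] w)%:R) / 2)) <=
  \prod_(y <- ys) avoid o mu n [:: y] * \prod_(x <- xs) ((1 + avoid o mu n [:: x]) / 2).
Proof.
move=> nd; have bp xs' : bdd (fun w => \prod_(x <- xs')
    ((1 + (avoids o s 0 n [:: x] w)%:R) / 2) : R).
  apply: bdd_prod => x; apply: bddM; last exact: bdd_cst.
  by apply: bddD; [exact: bdd_cst|exact: bdd_avoids].
elim: xs ys => [|x xs IH] ys uxs.
  rewrite big_nil mulr1 (_ : (fun w => _) = (fun w => (avoids o s 0 n ys w)%:R)); last first.
    by apply/funext => w; rewrite big_nil mulr1.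
  rewrite (Ex_avoids0 o iid); apply: avoid_prod => //.
  by rewrite cats0 in uxs.
have split2 : (fun w => (avoids o s 0 n ys w)%:R *
      \prod_(x <- x :: xs) ((1 + (avoids o s 0 n [:: x] w)%:R) / 2) : R) =
    (fun w => 2^-1 * ((avoids o s 0 n ys w)%:R *
      \prod_(x <- xs) ((1 + (avoids o s 0 n [:: x] w)%:R) / 2)) +
     2^-1 * ((avoids o s 0 n (x :: ys) w)%:R *
      \prod_(x <- xs) ((1 + (avoids o s 0 n [:: x] w)%:R) / 2))).
  apply/funext => w; rewrite big_cons (avoids_cons 0 n x ys).
  by do 2 case: (avoids _ _ _ _ _ _) => //=; field.
have bA zs : bdd (fun w => (avoids o s 0 n zs w)%:R *
      \prod_(x <- xs) ((1 + (avoids o s 0 n [:: x] w)%:R) / 2) : R).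
  by apply: bddM => //; exact: bdd_avoids.
rewrite split2 ExD ?ExZ//; try exact: bddZ.
have u1 : uniq (ys ++ xs).
  by move: uxs; rewrite !cat_uniq /= => /and3P[-> /norP[_ ->] /andP[_ ->]].
have u2 : uniq ((x :: ys) ++ xs).
  by rewrite -(perm_uniq (s1 := ys ++ x :: xs))// -cat1s perm_catCA.
have := IH _ u1; have := IH _ u2; rewrite !big_cons.
set A := Ex P _; set B := Ex P _; set Y := \prod_(y <- ys) _; set Z := \prod_(y <- xs) _.
set a := avoid _ _ _ _ => h1 h2.
rewrite [leRHS](_ : _ = 2^-1 * (Y * Z) + 2^-1 * (a * Y * Z)); last by field.
by rewrite lerD// ler_wpM2l// invr_ge0.
Qed.

(** The product is 1/2 to the number of orbit points in [xs]; ignoring the other orbit points can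
    only increase it. *)
Lemma half_pow_le_prod n xs w : uniq xs ->
  half_pow n w <= \prod_(x <- xs) ((1 + (avoids o s 0 n [:: x] w)%:R) / 2).
Proof.
move=> uxs; have -> : \prod_(x <- xs) ((1 + (avoids o s 0 n [:: x] w)%:R) / 2) =
    2^-1 ^+ count (mem (orbit_seq n w)) xs :> R.
  elim: xs {uxs} => [|x xs IH]; first by rewrite big_nil.
  rewrite big_cons IH avoids_mem /=; case: (x \in _) => /=.
    by rewrite addr0 mul1r exprS.
  by rewrite add0n -[1 + 1%:R]/2 divff ?mul1r.
have [h0 h1] := half01; apply: ler_wiXn2l => //.
rewrite cardE -size_filter; apply: uniq_leq_size; first exact: filter_uniq.
by move=> x; rewrite mem_filter mem_undup => /andP[].
Qed.

Lemma half_pow_upper_seq n xs : negatively_dependent mu -> uniq xs ->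
  Ex P (half_pow n) <=
  expR (- 2^-1 * \sum_(x <- xs) (1 - avoid o mu n [:: x])).
Proof.
move=> nd uxs; apply: (@le_trans _ _ (Ex P (fun w => (avoids o s 0 n [::] w)%:R *
    \prod_(x <- xs) ((1 + (avoids o s 0 n [:: x] w)%:R) / 2)))).
  apply: Ex_le; first exact: bdd_half_pow.
    apply: bddM; first exact: bdd_avoids.
    apply: bdd_prod => x; apply: bddM; last exact: bdd_cst.
    by apply: bddD; [exact: bdd_cst|exact: bdd_avoids].
  move=> w; have -> : avoids o s 0 n [::] w by apply/avoidsP.
  by rewrite mul1r; exact: half_pow_le_prod.
apply: le_trans (Ex_avoids_half_le (ys := [::]) n nd uxs) _.
rewrite big_nil mul1r mulr_sumr expR_sum.
elim: xs {uxs} => [|x xs IH]; first by rewrite !big_nil.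
have /andP[a0 a1] := avoid01 o mu n [:: x].
rewrite !big_cons ler_pM//.
- by rewrite divr_ge0// addr_ge0.
- apply: prodr_ge0 => y _; have /andP[b0 _] := avoid01 o mu n [:: y].
  by rewrite divr_ge0// addr_ge0.
(* Here [(1 + a) / 2 = 1 - (1 - a) / 2], which is at most [expR (- ((1 - a) / 2))]. *)
by apply: le_trans (expR_ge1Dx _); lra.
Qed.

(** [1 - avoid o mu n [:: x]] is the probability that [x] lies in the orbit, so the sums increase to
    the mean orbit size: the counts are at most [n.+1] and reach the full orbit after finitely many
    points. *)
Lemma sum_avoid_cvg n :
  \sum_(x <- pickle_below m) (1 - avoid o mu n [:: x]) @[m --> \oo] -->
  \sum_(j < n.+1) no_return o mu j.
Proof.
rewrite -Ex_card.
have -> : (fun m => \sum_(x <- pickle_below m) (1 - avoid o mu n [:: x])) =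
    (fun m => Ex P (fun w => (count (mem (orbit_seq n w)) (pickle_below m))%:R)).
  apply/funext => m.
  rewrite (_ : (fun w => _) = (fun w => \sum_(x <- pickle_below m)
     (1 + (-1) * (avoids o s 0 n [:: x] w)%:R))); last first.
    apply/funext => w; rewrite -sum1_count natr_sum big_mkcond/=.
    apply: eq_bigr => x _; rewrite avoids_mem.
    by case: (x \in _) => /=; rewrite ?mulr0 ?addr0// mulN1r subrr.
  rewrite Ex_sum => [|x].
    apply: eq_bigr => x _; rewrite ExD; [|exact: bdd_cst|by apply: bddZ; exact: bdd_avoids].
    by rewrite Ex_cst ExZ ?(Ex_avoids0 o iid) ?mulN1r//; exact: bdd_avoids.
  by apply: bddD; [exact: bdd_cst|by apply: bddZ; exact: bdd_avoids].
have cle m w : (count (mem (orbit_seq n w)) (pickle_below m) <= n.+1)%N.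
  rewrite (leq_trans _ (card_le n w))// cardE -size_filter.
  apply: uniq_leq_size; first by rewrite filter_uniq ?pickle_below_uniq.
  by move=> x; rewrite mem_filter mem_undup => /andP[].
apply: (@Ex_cvg _ _ _ _ _ _ n.+1%:R).
- move=> m; have [//] : bdd (fun w => (count (mem (orbit_seq n w)) (pickle_below m))%:R : R).
  apply: (dmeas_bdd (h := fun ys : seq X => (count (mem ys) (pickle_below m))%:R)
    (dmeas_orbit_seq n)).
  by exists (size (pickle_below m))%:R => ys; rewrite normr_nat ler_nat count_size.
- exact: bdd_card.
- by move=> m w; rewrite normr_nat ler_nat.
apply: aeW => w; apply: cvg_near_cst.
near=> m; rewrite cardE -size_filter; congr (_%:R); apply: perm_size.
apply: uniq_perm; rewrite ?filter_uniq ?pickle_below_uniq ?undup_uniq// => x.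
rewrite mem_filter mem_undup mem_pickle_below /=; apply: andb_idr => xO.
apply: (@leq_trans (\max_(y <- orbit_seq n w) pickle y).+1).
  by rewrite ltnS; apply: (leq_bigmax_seq (F := pickle)).
by near: m; exact: nbhs_infty_ge.
Unshelve. all: by end_near. Qed.

Lemma half_pow_upper n : negatively_dependent mu ->
  Ex P (half_pow n) <= expR (- ((n%:R + 1) / 2 * q)).
Proof.
move=> nd; apply: (@le_trans _ _ (expR (- 2^-1 * \sum_(j < n.+1) no_return o mu j))).
  have c : expR (- 2^-1 * \sum_(x <- pickle_below m) (1 - avoid o mu n [:: x])) @[m --> \oo]
      --> expR (- 2^-1 * \sum_(j < n.+1) no_return o mu j).
    apply: continuous_cvg; first exact: continuous_expR.
    by apply: cvgMr; exact: sum_avoid_cvg.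
  apply: (@ler_cvg_to _ _ _ _ (fun=> Ex P (half_pow n)) _ _ _ (cvg_cst _) c).
  by near=> m; apply: half_pow_upper_seq => //; exact: pickle_below_uniq.
rewrite ler_expR; have : \sum_(j < n.+1) q <= \sum_(j < n.+1) no_return o mu j.
  by apply: ler_sum => j _; exact: no_return_cvg.2.
rewrite sumr_const card_ord -[q *+ _]mulr_natr -natr1; lra.
Unshelve. all: by end_near. Qed.

Lemma orbit_bounds : negatively_dependent mu ->
  (exists2 u : nat -> R, (fun n => u n / n%:R) @ \oo --> (0 : R) &
     forall n : nat,
       ((expR (- (n%:R * ln 2 * q) + u n))%:E <= half_pow_mean P card n)%E) /\
  (forall n : nat,
     (half_pow_mean P card n <= (expR (- ((n%:R + 1) / 2 * q)))%:E)%E).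
Proof.
move=> nd; split; last first.
  by move=> n; rewrite half_pow_meanE lee_fin; exact: half_pow_upper.
(* The error is what separates the exact Jensen exponent from its linear part; it is sublinear by
   Cesaro's lemma, as [no_return] tends to [q]. *)
exists (fun n => - ln 2 * (\sum_(j < n.+1) no_return o mu j - n%:R * q)); last first.
  move=> n; rewrite half_pow_meanE lee_fin; apply: le_trans (half_pow_lower n).
  by rewrite ler_expR le_eqVlt; apply/orP; left; apply/eqP; ring.
have [c _] := no_return_cvg.
(* The sum has one term more than its divisor. After the shift it is an arithmetic mean plus a
   boundary term of order [1 / n.+1]. *)
rewrite -cvg_shiftS.
rewrite (_ : [sequence _]_n =
  (fun n => - ln 2 * (arithmetic_mean (no_return o mu) n - q +
     no_return o mu n.+1 * n.+1%:R^-1))); last first.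
  apply/funext => n; rewrite /= /arithmetic_mean /series /=.
  rewrite big_ord_recr/= big_mkord; field.
  by rewrite ?nat1r ?natr1 pnatr_eq0.
have z : - ln 2 * (q - q + 0) = 0 :> R by ring.
suff : (fun n => - ln 2 * (arithmetic_mean (no_return o mu) n - q +
  no_return o mu n.+1 * n.+1%:R^-1)) @ \oo --> - ln 2 * (q - q + 0) by rewrite z.
apply: cvgMr; apply: cvgD.
  by apply: cvgB; [exact: cesaro|exact: cvg_cst].
apply: (@squeeze_cvgr _ _ _ _ (fun=> 0) (fun n => n.+1%:R^-1)).
- near=> n; have /andP[n0 n1] := no_return01 n.+1.
  by rewrite mulr_ge0//= ler_piMl.
- exact: cvg_cst.
- exact: cvg_harmonic.
Unshelve. all: by end_near. Qed.

End orbit_card.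

(** * A transience criterion *)

Section markov_chain.
Context {R : realType} {X : countType}.
Variables (mu : probability (borel_sym X) R) (p : X -> X -> R).
Hypothesis pE : forall x y, p x y = Ex mu (ind [set t : sym X | t x = y]).
Context {d : measure_display} {W : measurableType d}.
Variables (P : probability W R) (a : X) (Y : nat -> W -> X).
Hypothesis mc : markov_chain P p a Y.

Lemma markov_dmeas n : dmeas (Y n).
Proof. by case: mc => mY _ _ x; exact: mY. Qed.

Definition trajectory (n : nat) (w : W) : seq X := map (Y ^~ w) (iota 0 n.+1).

Lemma dmeas_trajectory n : dmeas (trajectory n).
Proof.
rewrite /trajectory; elim: (iota 0 n.+1) => [|j js IH] /=; first exact: dmeas_cst.
exact: (dmeas_comp (fun q => q.1 :: q.2) (dmeas_pair (markov_dmeas j) IH)).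
Qed.

Definition follows (n : nat) (u : nat -> X) : set W :=
  [set w | forall i, (i <= n)%N -> Y i w = u i].

Lemma followsE n u : follows n u = [set w | trajectory n w = map u (iota 0 n.+1)].
Proof.
apply/seteqP; split => w /=.
  by move=> h; apply/eq_in_map => i; rewrite mem_iota add0n ltnS => /andP[_ /h].
by move=> /eq_in_map h i ni; apply: h; rewrite mem_iota add0n ltnS.
Qed.

Lemma measurable_follows n u : measurable (follows n u).
Proof. by rewrite followsE; exact: dmeas_trajectory. Qed.

Lemma Ex_followsS n u :
  Ex P (ind (follows n.+1 u)) = Ex P (ind (follows n u)) * p (u n) (u n.+1).
Proof.
case: mc => _ _ /(_ n u) e; apply: EFin_inj.
by rewrite EFinM -!Ex_ind; [exact: e|exact: measurable_follows|exact: measurable_follows].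
Qed.

Definition set_at (u : nat -> X) (n : nat) (y : X) (i : nat) : X :=
  if i == n then y else u i.

Lemma follows_set_at n u y :
  follows n.+1 (set_at u n.+1 y) = follows n u `&` [set w | Y n.+1 w = y].
Proof.
apply/seteqP; split => w /=.
  move=> h; split => [i ni|]; last by have := h n.+1 (leqnn _); rewrite /set_at eqxx.
  by have := h i (leqW ni); rewrite /set_at ltn_eqF.
move=> [h1 h2] i; rewrite leq_eqVlt /set_at => /predU1P[->|ni]; first by rewrite eqxx.
by rewrite ltn_eqF//; exact: h1.
Qed.

Lemma Ex_follows_set_at n u y : Ex P (ind (follows n.+1 (set_at u n.+1 y))) =
  Ex P (ind (follows n u)) * p (u n) y.
Proof.
rewrite Ex_followsS /set_at eqxx ltn_eqF//; congr (_ * _); congr Ex; congr ind.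
by apply/seteqP; split => w h i ni; have := h i ni; rewrite /set_at ltn_eqF.
Qed.

(* The probability that the walk from [x] avoids [a] at the times [1, ..., k]. *)
Definition no_hit (k : nat) (x : X) : R :=
  if k is m.+1 then Ex mu (fun t => avoid a mu m [:: (t : sym X) x]) else 1.

Lemma avoid1 n y : avoid a mu n [:: y] = (y != a)%:R * no_hit n y.
Proof. by case: n => [|n] /=; rewrite inE eq_sym. Qed.

Definition misses (n k : nat) : set W := [set w | forall i, (n < i <= n + k)%N -> Y i w <> a].

Lemma measurable_misses n k : measurable (misses n k).
Proof.
rewrite (_ : misses n k =
  \bigcap_i (if (n < i <= n + k)%N then Y i @^-1` [set x | x <> a] else setT)).
  by apply: bigcapT_measurable => i; case: ifP => // _; exact: dmeas_set (markov_dmeas i).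
apply/seteqP; split => w /= h i; first by case: ifP => // ik _; exact: h.
by move=> ik; have := h i Logic.I; rewrite ik.
Qed.

Lemma missesS n k : misses n k.+1 = [set w | Y n.+1 w <> a] `&` misses n.+1 k.
Proof.
apply/seteqP; split => w /=.
  move=> h; split; first by apply: h; rewrite ltnSn addnS ltnS leq_addr.
  by move=> i /andP[ni ik]; apply: h; rewrite (ltnW ni) -addSnnS.
move=> [h1 h2] i /andP[]; rewrite leq_eqVlt => /predU1P[<-//|ni ik].
by apply: h2; rewrite ni addSnnS.
Qed.

(** Markov property at time [n], from the transition rule for full paths: fibering over the next
    position extends the prescribed path by one value. *)
Lemma Ex_misses n u k :
  Ex P (fun w => ind (follows n u) w * ind (misses n k) w) =
  Ex P (ind (follows n u)) * no_hit k (u n).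
Proof.
elim: k n u => [|k IH] n u.
  rewrite mulr1; congr Ex; apply/funext => w; rewrite [X in _ * X]indT ?mulr1//.
  by move=> i /andP[ni]; rewrite addn0 leqNgt ni.
have mF m v := measurable_follows m v; have mM m j := measurable_misses m j.
rewrite -ExZ; last exact: (bdd_avoid a mu k [:: u n]).
apply: (Ex_fiber_eq (markov_dmeas n.+1) (dmeas_eval (u n))).
- by apply: bddM; exact: bdd_ind.
- by apply: bddZ; exact: (bdd_avoid a mu k [:: u n]).
move=> y; transitivity (Ex P (fun w => (y != a)%:R *
    (ind (follows n.+1 (set_at u n.+1 y)) w * ind (misses n.+1 k) w))).
  congr Ex; apply/funext => w; rewrite follows_set_at indI missesS indI.
  have [e|e] := pselect (Y n.+1 w = y); last first.
    have z : ind [set w | Y n.+1 w = y] w = 0 :> R by rewrite indF.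
    by rewrite z !(mulr0, mul0r).
  rewrite [ind [set w | Y n.+1 w = y] w]indT//.
  have -> : ind [set w | Y n.+1 w <> a] w = (y != a)%:R :> R.
    by rewrite /ind; congr ((nat_of_bool _)%:R); apply/asboolP/idP; rewrite /= e => /eqP.
  by ring.
rewrite ExZ; last by apply: bddM; exact: bdd_ind.
rewrite IH Ex_follows_set_at [set_at _ _ _ _]/set_at eqxx pE.
transitivity (Ex mu (fun t => (Ex P (ind (follows n u)) * avoid a mu k [:: y]) *
    ind [set t : sym X | t (u n) = y] t)).
  rewrite ExZ; last by apply: bdd_ind; exact: measurable_eval.
  by rewrite avoid1; ring.
congr Ex; apply/funext => t.
have [e|e] := pselect ([set t : sym X | t (u n) = y] t); last by rewrite !(indF e) !mulr0.
by have -> : (t : sym X) (u n) = y by exact: e.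
Qed.

Lemma Ex_last_exit n k : Ex P (ind ([set w | Y n w = a] `&` misses n k)) =
  Ex P (ind [set w | Y n w = a]) * no_hit k a.
Proof.
have mA := markov_dmeas n a; have mM := measurable_misses n k.
rewrite mulrC -ExZ; last exact: bdd_ind.
apply: (Ex_fiber_eq (dmeas_trajectory n) (dmeas_trajectory n)).
- by apply: bdd_ind; exact: measurableI.
- by apply: bddZ; exact: bdd_ind.
move=> us; have [sus|sus] := eqVneq (size us) n.+1; last first.
  congr Ex; apply/funext => w; rewrite [ind [set w | trajectory n w = us] w]indF ?mulr0//=.
  by move=> e; case/eqP: sus; rewrite -e size_map size_iota.
have fE : [set w | trajectory n w = us] = follows n (nth a us).
  by rewrite followsE -sus map_nth_iota0// take_size.
rewrite fE; have [e|e] := eqVneq (nth a us n) a.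
  transitivity (Ex P (fun w => ind (follows n (nth a us)) w * ind (misses n k) w)).
    congr Ex; apply/funext => w.
    have [h|h] := pselect (follows n (nth a us) w); last by rewrite !(indF h) mulr0 mul0r.
    by rewrite indI (indT h) mulr1 mul1r [ind [set w | Y n w = a] w]indT ?mul1r//= h.
  rewrite Ex_misses e mulrC -ExZ; last by apply: bdd_ind; exact: measurable_follows.
  congr Ex; apply/funext => w.
  have [h|h] := pselect (follows n (nth a us) w); last by rewrite !(indF h) !mulr0.
  by rewrite (indT h) [ind [set w | Y n w = a] w]indT ?mulr1//= h.
congr Ex; apply/funext => w.
have [h|h] := pselect (follows n (nth a us) w); last by rewrite !(indF h) !mulr0.
rewrite indI [ind [set w | Y n w = a] w]indF ?(mul0r, mulr0)//=.
by rewrite h// => /eqP; rewrite (negbTE e).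
Qed.

(** The chain starts at [a], so almost surely there is a last visit to [a] in [[0, N]]; if it occurs
    at time [j], the chain then misses [a] for [N - j] steps. *)
Lemma last_exit_le N :
  1 <= \sum_(j < N.+1) Ex P (ind [set w | Y j w = a]) * no_hit (N - j) a.
Proof.
case: mc => _ Y0 _.
have e0 : Ex P (ind [set w | Y 0%N w = a]) = 1.
  by apply: EFin_inj; rewrite -Ex_ind//; exact: (markov_dmeas 0 a).
have mA j : measurable ([set w | Y j w = a] `&` misses j (N - j)).
  by apply: measurableI; [exact: markov_dmeas|exact: measurable_misses].
under eq_bigr do rewrite -Ex_last_exit.
rewrite -e0 -Ex_sum; last by move=> j; exact: bdd_ind.
apply: Ex_le.
- by apply: bdd_ind; exact: markov_dmeas.
- by apply: bdd_sum => j; exact: bdd_ind.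
move=> w; have [h|h] := pselect ([set w | Y 0%N w = a] w); last first.
  by rewrite (indF h); apply: sumr_ge0 => j _; exact: ind_ge0.
have ex0 : exists j, (j <= N)%N && (Y j w == a) by exists 0%N; apply/eqP.
have bnd j : (j <= N)%N && (Y j w == a) -> (j <= N)%N by case/andP.
case: (ex_maxnP ex0 bnd) => j /andP[jN /eqP Yj] jmax.
have jN' : (j < N.+1)%N by [].
rewrite (bigD1 (Ordinal jN'))//= (indT h) indT.
  by rewrite lerDl; apply: sumr_ge0 => i _; exact: ind_ge0.
split => //= i /andP[ji iN] Yi.
have : (i <= j)%N by apply: jmax; rewrite Yi eqxx andbT; move: iN; rewrite subnKC.
by rewrite leqNgt ji.
Qed.

(* [G k] bounds the probability of being at [a] after [k] steps. *)
Lemma Ex_return_le (G : nat -> X -> R) :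
  (forall k x, 0 <= G k x <= 1) -> 1 <= G 0%N a ->
  (forall k x, Ex mu (fun t => G k ((t : sym X) x)) <= G k.+1 x) ->
  forall k, Ex P (ind [set w | Y k w = a]) <= G k a.
Proof.
move=> G01 G0 GS.
have bG k x : bdd (fun t : borel_sym X => G k ((t : sym X) x)).
  apply: (dmeas_bdd (h := G k) (dmeas_eval x)); exists 1 => y.
  by have /andP[g0 g1] := G01 k y; rewrite ger0_norm.
have mA j := markov_dmeas j a.
(* The claim is generalised to an arbitrary past [u] up to time [n], so that the induction on the
   remaining time [k] can lengthen the past. *)
have gen k n u : Ex P (fun w => ind (follows n u) w * ind [set w | Y (n + k)%N w = a] w) <=
    Ex P (ind (follows n u)) * G k (u n).
  elim: k n u => [|k IH] n u; have mF := measurable_follows n u.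
    rewrite addn0 mulrC -ExZ; last exact: bdd_ind.
    apply: Ex_le; [by apply: bddM; exact: bdd_ind|by apply: bddZ; exact: bdd_ind|].
    move=> w; have [h|h] := pselect (follows n u w); last by rewrite !(indF h) mulr0 mul0r.
    rewrite (indT h) mul1r mulr1; have [e|e] := pselect (Y n w = a).
      by rewrite indT// -(h n (leqnn n)) e.
    by rewrite indF//; have /andP[] := G01 0%N (u n).
  apply: (@le_trans _ _ (Ex P (ind (follows n u)) * Ex mu (fun t => G k ((t : sym X) (u n))))).
    rewrite -ExZ//; apply: (Ex_fiber_le (markov_dmeas n.+1) (dmeas_eval (u n))).
    - by apply: bddM; exact: bdd_ind.
    - exact: bddZ.
    move=> y; rewrite (_ : (fun w => _) = (fun w =>
        ind (follows n.+1 (set_at u n.+1 y)) w * ind [set w | Y (n.+1 + k)%N w = a] w)).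
      apply: le_trans (IH _ _) _; rewrite Ex_follows_set_at [set_at _ _ _ _]/set_at eqxx pE.
      rewrite (_ : (fun t => _) = (fun t => (Ex P (ind (follows n u)) * G k y) *
         ind [set t : sym X | t (u n) = y] t)).
        rewrite ExZ; last by apply: bdd_ind; exact: measurable_eval.
        by rewrite le_eqVlt; apply/orP; left; apply/eqP; ring.
      apply/funext => t.
      have [e|e] := pselect ([set t : sym X | t (u n) = y] t).
        by have -> : (t : sym X) (u n) = y by exact: e.
      by rewrite !(indF e) !mulr0.
    by apply/funext => w; rewrite follows_set_at indI addSnnS; ring.
  by rewrite ler_wpM2l// Ex_ge0// => w; exact: ind_ge0.
move=> k; have e0 : Ex P (ind (follows 0 (fun=> a))) = 1.
  case: mc => _ Y0 _; apply: EFin_inj; rewrite -Ex_ind; last exact: measurable_follows.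
  rewrite -Y0; congr (P _); apply/seteqP; split => w /=; first exact.
  by move=> h i; rewrite leqn0 => /eqP ->.
rewrite -[leRHS]mul1r -e0; apply: le_trans (gen k 0%N (fun=> a)).
have mF := measurable_follows 0 (fun=> a).
by rewrite add0n -Ex_ind_full.
Qed.

(** In the last-exit inequality at time [N + L] the visits from time [L] on contribute less than 1/2
    for [L] large. The earlier ones then give [2^-1 <= S L * t N] for all [N], and letting [N] grow
    bounds [S L * q] below. *)
Lemma never_returns_gt0 (B : R) :
  (forall N, \sum_(k < N) Ex P (ind [set w | Y k w = a]) <= B) ->
  0 < never_returns P Y a.
Proof.
move=> rB; pose r k := Ex P (ind [set w | Y k w = a]).
have r0 k : 0 <= r k by apply: Ex_ge0 => w; exact: ind_ge0.
have [_ c le] := no_return_by_cvg P a markov_dmeas.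
set q := never_returns _ _ _ in c le *.
have tE k : Ex P (ind (no_return_by Y a k)) = no_hit k a.
  have mF := measurable_follows 0 (fun=> a); have mM := measurable_misses 0 k.
  have e0 : Ex P (ind (follows 0 (fun=> a))) = 1.
    case: mc => _ Y0 _; apply: EFin_inj; rewrite -Ex_ind//.
    rewrite -Y0; congr (P _); apply/seteqP; split => w /=; first exact.
    by move=> h i; rewrite leqn0 => /eqP ->.
  rewrite -[RHS]mul1r -e0 -(Ex_misses 0 (fun=> a)) -Ex_ind_full//.
pose t k := Ex P (ind (no_return_by Y a k)).
have [mt _ _] := no_return_by_cvg P a markov_dmeas.
have t_decr i j : (i <= j)%N -> t j <= t i.
  move=> ij; apply: Ex_ind_le => // w h l /andP[l0 li].
  by apply: h; rewrite l0 (leq_trans li).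
have t01 k : 0 <= t k <= 1.
  rewrite Ex_ge0 => [|w]; last exact: ind_ge0.
  by rewrite Ex_le1//; [exact: bdd_ind|move=> w; exact: ind_le1].
pose S N := \sum_(0 <= k < N) r k.
have S_incr : nondecreasing_seq S.
  by apply/nondecreasing_seqP => n; rewrite /S big_nat_recr//= lerDl.
have S_B : has_ubound (range S).
  by exists B => _ [N _ <-]; rewrite /S big_mkord; exact: rB.
have S_cvg := nondecreasing_is_cvgn S_incr S_B.
have S_le := nondecreasing_cvgn_le S_incr S_cvg.
(* The expected number of visits from time [L] on is below 1/2. *)
have [L SL] : exists L, limn S - 2^-1 < S L.
  apply: contrapT => /forallNP h; have : limn S <= limn S - 2^-1.
    by apply: limr_le => //; apply: nearW => n; rewrite leNgt; apply/negP; exact: h.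
  by move: (limn S) => l; lra.
have half N : 2^-1 <= S L * t N.
  have := last_exit_le (N + L).
  rewrite -(big_mkord xpredT (fun j => Ex P (ind [set w | Y j w = a]) * no_hit (N + L - j) a)).
  rewrite (@big_cat_nat _ _ _ L) ?leqW ?leq_addl//=.
  set s1 := \sum_(0 <= i < L) _; set s2 := \sum_(L <= i < _) _.
  have h1 : s1 <= S L * t N.
    rewrite mulr_suml /s1 big_nat [leRHS]big_nat; apply: ler_sum => j /andP[_ jL].
    rewrite -tE; apply: ler_wpM2l; [exact: r0|apply: t_decr].
    by rewrite -addnBA ?leq_addr// ltnW.
  have h2 : s2 <= limn S - S L.
    apply: (@le_trans _ _ (S (N + L).+1 - S L)); last by rewrite lerB.
    rewrite {1}/S (@big_cat_nat _ _ _ L) ?leqW ?leq_addl//= addrAC subrr add0r.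
    apply: ler_sum => j _; rewrite -tE; apply: ler_piMr; first exact: r0.
    by have /andP[] := t01 (N + L - j)%N.
  by move: h1 h2 SL; clear; lra.
have : 2^-1 <= S L * q.
  have c' : (fun N => S L * t N) @ \oo --> S L * q by apply: cvgMr.
  by apply: (ler_cvg_to (cvg_cst _) c'); near=> N; exact: half.
have S0 : 0 <= S L by apply: sumr_ge0.
move=> h; rewrite ltNge; apply/negP => q0.
by have : S L * q <= 0 by [rewrite mulr_ge0_le0]; move: h; clear; lra.
Unshelve. all: by end_near. Qed.

End markov_chain.

(** * The conductances of a symmetric law *)

Section conductance_kernel.
Context {R : realType} {X : countType}.
Variable mu : probability (borel_sym X) R.
Hypothesis mu_sym : symmetric_law mu.

Definition kernel (x y : X) : R := Ex mu (ind [set t : sym X | t x = y]).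

Lemma kernelE x y : mu [set t : sym X | t x = y] = (kernel x y)%:E.
Proof. by rewrite /kernel -Ex_ind//; exact: measurable_eval. Qed.

Lemma conductanceE x y : conductance mu x y = (2 * kernel x y)%:E.
Proof.
rewrite /conductance (mu_sym (measurable_eval y x)).
rewrite (_ : sym_inv @^-1` _ = [set t : sym X | t x = y]); last first.
  apply/seteqP; split => t /= <-; first exact: (sym_inv_funK t).
  exact: (sym_funK t).
by rewrite kernelE -EFinD mulr_natl mulr2n.
Qed.

Lemma kernel_sum_le x (ys : seq X) : uniq ys -> \sum_(y <- ys) kernel x y <= 1.
Proof.
move=> uys; have bi y : bdd (ind [set t : sym X | t x = y] : borel_sym X -> R).
  by apply: bdd_ind; exact: measurable_eval.
rewrite -Ex_sum//; apply: Ex_le1; first exact: bdd_sum.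
move=> t; have [tx|tx] := boolP ((t : sym X) x \in ys).
  rewrite (bigD1_seq _ tx)//= big1 ?addr0 ?ind_le1// => y ne.
  by rewrite indF//= => e; rewrite e eqxx in ne.
rewrite big_seq big1 ?ler01// => y yys; rewrite indF//= => e.
by rewrite e yys in tx.
Qed.

Lemma kernel_sum_cvg x : \sum_(y <- @pickle_below X m) kernel x y @[m --> \oo] --> (1 : R).
Proof.
have bi y : bdd (ind [set t : sym X | t x = y] : borel_sym X -> R).
  by apply: bdd_ind; exact: measurable_eval.
under eq_fun do rewrite -Ex_sum//.
rewrite -(Ex_cst mu 1).
apply: (@Ex_cvg _ _ _ _ _ _ 1) => [m||m t|].
- by have [] := bdd_sum (@pickle_below X m) bi.
- exact: bdd_cst.
- rewrite ger0_norm; last by apply: sumr_ge0 => y _; exact: ind_ge0.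
  have [tx|tx] := boolP ((t : sym X) x \in @pickle_below X m).
    rewrite (bigD1_seq _ tx) ?pickle_below_uniq//= big1 ?addr0 ?ind_le1// => y ne.
    by rewrite indF//= => e; rewrite e eqxx in ne.
  rewrite big_seq big1 ?ler01// => y yys; rewrite indF//= => e.
  by rewrite e yys in tx.
apply: aeW => t; apply: cvg_near_cst; near=> m.
have tx : (t : sym X) x \in @pickle_below X m.
  by rewrite mem_pickle_below; near: m; exact: nbhs_infty_gt.
rewrite (bigD1_seq _ tx) ?pickle_below_uniq//= big1 ?addr0 ?indT// => y ne.
by rewrite indF//= => e; rewrite e eqxx in ne.
Unshelve. all: by end_near. Qed.

(** Finite sets of targets have kernel mass at most 1, and the masses of a finite exhaustion tend to
    1; symmetry of the law doubles them. *)
Lemma conductance_atE x : conductance_at mu x = 2%:E.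
Proof.
rewrite /conductance_at; set c := esum _ _.
have up : (c <= 2%:E)%E.
  apply: ub_ereal_sup => _ [A [fA _] <-]; rewrite fsbig_finite//=.
  under eq_bigr do rewrite conductanceE.
  rewrite sumEFin lee_fin -mulr_sumr ler_piMr//.
  by apply: kernel_sum_le; exact: fset_uniq.
have lo m : ((2 * \sum_(y <- @pickle_below X m) kernel x y)%:E <= c)%E.
  apply: ereal_sup_ubound; exists [set` (@pickle_below X m)].
    by split => //; exact: finite_seq.
  rewrite -fsbig_seq ?pickle_below_uniq// mulr_sumr -sumEFin.
  by apply: eq_bigr => y _; rewrite conductanceE.
apply/eqP; rewrite eq_le up/=.
have cf : c \is a fin_num.
  rewrite fin_numE; apply/andP; split.
    by apply/eqP => e; have := lo 0%N; rewrite e.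
  by apply/eqP => e; have := up; rewrite e.
rewrite -(fineK cf) lee_fin.
have h : 2 * \sum_(y <- @pickle_below X m) kernel x y @[m --> \oo] --> (2 * 1 : R).
  by apply: cvgMr; exact: kernel_sum_cvg.
rewrite mulr1 in h; apply: (ler_cvg_to h (cvg_cst _)); near=> m.
by rewrite -lee_fin fineK.
Unshelve. all: by end_near. Qed.

Lemma conductance_walkE x y : conductance_walk mu x y = kernel x y.
Proof. by rewrite /conductance_walk conductanceE conductance_atE /= mulrC mulKf. Qed.

Context {d : measure_display} {W : measurableType d}.
Variables (P : probability W R) (s : nat -> {RV P >-> borel_sym X}).
Hypothesis iid : iid_law mu s.

Lemma iid_markov (a : X) :
  markov_chain P (conductance_walk mu) a (fun n w => walk (fun i => s i) n w a).
Proof.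
have wE n w := esym (walk_from0 s n w a).
split.
- move=> n x; under eq_fun do rewrite wE; exact: dmeas_walk_from.
- by rewrite (_ : mkset _ = setT) ?probability_setT//; apply/seteqP.
move=> n u; rewrite conductance_walkE.
pose A i : set (borel_sym X) := [set t | (t : sym X) (u i) = u i.+1].
have mA i : measurable (A i) by exact: measurable_eval.
have E m : u 0%N = a -> [set w | forall i, (i <= m)%N -> walk (fun i => s i) i w a = u i] =
    first_steps s m A.
  move=> u0; apply/seteqP; split => w /= h.
    by move=> i im; rewrite /A /= -(h i (ltnW im)) -(h i.+1 im).
  elim=> [|i IH] im //; rewrite /= IH ?(ltnW im)//; exact: h.
have [u0|u0] := pselect (u 0%N = a).
  rewrite !E// !Ex_ind; [|exact: (first_stepsE iid n mA).1|exact: (first_stepsE iid n.+1 mA).1].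
  by rewrite -EFinM (first_stepsS iid n mA) /A kernelE.
have Z m : [set w | forall i, (i <= m)%N -> walk (fun i => s i) i w a = u i] = set0.
  by rewrite -subset0 => w /(_ 0%N isT)/= /esym.
by rewrite !Z measure0 mul0e.
Qed.

End conductance_kernel.

Section helpers.
Context {R : realType}.

Lemma nneseries_lty (u : nat -> R) (B : R) : (forall k, 0 <= u k) ->
  (forall N, \sum_(0 <= k < N) u k <= B) -> (\sum_(k <oo) (u k)%:E < +oo)%E.
Proof.
move=> u0 uB; apply: (@le_lt_trans _ _ B%:E); last exact: ltry.
apply: lime_le; first by apply: is_cvg_nneseries => k _ _; rewrite lee_fin.
by apply: nearW => N; rewrite sumEFin lee_fin.
Qed.

Lemma geometric_sum_le1 N : \sum_(0 <= k < N) (2^-1 : R) ^+ k.+1 <= 1.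
Proof.
suff -> : \sum_(0 <= k < N) (2^-1 : R) ^+ k.+1 = 1 - 2^-1 ^+ N.
  by rewrite gerBl exprn_ge0// invr_ge0.
elim: N => [|N IH]; first by rewrite big_geq// expr0 subrr.
by rewrite big_nat_recr//= IH exprS; field.
Qed.

End helpers.

(** * The cubic lattice *)

Section central_binomial.
Context {R : realType}.

(** Binomial coefficients extended by 0 to negative lower index, so that Pascal's rule holds on all
    of the integers. *)
Definition bin_int (m : nat) (j : int) : R := if j is Posz i then 'C(m, i)%:R else 0.

Lemma bin_intS m j : bin_int m.+1 j = bin_int m j + bin_int m (j - 1).
Proof.
case: j => [[|i]|i].
- by rewrite /bin_int !bin0 sub0r /= addr0.
- by rewrite (_ : Posz i.+1 - 1 = Posz i) /bin_int ?binS ?natrD//; lia.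
- by rewrite (_ : Negz i - 1 = Negz i.+1) ?NegzE /= ?addr0//; lia.
Qed.

(* The probability that the sum of [2 n] independent fair signs is [2 k]. *)
Definition block_prob (n : nat) (k : int) : R := bin_int (2 * n) (n%:Z + k) / 4 ^+ n.

(** Two applications of Pascal's rule: one step of the lazy walk with weights 1/4, 1/2, 1/4. *)
Lemma block_probS n k : block_prob n.+1 k =
  block_prob n k / 2 + (block_prob n (k - 1) + block_prob n (k + 1)) / 4.
Proof.
rewrite /block_prob mulnS !bin_intS.
have -> : n.+1%:Z + k = n%:Z + (k + 1) by lia.
have -> : n%:Z + (k + 1) - 1 = n%:Z + k by lia.
have -> : n%:Z + k - 1 = n%:Z + (k - 1) by lia.
rewrite exprS; field.
by rewrite expf_neq0// pnatr_eq0.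
Qed.

Lemma bin_int_ge0 m j : 0 <= bin_int m j.
Proof. by case: j => i //=; exact: ler0n. Qed.

Lemma block_prob01 n k : 0 <= block_prob n k <= 1.
Proof.
rewrite divr_ge0 ?bin_int_ge0 ?exprn_ge0//= ler_pdivrMr ?exprn_gt0// mul1r.
case: (n%:Z + k) => i /=; last by rewrite exprn_ge0.
rewrite -natrX ler_nat (_ : 4 = 2 ^ 2)%N// -expnM.
rewrite -[(2 ^ (2 * n))%N]/((1 + 1) ^ (2 * n))%N expnDn.
have [ni|ni] := ltnP (2 * n) i; first by rewrite bin_small.
rewrite (bigD1 (Ordinal (ni : i < (2 * n).+1)%N))//= !exp1n !muln1.
exact: leq_addr.
Qed.

Lemma block_prob0 k : block_prob 0 k = (k == 0)%:R.
Proof.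
rewrite /block_prob muln0 add0r expr0 divr1; by case: k => [[|i]|i].
Qed.

Lemma block_prob_centerS n :
  block_prob n.+1 0 * (n.+1%:R * 2) = block_prob n 0 * (2 * n%:R + 1).
Proof.
rewrite /block_prob !addr0 /=.
have e : ('C(2 * n.+1, n.+1) * n.+1 = 2 * (2 * n).+1 * 'C(2 * n, n))%N.
  have c : 'C((2 * n).+1, n.+1) = 'C((2 * n).+1, n).
    by rewrite -bin_sub; [congr ('C(_, _)); lia|lia].
  rewrite {1}(_ : 2 * n.+1 = (2 * n).+2)%N; last by lia.
  rewrite mulnC -mul_bin_diag -c.
  rewrite (_ : (2 * n).+2 = 2 * n.+1)%N; last by lia.
  by rewrite -!mulnA mul_bin_diag.
have e' : 'C(2 * n.+1, n.+1)%:R * n.+1%:R = 2 * (2 * n%:R + 1) * 'C(2 * n, n)%:R :> R.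
  by rewrite -natrM e !natrM -[(2 * n).+1]addn1 natrD natrM.
have p0 : (4 : R) ^+ n != 0 by rewrite expf_neq0// pnatr_eq0.
rewrite exprS; apply: (mulIf p0).
transitivity ('C(2 * n.+1, n.+1)%:R * n.+1%:R / 2 : R); first by field.
by rewrite e'; field.
Qed.

Lemma block_prob_center_sqr n : block_prob n 0 ^+ 2 * (2 * n%:R + 1) <= 1.
Proof.
elim: n => [|n IH]; first by rewrite block_prob0 mulr0 add0r expr1n mulr1.
have n0 : (0 : R) <= n%:R by exact: ler0n.
have e := block_prob_centerS n; move: IH e; rewrite -(natr1 n).
set b := block_prob n 0; set b' := block_prob n.+1 0; set N := n%:R in n0 *.
move=> IH e; have e2 : b' ^+ 2 * (4 * (N + 1) ^+ 2) = b ^+ 2 * (2 * N + 1) * (2 * N + 1).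
  transitivity ((b' * ((N + 1) * 2)) ^+ 2); first by ring.
  by rewrite e; ring.
have p : 0 < 4 * (N + 1) ^+ 2 by rewrite mulr_gt0// exprn_gt0//; lra.
rewrite -(ler_pM2r p) mul1r mulrAC e2.
apply: (@le_trans _ _ (1 * (2 * N + 1) * (2 * (N + 1) + 1))).
  by rewrite !ler_wpM2r//; lra.
(* The difference [4 (N + 1)^2 - (2 N + 1) (2 N + 3)] equals 1. *)
by rewrite -subr_ge0 [leRHS](_ : _ = 1)//; ring.
Qed.

(** The sum telescopes: by the recursion [b - b' = b / (2 (n + 1))], and [b ^+ 2 * (n + 1) <= 1], so
    the cube of [b] is at most [2 (b - b')]. The third power is where the dimension enters. *)
Lemma block_prob_center_sum N : \sum_(n < N) block_prob n 0 ^+ 3 <= 2.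
Proof.
suff h : \sum_(n < N) block_prob n 0 ^+ 3 <= 2 * (1 - block_prob N 0).
  by apply: le_trans h _; have /andP[b0 _] := block_prob01 N 0; lra.
elim: N => [|n IH]; first by rewrite big_ord0 block_prob0 subrr mulr0.
rewrite big_ord_recr/=; have n0 : (0 : R) <= n%:R by exact: ler0n.
have /andP[b0 b1] := block_prob01 n 0.
have e := block_prob_centerS n; have q := block_prob_center_sqr n.
move: IH e b0 b1 q; rewrite -(natr1 n).
set b := block_prob n 0; set b' := block_prob n.+1 0; set N := n%:R in n0 *.
move=> IH e b0 b1 q.
suff : b ^+ 3 <= 2 * (b - b') by move: IH; lra.
have p : 0 < N + 1 by lra.
rewrite -(ler_pM2r p).
have -> : 2 * (b - b') * (N + 1) = b by move: e; lra.
have -> : b ^+ 3 * (N + 1) = b ^+ 2 * (N + 1) * b by ring.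
rewrite ler_piMl//; apply: le_trans q; rewrite ler_wpM2l ?exprn_ge0//; lra.
Qed.

End central_binomial.

(* The pairs are [{2 m, 2 m + 1}] for [e = false] and [{2 m - 1, 2 m}] for [e = true]. *)
Definition flip (e : bool) (z : int) : int :=
  if (z %% 2)%Z == (~~ e)%:Z then z - 1 else z + 1.

Definition block (z : int) : int := (z %/ 2)%Z.

Lemma flipK e : involutive (flip e).
Proof.
move=> z; rewrite /flip; case: e => /=;
  by case: (boolP ((z %% 2)%Z == _)) => h; case: eqP => h'; lia.
Qed.

Lemma block_flip z : block (flip false z) = block z.
Proof. by rewrite /flip /block /=; case: eqP; lia. Qed.

Lemma block_flip_odd z :
  block (flip true z) = block z + (if (z %% 2)%Z == 0 then -1 else 1).
Proof. by rewrite /flip /block /=; case: eqP; lia. Qed.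

Lemma parity_flip e z : ((flip e z %% 2)%Z == 0) = ((z %% 2)%Z != 0).
Proof.
by rewrite /flip; case: e => /=; case: ifP => h; apply/idP/idP; lia.
Qed.

Section line_average.
Context {R : realType}.
Implicit Types (h u : int -> R).

Definition line_avg (e : bool) h (z : int) : R := (h z + h (flip e z)) / 2.

Lemma line_avg_idem e h : line_avg e (line_avg e h) = line_avg e h.
Proof. by apply/funext => z; rewrite /line_avg flipK; field. Qed.

Lemma line_avg_block u : line_avg false (u \o block) = u \o block.
Proof. by apply/funext => z; rewrite /line_avg /= block_flip; field. Qed.

(** With bias 1/2 a layer is a projection, so the two middle averages collapse into one, and the
    innermost one fixes functions of the block. The outer average then mixes the two parities inside
    a block, which move to opposite neighbours. *)
Lemma line_avg_palindrome u :
  line_avg false (line_avg true (line_avg true (line_avg false (u \o block)))) =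
  (fun k => u k / 2 + (u (k - 1) + u (k + 1)) / 4) \o block.
Proof.
rewrite line_avg_block line_avg_idem; apply/funext => z.
rewrite /line_avg /= !block_flip_odd parity_flip block_flip.
by case: eqP => _ /=; field.
Qed.

End line_average.

Section cubic_lattice.
Context {R : realType} (d : nat).
Notation Zd := 'rV[int]_d.

(* For [k < 2 d] this acts on coordinate [k./2]; for larger [k] it is the identity. *)
Definition lattice_swap (k : nat) (x : Zd) : Zd :=
  \row_j (if k./2 == j :> nat then flip (odd k) (x 0 j) else x 0 j).

(** The general construction takes an infinite summable sequence of biases in [(0, 1)]; the
    geometric tail is attached to layers that act as the identity. *)
Definition lattice_bias (k : nat) : R := if (k < d.*2)%N then 2^-1 else 2^-1 ^+ k.+1.

Lemma lattice_swapK k : involutive (lattice_swap k).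
Proof.
by move=> x; apply/rowP => j; rewrite !mxE; case: eqP => // _; rewrite flipK.
Qed.

Lemma half_expr01 k : 0 < (2^-1 : R) ^+ k.+1 < 1.
Proof. by rewrite exprn_gt0 ?exprn_ilt1//= ?invr_ge0//; lra. Qed.

Lemma lattice_bias01 k : 0 < lattice_bias k < 1.
Proof. by rewrite /lattice_bias; case: ifP => _; [lra|exact: half_expr01]. Qed.

Lemma lattice_bias_sum : (\sum_(k <oo) (lattice_bias k)%:E < +oo)%E.
Proof.
apply: (@nneseries_lty _ _ (d.*2%:R + 1)) => [k|N].
  by have /andP[/ltW] := lattice_bias01 k.
apply: (@le_trans _ _ (\sum_(0 <= k < N) ((k < d.*2)%N%:R + 2^-1 ^+ k.+1))).
  apply: ler_sum => k _; have /andP[e0 _] := half_expr01 k.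
  by rewrite /lattice_bias; case: ifP => _ /=; lra.
rewrite big_split/= lerD ?geometric_sum_le1// -natr_sum ler_nat -big_mkcond/=.
rewrite sum1_count -size_filter -[leqRHS](size_iota 0); apply: uniq_leq_size.
  by rewrite filter_uniq ?iota_uniq.
by move=> k; rewrite mem_filter mem_iota => /andP[].
Qed.

Local Notation avg := (avg lattice_swap lattice_bias).
Local Notation avgs := (avgs lattice_swap lattice_bias).

Definition tensor (h : 'I_d -> int -> R) (x : Zd) : R := \prod_(i < d) h i (x 0 i).

Lemma avg_fix k (f : Zd -> R) x : (d.*2 <= k)%N -> avg k f x = f x.
Proof.
move=> dk; rewrite /avg (_ : lattice_swap k x = x); first by ring.
apply/rowP => j; rewrite mxE; case: eqP => // kj; exfalso.
by have := ltn_ord j; lia.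
Qed.

Lemma avg_tensor k h x : avg k (tensor h) x =
  tensor (fun i => if k./2 == i :> nat then line_avg (odd k) (h i) else h i) x.
Proof.
have [kd|kd] := leqP d.*2 k.
  rewrite avg_fix//; apply: eq_bigr => i _; case: eqP => // ki; exfalso.
  by have := ltn_ord i; lia.
have kd2 : (k./2 < d)%N by lia.
pose i := Ordinal kd2; rewrite /avg /lattice_bias kd /tensor.
have split_i (F : 'I_d -> R) : \prod_j F j = F i * \prod_(j < d | j != i) F j.
  by rewrite (bigD1 i).
rewrite !split_i /= eqxx mxE eqxx.
have -> : \prod_(j < d | j != i) h j (lattice_swap k x 0 j) =
    \prod_(j < d | j != i) h j (x 0 j).
  apply: eq_bigr => j ji; rewrite mxE; case: eqP => // kj.
  by case/eqP: ji; apply: val_inj.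
have -> : \prod_(j < d | j != i)
     (if k./2 == j :> nat then line_avg (odd k) (h j) else h j) (x 0 j) =
    \prod_(j < d | j != i) h j (x 0 j).
  apply: eq_bigr => j ji; case: eqP => // kj.
  by case/eqP: ji; apply: val_inj.
by rewrite /line_avg; field.
Qed.

(** Each layer acts on a single coordinate, so products over the coordinates are preserved and
    coordinate [i] sees only the layers [2 i] and [2 i + 1]. *)
Lemma avgs_tensor ks h x : avgs ks (tensor h) x =
  tensor (fun i => foldr (fun k g => line_avg (odd k) g) (h i)
                         [seq k <- ks | k./2 == i :> nat]) x.
Proof.
elim: ks x => //= k ks IH x.
rewrite (_ : avgs ks _ = tensor (fun i => foldr (fun k g => line_avg (odd k) g) (h i)
                         [seq k <- ks | k./2 == i :> nat])); last exact/funext.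
by rewrite avg_tensor; apply: eq_bigr => i _; case: ifP.
Qed.

Lemma filter_half_iota M i : (i < d)%N -> (d.*2 <= M)%N ->
  [seq k <- iota 0 M | k./2 == i] = [:: i.*2; i.*2.+1].
Proof.
move=> id dM; have -> : M = (i.*2 + (2 + (M - i.*2 - 2)))%N by lia.
have no a m : (forall k, (a <= k < a + m)%N -> k./2 != i) ->
    [seq k <- iota a m | k./2 == i] = [::].
  move=> h; rewrite -(filter_pred0 (iota a m)); apply: eq_in_filter => k.
  by rewrite mem_iota => /h /negbTE.
rewrite iotaD filter_cat no ?cat0s => [|k]; last by lia.
rewrite iotaD filter_cat [X in _ ++ X]no => [|k]; last by lia.
by rewrite cats0 add0n /= uphalf_double doubleK eqxx.
Qed.

(* The probability that the walk is in the block of [a] after [n] steps; a block has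
   side 2 and the coordinates of the block are independent walks. *)
Definition lattice_green (a : Zd) (n : nat) : Zd -> R :=
  tensor (fun i z => block_prob n (block z - block (a 0 i))).

Lemma lattice_green01 a n x : 0 <= lattice_green a n x <= 1.
Proof.
rewrite /lattice_green /tensor; elim/big_ind: _ => [|u v /andP[u0 u1] /andP[v0 v1]|i _].
- by rewrite ler01 lexx.
- by rewrite mulr_ge0//= mulr_ile1.
- exact: block_prob01.
Qed.

Lemma lattice_green0 a : lattice_green a 0 a = 1.
Proof. by rewrite /lattice_green /tensor big1// => i _; rewrite subrr block_prob0. Qed.

Lemma lattice_green_sum a N : (3 <= d)%N -> \sum_(n < N) lattice_green a n a <= 2.
Proof.
move=> d3; apply: le_trans (@block_prob_center_sum R N); apply: ler_sum => n _.
rewrite /lattice_green /tensor (eq_bigr (fun=> block_prob n 0)); last first.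
  by move=> i _; rewrite subrr.
rewrite prodr_const card_ord; have /andP[b0 b1] := @block_prob01 R n 0.
exact: ler_wiXn2l.
Qed.

Definition lattice_law : probability (borel_sym Zd) R :=
  stirring_law lattice_swapK lattice_bias01.

Lemma lattice_green_step a n x :
  Ex lattice_law (fun s => lattice_green a n ((s : sym Zd) x)) = lattice_green a n.+1 x.
Proof.
have c := stirring_law_avgs (sgK := lattice_swapK) (dl01 := lattice_bias01)
  lattice_bias_sum (x := x) (lattice_green01 a n).
apply: (cvg_unique _ c) => //; apply: cvg_near_cst; near=> M.
have dM : (d.*2 <= M)%N by near: M; exact: nbhs_infty_ge.
rewrite avgs_tensor; apply: eq_bigr => i _.
rewrite filter_cat filter_rev filter_half_iota//= odd_double /=.
rewrite (line_avg_palindrome (fun k => block_prob n (k - block (a 0 i)))) /=.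
by rewrite block_probS; congr (_ / _ + (block_prob _ _ + block_prob _ _) / _); lia.
Unshelve. all: by end_near. Qed.

Definition norm1 (x : Zd) : R := \sum_(i < d) (`|x 0 i|%:~R).

Lemma norm2_le_norm1 (x : Zd) : norm2 R x <= norm1 x.
Proof.
have n0 i : 0 <= (`|x 0 i|%:~R : R) by rewrite ler0z.
have s0 : 0 <= norm1 x by exact: sumr_ge0.
rewrite -(ger0_norm s0) -sqrtr_sqr /norm2 ler_wsqrtr//.
rewrite (eq_bigr (fun i => (`|x 0 i|%:~R : R) ^+ 2)); last first.
  by move=> i _; rewrite intr_norm real_normK ?num_real.
rewrite /norm1; have : forall i, true -> 0 <= (`|x 0 i|%:~R : R) by [].
elim: (index_enum _) => [|i r IH] h; first by rewrite !big_nil expr0n.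
rewrite !big_cons sqrrD; have := IH h.
have : 0 <= (`|x 0 i|%:~R : R) * \sum_(j <- r) `|x 0 j|%:~R by rewrite mulr_ge0// sumr_ge0.
by lra.
Qed.

Lemma norm1_swap k (x y : Zd) : norm1 (x - y) - 1 <= norm1 (lattice_swap k x - y).
Proof.
rewrite lerBlDr.
have [kd|kd] := ltnP k./2 d; last first.
  rewrite (_ : lattice_swap k x = x) ?lerDl//; apply/rowP => j; rewrite mxE.
  by case: eqP => // kj; have := ltn_ord j; lia.
pose i := Ordinal kd; rewrite /norm1.
have split_i (F : 'I_d -> R) : \sum_j F j = F i + \sum_(j < d | j != i) F j.
  by rewrite (bigD1 i).
rewrite !split_i.
have -> : \sum_(j < d | j != i) `|(lattice_swap k x - y) 0 j|%:~R =
    \sum_(j < d | j != i) `|(x - y) 0 j|%:~R :> R.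
  apply: eq_bigr => j ji; rewrite !mxE; case: eqP => // kj.
  by case/eqP: ji; apply: val_inj.
rewrite addrAC lerD2r !mxE eqxx -(rmorphD _ _ 1) ler_int.
by move: (x 0 i) (y 0 i) => u v; rewrite /flip; case: ifP => _; lia.
Qed.

(** The function [E] majorises the indicator of [y], and each swap changes the 1-norm by at most 1,
    so each nontrivial layer costs a factor [expR 1]. The palindrome has at most [4 d] of them,
    whence [b = 1] and [B = expR (4 * d%:R)]. *)
Lemma lattice_kernel_le x y :
  kernel lattice_law x y <= expR (4 * d%:R) * expR (- (1 * norm2 R (x - y))).
Proof.
pose f (z : Zd) : R := (z == y)%:R.
have f01 z : 0 <= f z <= 1 by rewrite ler0n lern1 leq_b1.
have c := stirring_law_avgs (sgK := lattice_swapK) (dl01 := lattice_bias01)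
  lattice_bias_sum (x := x) f01.
have -> : kernel lattice_law x y = Ex lattice_law (fun s => f ((s : sym Zd) x)).
  by congr Ex; apply/funext => s; rewrite /ind /f; congr ((nat_of_bool _)%:R); apply/asboolP/eqP.
pose E (z : Zd) : R := expR (- norm1 (z - y)).
have avgE k (a : R) z : 0 <= a -> avg k (fun z => a * E z) z <=
    (if (k < d.*2)%N then expR 1 else 1) * a * E z.
  move=> a0; case: ltnP => kd; last by rewrite avg_fix// mul1r.
  have E1 : E (lattice_swap k z) <= expR 1 * E z.
    by rewrite -expRD ler_expR; have := norm1_swap k z y; lra.
  have E2 : E z <= expR 1 * E z by rewrite ler_peMl ?expR_ge0// ltW// expR_gt1.
  rewrite /avg /lattice_bias kd -mulrA [leRHS]mulrCA.
  rewrite [leRHS](_ : _ = (1 - 2^-1) * (a * (expR 1 * E z)) + 2^-1 * (a * (expR 1 * E z))); last by field.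
  by rewrite lerD// ler_wpM2l ?ler_wpM2l//; lra.
have avgsE ks z : avgs ks f z <= expR 1 ^+ count (fun k => k < d.*2)%N ks * E z.
  elim: ks z => [|k ks IH] z /=.
    rewrite expr0 mul1r /f; case: eqP => [->|_]; last exact: expR_ge0.
    rewrite /E subrr /norm1 big1 ?oppr0 ?expR0// => i _.
    by rewrite mxE normr0.
  apply: le_trans (avg_le lattice_swap lattice_bias01 k IH z) _.
  apply: le_trans (avgE _ _ _ _) _; first by rewrite exprn_ge0 ?expR_ge0.
  by case: ltnP => _ /=; rewrite ?mul1r// exprS.
apply: (ler_cvg_to c (cvg_cst _)); near=> M.
apply: le_trans (avgsE _ _) _; rewrite ler_pM ?exprn_ge0 ?expR_ge0//; last first.
  by rewrite ler_expR mul1r lerN2 norm2_le_norm1.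
have cM : (count (fun k => k < d.*2)%N (iota 0 M) <= d.*2)%N.
  rewrite -size_filter -[leqRHS](size_iota 0); apply: uniq_leq_size.
    by rewrite filter_uniq ?iota_uniq.
  by move=> k; rewrite mem_filter mem_iota [_ \in iota 0 d.*2]mem_iota => /andP[/= ->].
rewrite -expRM_natl mulr1 ler_expR count_cat count_rev.
rewrite -(natrM _ 4) ler_nat; lia.
Unshelve. all: by end_near. Qed.

End cubic_lattice.

(** * Flips of binary digits *)

(** Two's complement digits: division rounds down, so negative integers have digits as well and
    flips act on the whole line. *)
Definition bit (m : nat) (z : int) : int := ((z %/ (2 ^ m)%N%:Z)%Z %% 2)%Z.

Definition bit_flip (m : nat) (z : int) : int :=
  if bit m z == 0 then z + (2 ^ m)%N%:Z else z - (2 ^ m)%N%:Z.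

Lemma div_bit_flip m z :
  (bit_flip m z %/ (2 ^ m)%N%:Z)%Z =
  (z %/ (2 ^ m)%N%:Z)%Z + (if bit m z == 0 then 1 else -1).
Proof.
have p0 : (2 ^ m)%N%:Z != 0 by rewrite eqz_nat expn_eq0.
have := divzMDl 1 z p0; have := divzMDl (-1) z p0.
rewrite mul1r mulN1r /bit_flip => eN e1; case: ifP => _.
  by rewrite (addrC z) e1 addrC.
by rewrite (addrC z) eN addrC.
Qed.

Lemma bit_bit_flip m z : (bit m (bit_flip m z) == 0) = (bit m z != 0).
Proof.
rewrite {1}/bit div_bit_flip /bit; move: (z %/ _)%Z => u.
by case: ifP => /eqP h; apply/idP/idP; lia.
Qed.

Lemma bit_flipK m : involutive (bit_flip m).
Proof.
move=> z; rewrite {1}/bit_flip bit_bit_flip /bit_flip.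
by case: (bit m z == 0) => /=; lia.
Qed.

(** For [j < m] the quotient by [2 ^ j] changes by an even number. For [j > m] the digit depends
    only on the quotient by [2 ^ m.+1], which a flip of digit [m] preserves. *)
Lemma bit_bit_flip_neq j m z : j != m -> bit j (bit_flip m z) = bit j z.
Proof.
rewrite neq_ltn => /orP[jm|mj].
  have p0 : (2 ^ j)%N%:Z != 0 by rewrite eqz_nat expn_eq0.
  pose q := (2 ^ (m - j).-1)%N%:Z.
  have qE : (2 ^ m)%N%:Z = (2 * q) * (2 ^ j)%N%:Z :> int.
    rewrite -!PoszM; congr Posz; rewrite -expnS prednK ?subn_gt0// -expnD subnK//.
    exact: ltnW.
  have := divzMDl (2 * q) z p0; have := divzMDl (- (2 * q)) z p0.
  rewrite mulNr -qE /bit => eN e1; rewrite /bit_flip.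
  by case: ifP => _; rewrite (addrC z) ?e1 ?eN; lia.
rewrite /bit; have -> : (2 ^ j = 2 ^ m * 2 * 2 ^ (j - m.+1))%N.
  by rewrite -expnSr -expnD subnKC.
rewrite !PoszM !divzMA_ge0//.
have -> : ((bit_flip m z %/ (2 ^ m)%N%:Z)%Z %/ 2)%Z = ((z %/ (2 ^ m)%N%:Z)%Z %/ 2)%Z.
  by rewrite div_bit_flip /bit; move: (z %/ _)%Z => u; case: ifP => /eqP h; lia.
by [].
Qed.

Definition bit_sign {R : realType} (m : nat) (z : int) : R :=
  if bit m z == 0 then 1 else -1.

Section binary_flips.
Context {R : realType}.
Notation Z2 := 'rV[int]_2.

Definition plane_swap (m : nat) (x : Z2) : Z2 :=
  \row_j (if j == 0 then bit_flip m (x 0 j) else x 0 j).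

(** The decay is a compromise: summable, so that the limit exists and the majorant has finite mass,
    yet slow enough that about [3 log2 n] digits are mixed by time [n], which makes the return
    probabilities summable. *)
Definition plane_bias (m : nat) : R := 2^-1 ^+ (m %/ 3).+1.

Lemma plane_swapK m : involutive (plane_swap m).
Proof.
by move=> x; apply/rowP => j; rewrite !mxE; case: eqP => // _; rewrite bit_flipK.
Qed.

Lemma plane_bias01 m : 0 < plane_bias m < 1.
Proof. exact: half_expr01. Qed.

Lemma plane_bias_le_half m : plane_bias m <= 2^-1.
Proof. by rewrite /plane_bias exprS ler_piMr ?exprn_ile1//; lra. Qed.

Lemma plane_bias_sum_le N : \sum_(0 <= m < N) plane_bias m <= 3.
Proof.
have b0 m : 0 <= plane_bias m by have /andP[/ltW] := plane_bias01 m.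
(* The sum is extended to [3 N] terms so that the biases group into triples of equal values. *)
apply: (@le_trans _ _ (\sum_(0 <= m < 3 * N) plane_bias m)).
  rewrite (@big_cat_nat _ _ _ N 0 (3 * N))//=; last by lia.
  by rewrite lerDl sumr_ge0.
apply: (@le_trans _ _ (3 * \sum_(0 <= k < N) (2^-1 : R) ^+ k.+1)); last first.
  by have := @geometric_sum_le1 R N; lra.
elim: N => [|N IH]; first by rewrite muln0 !big_geq// mulr0.
rewrite mulnS addnC !addnS addn0 !big_nat_recr//= /plane_bias.
rewrite (_ : (3 * N) %/ 3 = N)%N; last by lia.
rewrite (_ : (3 * N).+1 %/ 3 = N)%N; last by lia.
rewrite (_ : (3 * N).+2 %/ 3 = N)%N; last by lia.
by move: IH; rewrite /plane_bias; lra.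
Qed.

Lemma plane_bias_sum : (\sum_(k <oo) (plane_bias k)%:E < +oo)%E.
Proof.
apply: (@nneseries_lty _ _ 3); last exact: plane_bias_sum_le.
by move=> k; have /andP[/ltW] := plane_bias01 k.
Qed.

Local Notation avg := (avg plane_swap plane_bias).
Local Notation avgs := (avgs plane_swap plane_bias).

Definition plane_law : probability (borel_sym Z2) R :=
  stirring_law plane_swapK plane_bias01.

Definition plane_shift (m : nat) : Z2 := \row_j (if j == 0 then (2 ^ m)%N%:Z else 0).

(* The translation invariant majorant of [avg]: [plane_swap m] moves by [plane_shift m] in
   one of the two directions. *)
Definition spread (m : nat) (f : Z2 -> R) (z : Z2) : R :=
  f z + plane_bias m * (f (z + plane_shift m) + f (z - plane_shift m)).

Definition spreads (ks : seq nat) (f : Z2 -> R) : Z2 -> R := foldr spread f ks.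

Lemma plane_swap_shift m x :
  plane_swap m x = x + plane_shift m \/ plane_swap m x = x - plane_shift m.
Proof.
have [b|b] := boolP (bit m (x 0 0) == 0); [left|right]; apply/rowP => j;
  rewrite !mxE; case: eqP => [->|_]; rewrite ?oppr0 ?addr0// /bit_flip ?b//.
by rewrite (negbTE b).
Qed.

Lemma spread_ge0 m f : (forall z, 0 <= f z) -> forall z, 0 <= spread m f z.
Proof.
move=> f0 z; have /andP[/ltW b0 _] := plane_bias01 m.
by rewrite addr_ge0// mulr_ge0// addr_ge0.
Qed.

Lemma spreads_ge0 ks f : (forall z, 0 <= f z) -> forall z, 0 <= spreads ks f z.
Proof. by move=> f0; elim: ks => //= k ks IH; exact: spread_ge0. Qed.

Lemma spread_le m f g : (forall z, f z <= g z) -> forall z, spread m f z <= spread m g z.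
Proof.
move=> fg z; have /andP[/ltW b0 _] := plane_bias01 m.
by rewrite lerD// ler_wpM2l// lerD.
Qed.

Lemma spreads_le ks f g : (forall z, f z <= g z) -> forall z, spreads ks f z <= spreads ks g z.
Proof. by move=> fg; elim: ks => //= k ks IH; exact: spread_le. Qed.

Lemma le_spread m f : (forall z, 0 <= f z) -> forall z, f z <= spread m f z.
Proof.
move=> f0 z; have /andP[/ltW b0 _] := plane_bias01 m.
by rewrite lerDl mulr_ge0// addr_ge0.
Qed.

Lemma avgs_le_spreads ks f g y : (forall z, 0 <= g z) ->
  (forall x, f x <= g (x - y)) -> forall x, avgs ks f x <= spreads ks g (x - y).
Proof.
move=> g0 fg; elim: ks => //= k ks IH x.
have /andP[b0 b1] := plane_bias01 k; have h := spreads_ge0 ks g0.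
rewrite /avg /spread; apply: lerD.
  apply: (@le_trans _ _ ((1 - plane_bias k) * spreads ks g (x - y))).
    by rewrite ler_wpM2l// subr_ge0 ltW.
  by rewrite ler_piMl//; lra.
apply: ler_wpM2l; first exact: ltW.
apply: le_trans (IH _) _.
by case: (plane_swap_shift k x) => ->; rewrite addrAC ?lerDl ?lerDr.
Qed.

Lemma sum_spreads ks f (B : R) : (forall zs, uniq zs -> \sum_(z <- zs) f z <= B) ->
  forall zs, uniq zs ->
  \sum_(z <- zs) spreads ks f z <= \prod_(k <- ks) (1 + 2 * plane_bias k) * B.
Proof.
move=> fB; elim: ks => [|k ks IH] zs uzs /=; first by rewrite big_nil mul1r; exact: fB.
rewrite big_cons -mulrA; set C := _ * B in IH *.
have /andP[/ltW b0 _] := plane_bias01 k.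
rewrite /spread big_split/= -mulr_sumr big_split/=.
have sh a : \sum_(z <- zs) spreads ks f (z + a) <= C.
  rewrite -(big_map (fun z => z + a) xpredT (spreads ks f)); apply: IH.
  by rewrite map_inj_uniq//; exact: addIr.
rewrite mulrDl mul1r lerD ?IH// -mulrA [leRHS]mulrCA ler_wpM2l//.
by have := sh (plane_shift k); have := sh (- plane_shift k); lra.
Qed.

Definition spread_kernel (M : nat) : Z2 -> R :=
  spreads (iota 0 M ++ rev (iota 0 M)) (fun z => (z == 0)%:R).

Lemma spread_kernel_sum M zs : uniq zs -> \sum_(z <- zs) spread_kernel M z <= expR 12.
Proof.
move=> uzs; rewrite /spread_kernel.
apply: le_trans (sum_spreads (B := 1) _ _ uzs) _.
  move=> ys uys; rewrite -natr_sum -big_mkcond/= sum1_count lern1.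
  by rewrite (count_uniq_mem 0 uys) leq_b1.
have p0 : 0 <= \prod_(k <- iota 0 M) (1 + 2 * plane_bias k).
  by apply: prodr_ge0 => k _; have /andP[/ltW b0 _] := plane_bias01 k; lra.
(* The biases sum to at most 3 and enter with factor 2, giving 6; the two halves of the palindrome
   give 12. *)
have p1 : \prod_(k <- iota 0 M) (1 + 2 * plane_bias k) <= expR 6.
  apply: (@le_trans _ _ (expR (2 * \sum_(0 <= m < M) plane_bias m))).
    rewrite /index_iota subn0 mulr_sumr expR_sum big_seq [leRHS]big_seq.
    apply: ler_prod => k _; rewrite expR_ge1Dx andbT.
    by have /andP[/ltW b0 _] := plane_bias01 k; lra.
  by rewrite ler_expR; have := plane_bias_sum_le M; lra.
rewrite mulr1 big_cat/= (perm_big _ (permEl (perm_rev (iota 0 M)))) /=.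
rewrite (_ : 12 = 6 + 6); last by ring.
by rewrite expRD ler_pM.
Qed.

(** The next palindrome inserts two operators [spread] in the middle, each of which increases
    nonnegative functions. With the uniform mass bound this provides the limit kernel. *)
Lemma spread_kernel_incr z : nondecreasing_seq (spread_kernel ^~ z).
Proof.
apply/nondecreasing_seqP => M; rewrite /spread_kernel.
rewrite -[M.+1]addn1 iotaD/= rev_cat -catA /spreads !foldr_cat/=.
have d0 (z' : Z2) : 0 <= ((z' == 0)%:R : R) by exact: ler0n.
have r0 := spreads_ge0 (rev (iota 0 M)) d0.
rewrite -[X in foldr _ X (iota 0 M)]/(spreads (rev (iota 0 M)) (fun z => (z == 0)%:R)).
apply: (spreads_le (iota 0 M)) => y.
apply: le_trans (le_spread _ _ _); last by apply: spread_ge0.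
exact: le_spread.
Qed.


Definition plane_kernel_bound (z : Z2) : R := limn (spread_kernel ^~ z).

Lemma spread_kernel_cvg z : spread_kernel ^~ z @ \oo --> plane_kernel_bound z.
Proof.
apply: nondecreasing_is_cvgn; first exact: spread_kernel_incr.
exists (expR 12) => _ [M _ <-].
by have := @spread_kernel_sum M [:: z] isT; rewrite big_seq1.
Qed.

Lemma plane_kernel_bound_summable :
  summable [set: Z2] (fun z => (plane_kernel_bound z)%:E).
Proof.
have k0 z : 0 <= plane_kernel_bound z.
  apply: limr_ge; first exact: (cvgP _ (@spread_kernel_cvg z)).
  apply: nearW => M.
  by apply: spreads_ge0 => z'; exact: ler0n.
rewrite /summable; apply: (@le_lt_trans _ _ (expR 12)%:E); last exact: ltry.
apply: ub_ereal_sup => _ [A [fA _] <-]; rewrite fsbig_finite//=.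
rewrite (eq_bigr (fun z => (plane_kernel_bound z)%:E)); last first.
  by move=> z _; rewrite ger0_norm.
rewrite sumEFin lee_fin.
have c : forall zs : seq Z2, \sum_(z <- zs) spread_kernel M z @[M --> \oo] -->
    \sum_(z <- zs) plane_kernel_bound z.
  elim=> [|z zs IH].
    by under eq_fun do rewrite big_nil; rewrite big_nil; exact: cvg_cst.
  under eq_fun do rewrite big_cons; rewrite big_cons.
  by apply: cvgD => //; exact: spread_kernel_cvg.
apply: (ler_cvg_to (c _) (cvg_cst _)); apply: nearW => M.
by apply: spread_kernel_sum; exact: fset_uniq.
Qed.

Lemma plane_kernel_le x y : kernel plane_law x y <= plane_kernel_bound (x - y).
Proof.
pose f (z : Z2) : R := (z == y)%:R.
have f01 z : 0 <= f z <= 1 by rewrite ler0n lern1 leq_b1.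
have c := stirring_law_avgs (sgK := plane_swapK) (dl01 := plane_bias01)
  plane_bias_sum (x := x) f01.
have -> : kernel plane_law x y = Ex plane_law (fun s => f ((s : sym Z2) x)).
  by congr Ex; apply/funext => s; rewrite /ind /f; congr ((nat_of_bool _)%:R); apply/asboolP/eqP.
apply: (ler_cvg_to c (@spread_kernel_cvg (x - y))); apply: nearW => M.
apply: avgs_le_spreads => [z|z]; first exact: ler0n.
by rewrite /f subr_eq0.
Qed.

Local Notation chi := (@bit_sign R).

Lemma bit_sign_swap m k x :
  chi m (plane_swap k x 0 0) = (if m == k then -1 else 1) * chi m (x 0 0).
Proof.
rewrite mxE eqxx /bit_sign; case: (eqVneq m k) => [->|mk].
  by rewrite bit_bit_flip; case: (bit k _ == 0); rewrite /= ?mulr1// mulN1r opprK.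
by rewrite bit_bit_flip_neq// mul1r.
Qed.

Lemma bit_sign_sqr m z : chi m z * chi m z = 1.
Proof. by rewrite /bit_sign; case: ifP => _; rewrite ?mulr1// mulN1r opprK. Qed.

Lemma bit_sign_norm m z : `|chi m z| = 1.
Proof. by rewrite /bit_sign; case: ifP => _; rewrite ?normrN normr1. Qed.

(** For [c m = chi m (a 0 0)] this is the indicator that the first [B] digits agree with those of
    [a]. The form is stable under layers: the sign of digit [k] is an eigenfunction of layer [k]
    with eigenvalue [1 - 2 * plane_bias k]. *)
Definition bit_product (B : nat) (c : nat -> R) (x : Z2) : R :=
  \prod_(m < B) ((1 + c m * chi m (x 0 0)) / 2).

Lemma avg_bit_product k B c x : avg k (bit_product B c) x =
  bit_product B (fun m => if m == k then (1 - 2 * plane_bias k) * c m else c m) x.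
Proof.
rewrite /avg /bit_product; have [kB|kB] := ltnP k B; last first.
  have E : \prod_(m < B) ((1 + c m * chi m (plane_swap k x 0 0)) / 2) =
           \prod_(m < B) ((1 + c m * chi m (x 0 0)) / 2).
    by apply: eq_bigr => m _; rewrite bit_sign_swap ltn_eqF ?mul1r// (leq_trans _ kB).
  rewrite E -mulrDl subrK mul1r; apply: eq_bigr => m _.
  by rewrite ltn_eqF// (leq_trans _ kB).
pose i := Ordinal kB.
have split_i (F : 'I_B -> R) : \prod_j F j = F i * \prod_(j < B | j != i) F j.
  by rewrite (bigD1 i).
rewrite !split_i /= eqxx bit_sign_swap eqxx.
have -> : \prod_(j < B | j != i) ((1 + c j * chi j (plane_swap k x 0 0)) / 2) =
    \prod_(j < B | j != i) ((1 + c j * chi j (x 0 0)) / 2).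
  by apply: eq_bigr => j ji; rewrite bit_sign_swap (negbTE ji : (j == k :> nat) = false) mul1r.
have -> : \prod_(j < B | j != i)
    ((1 + (if j == k :> nat then (1 - 2 * plane_bias k) * c j else c j) * chi j (x 0 0)) / 2) =
    \prod_(j < B | j != i) ((1 + c j * chi j (x 0 0)) / 2).
  by apply: eq_bigr => j ji; rewrite (negbTE ji : (j == k :> nat) = false).
by field.
Qed.

Lemma avgs_bit_product ks B c x : avgs ks (bit_product B c) x =
  bit_product B (fun m => (1 - 2 * plane_bias m) ^+ count_mem m ks * c m) x.
Proof.
elim: ks x => [|k ks IH] x /=.
  by congr bit_product; apply/funext => m; rewrite expr0 mul1r.
rewrite (_ : avgs ks _ = bit_product B
  (fun m => (1 - 2 * plane_bias m) ^+ count_mem m ks * c m)); last exact/funext.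
rewrite avg_bit_product; congr bit_product; apply/funext => m.
rewrite eq_sym; case: eqP => [->|_]; last by rewrite add0n.
by rewrite add1n exprS mulrA.
Qed.

(* The probability that the first [B] digits agree with those of [a] after [n] steps: the
   digits are independent and their signs are eigenfunctions of the walk. *)
Definition plane_green (a : Z2) (B n : nat) : Z2 -> R :=
  bit_product B (fun m => (1 - 2 * plane_bias m) ^+ (2 * n) * chi m (a 0 0)).

Lemma plane_ratio01 m : 0 <= 1 - 2 * plane_bias m <= 1.
Proof. by have := plane_bias_le_half m; have /andP[b0 _] := plane_bias01 m; lra. Qed.

Lemma plane_green01 a B n x : 0 <= plane_green a B n x <= 1.
Proof.
rewrite /plane_green /bit_product.
elim/big_ind: _ => [|u v /andP[u0 u1] /andP[v0 v1]|m _].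
- by rewrite ler01 lexx.
- by rewrite mulr_ge0//= mulr_ile1.
set t := _ * _ * _; have : `|t| <= 1.
  rewrite /t !normrM !bit_sign_norm !mulr1 normrX exprn_ile1//.
  by have /andP[r0 r1] := plane_ratio01 m; rewrite ger0_norm.
by rewrite ler_norml => /andP[t0 t1]; apply/andP; split; lra.
Qed.

Lemma plane_green0 a B : plane_green a B 0 a = 1.
Proof.
rewrite /plane_green /bit_product big1// => m _.
by rewrite expr0 mul1r bit_sign_sqr; field.
Qed.

Lemma plane_green_step a B n x :
  Ex plane_law (fun s => plane_green a B n ((s : sym Z2) x)) = plane_green a B n.+1 x.
Proof.
have c := stirring_law_avgs (sgK := plane_swapK) (dl01 := plane_bias01)
  plane_bias_sum (x := x) (plane_green01 a B n).
apply: (cvg_unique _ c) => //; apply: cvg_near_cst; near=> M.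
have BM : (B <= M)%N by near: M; exact: nbhs_infty_ge.
rewrite avgs_bit_product; apply: eq_bigr => m _.
have mM : (m < M)%N by rewrite (leq_trans _ BM).
rewrite count_cat count_rev count_uniq_mem ?iota_uniq// mem_iota mM /=.
by rewrite mulrA -exprD mulnS.
Unshelve. all: by end_near. Qed.

(** With [j = trunc_log 2 n], digits below [3 j] have bias at least [2 ^- j], hence at least
    [1 / n], so their coefficient after [n] steps is at most [expR (- 4) <= 1/5] and each factor at
    most 3/5. Since the cube of 3/5 is below 1/4, the product is at most [4 ^- j], and
    [n + 1 <= 2 ^ j.+1]. *)
Lemma plane_green_le a n :
  plane_green a (3 * trunc_log 2 n) n a <= 4 / (n%:R + 1) ^+ 2.
Proof.
have [->|n0] := posnP n.
  rewrite trunc_log0 muln0 /plane_green /bit_product big_ord0 add0r expr1n; lra.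
set j := trunc_log 2 n.
have /andP[jn nj] : (2 ^ j <= n < 2 ^ j.+1)%N by exact: trunc_log_bounds.
have le35 (m : 'I_(3 * j)) : 0 <= (1 + (1 - 2 * plane_bias m) ^+ (2 * n)) / 2 <= 3 / 5.
  have /andP[r0 r1] := plane_ratio01 m.
  have p0 : 0 <= (1 - 2 * plane_bias m) ^+ (2 * n) by exact: exprn_ge0.
  suff : (1 - 2 * plane_bias m) ^+ (2 * n) <= 5^-1 by move=> h; apply/andP; split; lra.
  have e4 : 5 <= expR 4 :> R by apply: le_trans (expR_ge1Dx _); lra.
  apply: (@le_trans _ _ (expR (- 4))); last first.
    by rewrite expRN lef_pV2// posrE ?expR_gt0//; lra.
  apply: (@le_trans _ _ (expR (- (2 * plane_bias m)) ^+ (2 * n))).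
    by rewrite lerXn2r// ?nnegrE ?expR_ge0// expR_ge1Dx.
  rewrite -expRM_natl ler_expR mulrN lerN2 natrM.
  have : 1 <= n%:R * plane_bias m.
    rewrite /plane_bias exprVn ler_pdivlMr ?exprn_gt0// mul1r -natrX ler_nat.
    apply: leq_trans jn; rewrite leq_exp2l//; have := ltn_ord m; lia.
  by lra.
have bound : plane_green a (3 * j) n a <= (3 / 5) ^+ (3 * j).
  rewrite -[X in _ <= _ ^+ X]card_ord -prodr_const /plane_green /bit_product.
  by apply: ler_prod => m _; rewrite -mulrA bit_sign_sqr mulr1; exact: le35.
apply: le_trans bound _; apply: (@le_trans _ _ (4^-1 ^+ j)).
  have h3 : (3 / 5) ^+ 3 <= 4^-1 :> R by rewrite !exprS expr0; lra.
  have h0 : 0 <= (3 / 5) ^+ 3 :> R by rewrite exprn_ge0//; lra.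
  by rewrite exprM lerXn2r// nnegrE invr_ge0.
have u0 : 0 < n%:R + 1 :> R by have := ler0n R n; lra.
rewrite exprVn ler_pdivlMr ?exprn_gt0// mulrC ler_pdivrMr ?exprn_gt0//.
rewrite (_ : 4 * 4 ^+ j = (2 * 2 ^+ j) ^+ 2 :> R); last first.
  by rewrite exprMn -exprM mulnC exprM; congr (_ * _ ^+ _); lra.
rewrite lerXn2r ?nnegrE ?(ltW u0)//.
by rewrite natr1 -exprS -natrX ler_nat.
Qed.

Lemma inverse_square_sum N : \sum_(n < N) (4 / (n%:R + 1) ^+ 2 : R) <= 8.
Proof.
(* Comparison with the telescoping sum of [4 / (N (N + 1))]. *)
suff h : (0 < N)%N -> \sum_(n < N) (4 / (n%:R + 1) ^+ 2 : R) <= 8 - 4 / N%:R.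
  case: N h => [|N] h; first by rewrite big_ord0.
  by apply: le_trans (h isT) _; rewrite gerBl divr_ge0.
elim: N => // -[|N] IH _.
  by rewrite big_ord_recr big_ord0 /= !add0r expr1n; lra.
rewrite big_ord_recr/=; apply: le_trans (lerD (IH isT) (lexx _)) _.
rewrite -[N.+2%:R]natr1; set t : R := N.+1%:R.
have t0 : 0 < t by rewrite ltr0n.
have -> : 8 - 4 / (t + 1) = 8 - 4 / t + 4 / (t * (t + 1)) by field; rewrite !gt_eqF//; lra.
rewrite lerD2l ler_pM2l// lef_pV2 ?posrE ?exprn_gt0 ?mulr_gt0//; [|lra|lra].
by rewrite expr2 ler_pM2r; lra.
Qed.

End binary_flips.

(** * The theorem *)

Section fast_orbits.
Context {R : realType} {X : countType}.
Variables (o : X) (mu : probability (borel_sym X) R).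
Context {d : measure_display} {W : measurableType d}.
Variables (P : probability W R) (s : nat -> {RV P >-> borel_sym X}).
Hypothesis iid : iid_law mu s.
Hypothesis nd : negatively_dependent mu.
Local Notation card := (inverted_orbit_card (fun n => s n) o).
Let q := never_returns P (fun n w => walk (fun i => s i) n w o) o.
Hypothesis q_gt0 : 0 < q.

Lemma not_slow_orbits : ~ slow_orbits P card.
Proof.
have l2 : 0 < ln 2 :> R by rewrite ln_gt0// ltr1n.
(* On the event [|O_n| <= eps n] the variable [2 ^- |O_n|] is at least [expR (- (ln 2 * eps * n))].
   Slow orbits would thus make its mean at least [expR (- ((1 + ln 2) * eps * n))]; this [eps] turns
   the exponent into [- n q / 2], just above the upper bound [- (n + 1) q / 2]. *)
pose eps := q / (2 * (1 + ln 2)).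
have e0 : 0 < eps by rewrite divr_gt0// mulr_gt0//; lra.
move=> /(_ eps e0) [N _ hN].
have /= h := hN N.+1 (leqnSn N); set n := N.+1 in h.
pose A := [set w | ((card n w)%:R <= eps * n%:R :> R)%R].
have mA : measurable A.
  exact: (dmeas_set [set k : nat | (k%:R <= eps * n%:R :> R)%R] (dmeas_card o s n)).
rewrite Ex_ind// lee_fin in h.
have low : expR (- (ln 2 * (eps * n%:R))) * Ex P (ind A) <= Ex P (half_pow o s n).
  rewrite -ExZ; last exact: bdd_ind.
  apply: Ex_le; [by apply: bddZ; exact: bdd_ind|exact: bdd_half_pow|].
  move=> w; have [Aw|Aw] := pselect (A w); last first.
    by rewrite (indF Aw) mulr0 exprn_ge0.
  rewrite (indT Aw) mulr1 /half_pow.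
  have -> : 2^-1 ^+ card n w = expR (- (ln 2 * (card n w)%:R)) :> R.
    by rewrite mulrC -mulrN expRM_natl expRN lnK// posrE.
  by rewrite ler_expR lerN2 ler_pM2l.
have := le_trans low (half_pow_upper o iid n nd); rewrite -/q => up.
have : expR (- (ln 2 * (eps * n%:R))) * expR (- (eps * n%:R)) <=
       expR (- ((n%:R + 1) / 2 * q)).
  by apply: le_trans up; rewrite ler_wpM2l ?expR_ge0.
rewrite -expRD ler_expR.
have -> : - (ln 2 * (eps * n%:R)) - eps * n%:R = - (n%:R / 2 * q).
  by rewrite /eps; field; rewrite gt_eqF//; lra.
by rewrite lerN2; move: q_gt0; lra.
Qed.

Lemma not_subexponential_mean : ~ subexponential_mean P card.
Proof.
rewrite /subexponential_mean => c.
suff : 0 <= - (q / 2) by move: q_gt0; lra.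
apply: (ler_cvg_to c (cvg_cst _)); near=> n.
have n0 : 0 < n%:R :> R by rewrite ltr0n; near: n; exact: nbhs_infty_gt.
rewrite half_pow_meanE/= ler_pdivrMr//.
have E0 : 0 < Ex P (half_pow o s n).
  by apply: lt_le_trans (half_pow_lower o iid n); exact: expR_gt0.
apply: (@le_trans _ _ (ln (expR (- ((n%:R + 1) / 2 * q))))).
  by rewrite ler_ln ?posrE ?expR_gt0//; exact: (half_pow_upper o iid n nd).
by rewrite expRK; move: q_gt0; lra.
Unshelve. all: by end_near. Qed.

End fast_orbits.

Lemma lattice_transient (R : realType) (d : nat) : (3 <= d)%N ->
  transient (conductance_walk (@lattice_law R d)).
Proof.
move=> d3 a disp W P Y mc.
have pE := @conductance_walkE _ _ _ (stirring_law_symmetric (@lattice_swapK d) (@lattice_bias01 R d) (@lattice_bias_sum R d)).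
apply: (never_returns_gt0 pE mc (B := 2)) => N.
apply: le_trans (@lattice_green_sum R d a N d3); apply: ler_sum => k _.
apply: (Ex_return_le pE mc) => [n x||n x].
- exact: lattice_green01.
- by rewrite lattice_green0.
- by rewrite -lattice_green_step.
Qed.

Lemma plane_transient (R : realType) : transient (conductance_walk (@plane_law R)).
Proof.
move=> a disp W P Y mc.
have pE := @conductance_walkE _ _ _ (stirring_law_symmetric plane_swapK (@plane_bias01 R) (@plane_bias_sum R)).
apply: (never_returns_gt0 pE mc (B := 8)) => N.
apply: le_trans (@inverse_square_sum R N); apply: ler_sum => k _.
(* The number of digits is chosen according to [k]: every fixed number of digits gives a valid
   supersolution. *)
apply: le_trans (@plane_green_le R a k).
apply: (Ex_return_le pE mc) => [n x||n x].
- exact: plane_green01.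
- by rewrite plane_green0.
- by rewrite -plane_green_step.
Qed.

Unset Implicit Arguments.

Theorem theorem1p12 (R : realType) :
  (forall d : nat, (3 <= d)%N ->
   exists mu : probability (borel_sym 'rV[int]_d) R,
     [/\ symmetric_law mu,
         transient (conductance_walk mu),
         (exists b B : R, [/\ 0 < b, 0 < B &
            forall x y : 'rV[int]_d,
              conductance_walk mu x y <= B * expR (- (b * norm2 R (x - y)))]) &
         forall (disp : measure_display) (Omega : measurableType disp)
           (P : probability Omega R)
           (s : nat -> {RV P >-> borel_sym 'rV[int]_d}),
         iid_law mu s ->
         let O := inverted_orbit_card s 0 in
         let q := never_returns P (fun n w => walk s n w 0) 0 in
         (exists2 o : nat -> R, (fun n => o n / n%:R) @ \oo --> (0 : R) &
            forall n : nat,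
              ((expR (- (n%:R * ln 2 * q) + o n))%:E <= half_pow_mean P O n)%E) /\
         (forall n : nat,
            (half_pow_mean P O n <= (expR (- ((n%:R + 1) / 2 * q)))%:E)%E)])
  /\
  (exists mu : probability (borel_sym 'rV[int]_2) R,
     [/\ symmetric_law mu,
         (exists2 k : 'rV[int]_2 -> R,
            summable [set: 'rV[int]_2] (fun z => (k z)%:E) &
            forall x y : 'rV[int]_2, conductance_walk mu x y <= k (x - y)) &
         forall (disp : measure_display) (Omega : measurableType disp)
           (P : probability Omega R)
           (s : nat -> {RV P >-> borel_sym 'rV[int]_2}),
         iid_law mu s ->
         let O := inverted_orbit_card s 0 in
         ~ slow_orbits P O /\ ~ subexponential_mean P O]).
Proof.
split=> [d d3|].
  exists (lattice_law d); have sym := stirring_law_symmetric (@lattice_swapK d) (@lattice_bias01 R d) (@lattice_bias_sum R d).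
  split => //.
  - exact: lattice_transient.
  - exists 1, (expR (4 * d%:R)); split; [exact: ltr01|exact: expR_gt0|move=> x y].
    by rewrite conductance_walkE//; exact: lattice_kernel_le.
  - move=> disp W P s iid; apply: (orbit_bounds 0 iid).
    exact: stirring_law_negdep (@lattice_swapK d) (@lattice_bias01 R d) (@lattice_bias_sum R d).
exists plane_law; have sym := stirring_law_symmetric plane_swapK (@plane_bias01 R) (@plane_bias_sum R).
split => //.
  exists (@plane_kernel_bound R); first exact: plane_kernel_bound_summable.
  by move=> x y; rewrite conductance_walkE//; exact: plane_kernel_le.
move=> disp W P s iid O.
have nd := stirring_law_negdep plane_swapK (@plane_bias01 R) (@plane_bias_sum R).
(* Transience is applied to the one-point motion of the origin, which makes the exponential rate in
   the upper bound positive. *)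
have q0 := plane_transient (iid_markov sym iid 0).
by split; [exact: not_slow_orbits iid nd q0|exact: not_subexponential_mean iid nd q0].
Qed.
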